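(* Let $\alpha>0$, $p\ge 0$, $\beta>0$, $C\ge 1$, let $\tau_n>0$ satisfy $n\tau_n^2\to\infty$, let $\lambda_i=\tau_n^2 i^{-1-2\alpha}$ and $C^{-1}i^{-p}\le\kappa_i\le C i^{-p}$ for all $i\in\mathbb N$. Let $L$ be an $N(0,\Lambda)$-measurable linear functional whose representer $(l_i)$ satisfies $|l_i|=i^{-q-1/2}\mathcal S(i)$ for all $i$, for a slowly varying function $\mathcal S$ and some $q$ with $-\beta<q<p$. Let $\gamma\in(0,1)$ and let $\tilde\tau_n$ be the balancing scaling rate defined in the context. Then the asymptotic coverage of the credible interval $LAY\pm z_{\gamma/2}s_n$ for $L\mu$ is: (i) in $(1-\gamma,1)$, uniformly in $\mu_0$ such that $\|\mu_0\|_\beta\le1$, if $\tau_n\gg\tilde\tau_n$. (ii) in $(1-\gamma,1)$, for every $\mu_0\in S^\beta$, if $\tau_n\asymp\tilde\tau_n$ and $\beta+q<1+2\alpha+2p$; and, for any $c\in(0,1)$, in $(0,c)$ along some sequence $\mu_0^n$ with $\sup_n\|\mu_0^n\|_\beta<\infty$, if $\tau_n\asymp\tilde\tau_n$. (iii) $0$ along some sequence $\mu_0^n$ with $\sup_n\|\mu_0^n\|_\beta<\infty$, if $\tau_n\ll\tilde\tau_n$. In case (iii) the sequence $\mu_0^n$ can be taken a fixed element $\mu_0$ in $S^\beta$ if $\tau_n\lesssim n^{-\delta}\tilde\tau_n$ for some $\delta>0$. Furthermore, if $\tau_n\equiv1$, then the coverage takes the form as in (i), (ii) and (iii) if $\alpha<\beta-1/2$,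 $\alpha=\beta-1/2$ and $\alpha>\beta-1/2$, respectively, where in case (iii) the sequence $\mu_0^n$ can be taken a fixed element of $S^\beta$.
   Context: Setting. $H_1,H_2$ are separable Hilbert spaces with norms $\|\cdot\|_1,\|\cdot\|_2$ and inner products $\langle\cdot,\cdot\rangle_1,\langle\cdot,\cdot\rangle_2$; $K:H_1\to H_2$ is a known injective continuous linear operator with adjoint $K^T$. For $\mu\in H_1$ one observes $Y=K\mu+n^{-1/2}Z$, $Z$ the iso-Gaussian process of $H_2$; this means that $Y=(Y_h:h\in H_2)$ is a Gaussian process with $\mathrm E Y_h=\langle K\mu,h\rangle_2$ and $\mathrm{cov}(Y_h,Y_{h'})=n^{-1}\langle h,h'\rangle_2$. $\mathrm P_{\mu_0}$ is the probability when $\mu=\mu_0$. For a continuous linear $B:H_2\to H_1$, $BY$ is the process $(BY)_h=Y_{B^Th}$, $h\in H_1$, identified with a random element of $H_1$ when such an element exists with $\langle BY,h\rangle_1=(BY)_h$. Prior and posterior. The prior on $\mu$ is the Gaussian distribution $N(0,\Lambda)$ on $H_1$. The operators $K^TK$ and $\Lambda$ have the same eigenfunctions $(e_i)_{i\in\mathbb N}$, an orthonormal basis of $H_1$, with eigenvalues $(\kappa_i^2)$ and $(\lambda_i)$, respectively ($\kappa_i>0$); the prior may depend on $n$ through $\tau_n$. The posterior is $N(AY,S_n)$ with $A=\Lambda K^T(n^{-1}I+K\Lambda K^T)^{-1}$ and $S_n=\Lambda-A(n^{-1}I+K\Lambda K^T)A^T$. Write $Ke_i=\kappa_if_i$ and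 $Y_i=Y_{f_i}$; the $Y_i$ are independent $N(\kappa_i\mu_i,1/n)$. Linear functionals. An $N(0,\Lambda)$-measurable linear functional is a Borel measurable map $L:H_1\to\mathbb R$ that is linear on a measurable linear subspace $\underline H_1\subset H_1$ with $N(0,\Lambda)(\underline H_1)=1$. Then $L\Lambda^{1/2}:H_1\to\mathbb R$ is a continuous linear map, identified with an element of $H_1$ with coordinates $((L\Lambda^{1/2})_i)$ relative to $(e_i)$; the representer of $L$ is the sequence $l_i=(L\Lambda^{1/2})_i/\sqrt{\lambda_i}$ (so $\sum_il_i^2\lambda_i<\infty$). The posterior distribution of $L\mu$ is $N(LAY,s_n^2)$ with $LAY=\sum_i l_in\lambda_i\kappa_iY_i/(1+n\lambda_i\kappa_i^2)$ and $s_n^2=\sum_il_i^2\lambda_i/(1+n\lambda_i\kappa_i^2)$. For $\mu_0\in S^\beta$, $L\mu_0$ is understood as $\sum_il_i\mu_{0,i}$, with $\mu_{0,i}$ the coordinates of $\mu_0$. Credible interval and coverage. $z_\gamma$ is the (lower) standard normal $\gamma$-quantile. The coverage at $\mu_0$ is $\mathrm P_{\mu_0}(LAY+z_{\gamma/2}s_n\le L\mu_0\le LAY-z_{\gamma/2}s_n)$. ''Asymptotic coverage'' refers to the behaviour as $n\to\infty$: it is ''in an interval $(a,b)$'' if the liminf and limsup of the coverage are both in $(a,b)$ (uniformly: liminf of the infimum and limsup of the supremum over the indicated $\mu_0$), and ''is $0$'' if the coverage tends to $0$. Along a sequence $\mu_0^n$, the coverage for each $n$ is computed with $\mu_0=\mu_0^n$.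 The rate $\tilde\tau_n$. For a scaling $\tau_n$ put $\rho_n=(n\tau_n^2)^{1/(1+2\alpha+2p)}$; $\gamma_n^2=\mathcal S^2(\rho_n)$, $\sum_{i\le\rho_n}\mathcal S^2(i)/i$, or $1$ according as $\beta+q<$, $=$, or $>1+2\alpha+2p$; and $\delta_n^2=\mathcal S^2(\rho_n)$ (as $q<p$). Then $\tilde\tau_n$ is the scaling $\tau_n$ that equates the two quantities $(n\tau_n^2)^{-\left(\frac{\beta+q}{1+2\alpha+2p}\wedge1\right)}\gamma_n$ and $\tau_n(n\tau_n^2)^{-\left(\frac{1/2+\alpha+q}{1+2\alpha+2p}\wedge\frac12\right)}\delta_n$. It satisfies $\tilde\tau_n\asymp n^{(1/2+\alpha-\tilde\beta)/(2\tilde\beta+2p)}\eta_n$ for a slowly varying factor $\eta_n$, where $\tilde\beta=\beta\wedge(1+2\alpha+2p-q)$. Sobolev space. For $\mu=\sum_i\mu_ie_i$, $\|\mu\|_\beta^2=\sum_i\mu_i^2i^{2\beta}$ and $S^\beta=\{\mu\in H_1:\|\mu\|_\beta<\infty\}$. Notation. $a\wedge b=\min(a,b)$; $a_n\asymp b_n$ means $|a_n/b_n|$ is bounded away from $0$ and $\infty$ as $n\to\infty$; $a_n\lesssim b_n$ means $a_n/b_n$ is bounded; $a_n\ll b_n$, equivalently $b_n\gg a_n$, means $a_n/b_n\to0$. A (Borel measurable) function $\mathcal S:[0,\infty)\to\mathbb R$ is slowly varying if $\mathcal S(tx)/\mathcal S(t)\to1$ as $t\to\infty$, for every $x>0$.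
   Formalization: The assumption q > -1/2-α is added; measurability of L already gives q ≥ -1/2-α, and at q = -1/2-α the spread s_n exceeds the standard deviation of LAY by an unbounded factor, so the coverage in (i) tends to 1 and the claim as printed fails. *)

(* Defs.v *)
From HB Require Import structures.
From mathcomp Require Import all_boot all_order all_algebra.
From mathcomp Require Import all_classical all_reals all_analysis.
Set Implicit Arguments.
Unset Strict Implicit.
Unset Printing Implicit Defensive.
Import Order.TTheory GRing.Theory Num.Theory.
Import numFieldNormedType.Exports.
Local Open Scope classical_set_scope.
Local Open Scope ring_scope.

(* Throughout, an index i : nat stands for the natural number i + 1, so that
   powers of the index are powers of i.+1%:R. *)

(* A Hilbert space is a complete normed module whose norm comes from a dot
   product. *)
Definition norm_of_dot (R : realType) (H : normedModType R)
    (ip : {dot H for idfun}) : Prop :=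
  forall x : H, ip x x = `|x| ^+ 2.

Definition separable (T : topologicalType) : Prop :=
  exists D : set T, countable D /\ dense D.

Definition adjoint (R : realType) (H1 H2 : normedModType R)
    (ip1 : {dot H1 for idfun}) (ip2 : {dot H2 for idfun})
    (K : H1 -> H2) (KT : H2 -> H1) : Prop :=
  forall x y, ip2 (K x) y = ip1 x (KT y).

Definition orthonormal_basis (R : realType) (H : normedModType R)
    (ip : {dot H for idfun}) (e : nat -> H) : Prop :=
  (forall i j, ip (e i) (e j) = (i == j)%:R) /\
  (forall x, series (fun i => ip x (e i) *: e i) @ \oo --> x).

Definition sobolev_norm (R : realType) (H : normedModType R)
    (ip : {dot H for idfun}) (e : nat -> H) (beta : R) (mu : H) : \bar R :=
  ((\sum_(0 <= i <oo)
      ((ip mu (e i)) ^+ 2 * i.+1%:R `^ (2 * beta))%:E) `^ 2^-1)%E.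

Definition sobolev_space (R : realType) (H : normedModType R)
    (ip : {dot H for idfun}) (e : nat -> H) (beta : R) : set H :=
  [set mu | (sobolev_norm ip e beta mu < +oo)%E].

Definition sobolev_ball (R : realType) (H : normedModType R)
    (ip : {dot H for idfun}) (e : nat -> H) (beta : R) : set H :=
  [set mu | (sobolev_norm ip e beta mu <= 1)%E].

Definition sobolev_bounded (R : realType) (H : normedModType R)
    (ip : {dot H for idfun}) (e : nat -> H) (beta : R) (mu : nat -> H) : Prop :=
  (ereal_sup (range (fun n => sobolev_norm ip e beta (mu n))) < +oo)%E.

(* N(m, v), including the degenerate case v = 0, for which [normal_prob m 0]
   is not a point mass.  The second argument of [normal_prob] is a standard
   deviation. *)
Definition gaussian_law (R : realType) (m v : R) : set R -> \bar R :=
  if v == 0 then (\d_m : set R -> \bar R) else normal_prob m (Num.sqrt v).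

Definition has_gaussian_law (R : realType) d (T : measurableType d)
    (P : probability T R) (X : T -> R) (m v : R) : Prop :=
  forall A : set R, measurable A -> P (X @^-1` A) = gaussian_law m v A.

Definition gaussian_process (R : realType) d (T : measurableType d)
    (P : probability T R) (I : Type) (Y : I -> T -> R) : Prop :=
  forall (k : nat) (h : 'I_k -> I) (a : 'I_k -> R),
    exists m v : R, 0 <= v /\
      has_gaussian_law P (fun w => \sum_(j < k) a j * Y (h j) w) m v.

(* Under P, the process Y has the law of x + n^(-1/2) Z, where Z is the
   iso-Gaussian process of H. *)
Definition white_noise_model (R : realType) (H : normedModType R)
    (ip : {dot H for idfun}) d (T : measurableType d) (P : probability T R)
    (Y : H -> T -> R) (x : H) (n : nat) : Prop :=
  [/\ gaussian_process P Y,
      forall h, ('E_P[Y h] = (ip x h)%:E)%E &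
      forall h h', covariance P (Y h) (Y h') = (n%:R^-1 * ip h h')%:E].

Definition borel (T : topologicalType) := g_sigma_algebraType (@open T).

(* The Borel probability P on H is the Gaussian distribution N(0, Lam). *)
Definition centered_gaussian (R : realType) (H : normedModType R)
    (ip : {dot H for idfun}) (P : probability (borel H) R)
    (Lam : H -> H) : Prop :=
  forall h : H, has_gaussian_law P (fun x : borel H => ip h x) 0 (ip (Lam h) h).

Definition measurable_linear_functional (R : realType) (H : normedModType R)
    (P : probability (borel H) R) (L : H -> R) : Prop :=
  measurable_fun [set: borel H] (L : borel H -> R) /\
  exists V : set (borel H),
    [/\ measurable V, P V = 1%E, V (0 : H),
        (forall (a : R) (x y : H), V x -> V y -> V (a *: x + y)) &
        (forall (a : R) (x y : H), V x -> V y -> L (a *: x + y) = a * L x + L y)].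

(* z is the (lower) g-quantile of N(0, 1). *)
Definition normal_quantile (R : realType) (g z : R) : Prop :=
  normal_prob 0 1 `]-oo, z] = g%:E.

Definition prior_eigenvalue (R : realType) (alpha tau : R) (i : nat) : R :=
  tau ^+ 2 * i.+1%:R `^ (- 1 - 2 * alpha).

(* [l] is the representer of L: since Lam^(1/2) e_i = sqrt(lam_i) e_i, the
   coordinate (L Lam^(1/2))_i is L (sqrt(lam_i) e_i). *)
Definition representer (R : realType) (H : normedModType R) (L : H -> R)
    (e : nat -> H) (lam : nat -> R) (l : nat -> R) : Prop :=
  forall i, l i = L (Num.sqrt (lam i) *: e i) / Num.sqrt (lam i).

(* The i-th coefficient of LAY relative to Y_i. *)
Definition LA_coef (R : realType) (n : nat) (l lam kappa : nat -> R)
    (i : nat) : R :=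
  l i * (n%:R * lam i * kappa i / (1 + n%:R * lam i * kappa i ^+ 2)).

Definition posterior_sd (R : realType) (n : nat) (l lam kappa : nat -> R) : R :=
  Num.sqrt (limn (series (fun i =>
    (l i) ^+ 2 * lam i / (1 + n%:R * lam i * kappa i ^+ 2)))).

(* L mu, for mu in a Sobolev space. *)
Definition functional_value (R : realType) (H : normedModType R)
    (ip : {dot H for idfun}) (e : nat -> H) (l : nat -> R) (mu : H) : R :=
  limn (series (fun i => l i * ip mu (e i))).

(* [z] is meant to be the gamma/2 quantile, a negative number. *)
Definition coverage (R : realType) d (T : measurableType d)
    (P : probability T R) (X : T -> R) (z s v : R) : \bar R :=
  P [set w | X w + z * s <= v <= X w - z * s].

Definition asymp_small (R : realType) (a b : nat -> R) : Prop :=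
  a n / b n @[n --> \oo] --> (0 : R).

Definition asymp_equiv (R : realType) (a b : nat -> R) : Prop :=
  exists c C : R, 0 < c /\ \forall n \near \oo, c <= `|a n / b n| <= C.

Definition asymp_bounded (R : realType) (a b : nat -> R) : Prop :=
  exists C : R, \forall n \near \oo, `|a n / b n| <= C.

Definition asymp_in (R : realType) (a b : R) (u : nat -> \bar R) : Prop :=
  (a%:E < limn_einf u < b%:E)%E /\ (a%:E < limn_esup u < b%:E)%E.

Definition asymp_in_uniformly (R : realType) (a b : R) (H : Type) (M : set H)
    (u : nat -> H -> \bar R) : Prop :=
  (a%:E < limn_einf (fun n => ereal_inf [set u n mu | mu in M]) < b%:E)%E /\
  (a%:E < limn_esup (fun n => ereal_sup [set u n mu | mu in M]) < b%:E)%E.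

Definition slowly_varying (R : realType) (S : R -> R) : Prop :=
  measurable_fun (`[0, +oo[ : set R) S /\
  forall x : R, 0 < x -> S (t * x) / S t @[t --> +oo] --> (1 : R).

Definition rho (R : realType) (alpha p : R) (n : nat) (t : R) : R :=
  (n%:R * t ^+ 2) `^ (1 + 2 * alpha + 2 * p)^-1.

Definition gam2 (R : realType) (alpha p beta q : R) (S : R -> R)
    (n : nat) (t : R) : R :=
  let r := rho alpha p n t in
  if beta + q < 1 + 2 * alpha + 2 * p then S r ^+ 2
  else if beta + q == 1 + 2 * alpha + 2 * p then
    \sum_(1 <= i < (Num.truncn r).+1) S i%:R ^+ 2 / i%:R
  else 1.

Definition bias_rate (R : realType) (alpha p beta q : R) (S : R -> R)
    (n : nat) (t : R) : R :=
  (n%:R * t ^+ 2) `^ (- Num.min ((beta + q) / (1 + 2 * alpha + 2 * p)) 1)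
  * Num.sqrt (gam2 alpha p beta q S n t).

(* This is the rate for q < p, where delta_n^2 = S(rho_n)^2. *)
Definition spread_rate (R : realType) (alpha p q : R) (S : R -> R)
    (n : nat) (t : R) : R :=
  t * (n%:R * t ^+ 2)
        `^ (- Num.min ((2^-1 + alpha + q) / (1 + 2 * alpha + 2 * p)) 2^-1)
  * Num.sqrt (S (rho alpha p n t) ^+ 2).

Definition scaling (R : realType) (tau : nat -> R) : Prop :=
  (forall n, 0 < tau n) /\ n%:R * tau n ^+ 2 @[n --> \oo] --> +oo.

(* S need not be continuous, and then the two rates may fail to be exactly
   equal for any scaling.  The balancing rate matters only up to [asymp_equiv],
   and so the two rates are equated up to [asymp_equiv]; exact equality for
   large n is a particular case. *)
Definition balancing_scaling (R : realType) (alpha p beta q : R) (S : R -> R)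
    (ttau : nat -> R) : Prop :=
  scaling ttau /\
  asymp_equiv (fun n => bias_rate alpha p beta q S n (ttau n))
              (fun n => spread_rate alpha p q S n (ttau n)).

(* Main.v *)
Require Import Defs.
From HB Require Import structures.
From mathcomp Require Import all_boot all_order all_algebra.
From mathcomp Require Import all_classical all_reals all_analysis.
From mathcomp Require Import measurable_realfun ring lra.

(** The posterior for L mu is Gaussian, and so is the law of LAY: as a sum of
    independent Gaussian variables, LAY has law N(m_n, t_n^2).  Writing
    x_i = n lambda_i kappa_i^2, which is of the order (rho_n / i)^a with
    a = 1 + 2 alpha + 2 p, the bias, the posterior variance and the variance of
    LAY are
      B_n = L mu_0 - m_n = sum_i l_i mu_(0,i) / (1 + x_i),
      s_n^2 = sum_i l_i^2 lambda_i / (1 + x_i),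
      t_n^2 = sum_i l_i^2 lambda_i x_i / (1 + x_i)^2,
    and the coverage equals
      Phi ((B_n - z s_n) / t_n) - Phi ((B_n + z s_n) / t_n).
    This is coverage_white_noise; everything else is the comparison of B_n with
    t_n.

    The sums are estimated with the bounds of Potter for slowly varying
    functions, A y <= C A x max (y / x, x / y)^eps.  They give that s_n and t_n
    are both of the order sigma_n = n^(-1/2) rho_n^(p - q) |S rho_n|, while
    s_n / t_n stays above a constant r > 1: the difference s_n^2 - t_n^2 is
    itself of the order sigma_n^2 (spread_limits).  By the Cauchy-Schwarz
    inequality the largest bias over the Sobolev unit ball is of the order of
    the bias rate b_n (bias_bound, bias_extremal); a fixed element with
    coordinates sgn (l_i) i^(-beta - 1/2 - eps) has a bias of order at least
    rho_n^(- eps) b_n (bias_fixed); and if beta + q < a the bias at a fixed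
    element is of smaller order than b_n (bias_fixed_small), since only the
    coordinates near rho_n matter and their share of the Sobolev norm
    vanishes.

    The coverage is therefore decided by R_n = b_n / sigma_n.  If R_n tends to
    0, or at a fixed element with beta + q < a if it is bounded, the bias is
    negligible, and the interval, being wider than the 1 - gamma interval of an
    unbiased estimator by a factor between r and a larger constant, covers with
    probability eventually between two constants in (1 - gamma, 1)
    (coverage_uniform, coverage_fixed).  If R_n is bounded and bounded away from
    0, a multiple of the extremal elements lifts B_n / t_n above any prescribed
    level while keeping it bounded (coverage_critical).  If R_n tends to
    infinity the coverage vanishes along the extremal elements
    (coverage_worst), and even at a fixed element if R_n outgrows a
    power of rho_n (coverage_worst_fixed).

    Finally R_n = n^(1/2) h (rho_n), where h is a slowly varying function
    times a negative power of rho (bias_spread_ratio, rate_ratio_potter), and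
    rho_n is a power of n tau_n^2.  Hence R_n decreases in tau_n at a
    polynomial rate.  As R_n is of order one at the balancing scaling, its
    behaviour at tau_n is read off from tau_n / ttau_n. *)

Set Implicit Arguments.
Unset Strict Implicit.
Unset Printing Implicit Defensive.
Import Order.TTheory GRing.Theory Num.Theory.
Import numFieldNormedType.Exports.
Local Open Scope classical_set_scope.
Local Open Scope ring_scope.

(** * Moments of a Gaussian law *)

(** The Radon-Nikodym derivative of the normal law equals its density almost
    everywhere, because both have the same integrals over measurable sets. *)
Lemma ge0_integral_normal_prob (R : realType) (m s : R) (f : R -> \bar R) :
  measurable_fun [set: R] f -> (forall x, 0 <= f x)%E ->
  (\int[normal_prob m s]_x f x =
   \int[lebesgue_measure]_x (f x * (normal_pdf m s x)%:E))%E.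
Proof.
move=> mf f0.
have dom := normal_prob_dominates m s.
rewrite -(Radon_Nikodym_SigmaFinite.change_of_variables dom)//=.
apply: ae_eq_integral => //.
- apply: emeasurable_funM => //.
  apply: (measurable_int (@lebesgue_measure R)).
  exact: Radon_Nikodym_SigmaFinite.f_integrable.
- apply: emeasurable_funM => //; apply/measurable_EFinP.
  exact: measurable_normal_pdf.
- apply: ae_eqe_mul2l.
  apply: integral_ae_eq => //.
  + exact: Radon_Nikodym_SigmaFinite.f_integrable.
  + apply/measurable_EFinP; exact: measurable_normal_pdf.
  + by move=> E _ mE; rewrite -Radon_Nikodym_SigmaFinite.f_integral.
Qed.

Lemma continuous_gauss_mul (R : realType) (G : R -> R) : continuous G ->
  continuous (fun u => G u * gauss_fun u).
Proof.
by move=> cG x; apply: cvgM; [exact: cG|exact: continuous_gauss_fun].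
Qed.

(** Expresses every normal density through [gauss_fun], the function exp (-
    x^2), whose integral is known. *)
Lemma normal_pdf_gauss (R : realType) (m s : R) (x : R) : 0 < s ->
  normal_pdf m s x =
  gauss_fun ((x - m) / (s * Num.sqrt 2)) / (s * Num.sqrt 2) / Num.sqrt pi.
Proof.
move=> s0; rewrite normal_pdfE ?gt_eqF// /normal_peak /normal_fun /gauss_fun.
have -> : Num.sqrt (s ^+ 2 * pi *+ 2) = s * Num.sqrt 2 * Num.sqrt pi.
  have h2 : 0 <= s ^+ 2 by exact: sqr_ge0.
  have hpi : 0 <= s ^+ 2 * pi by rewrite mulr_ge0// pi_ge0.
  rewrite -[_ *+ 2]mulr_natr (sqrtrM _ hpi) (sqrtrM _ h2).
  by rewrite sqrtr_sqr gtr0_norm// mulrAC.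
have -> : ((x - m) / (s * Num.sqrt 2)) ^+ 2 = (x - m) ^+ 2 / (s ^+ 2 *+ 2).
  by rewrite expr_div_n exprMn sqr_sqrtr// mulr_natr.
by rewrite mulNr invfM mulrC mulrA.
Qed.

(** Standardization with the substitution u = (x - m) / (s sqrt 2), which
    reduces Gaussian integrals to integrals against exp (- u^2). *)
Lemma ge0_integral_normal_pdf (R : realType) (m s : R) (G : R -> R) : 0 < s ->
  continuous G -> (forall x, 0 <= G x) ->
  (\int[lebesgue_measure]_x
     (G ((x - m) / (s * Num.sqrt 2)) * normal_pdf m s x)%:E =
   \int[lebesgue_measure]_x (G x * gauss_fun x / Num.sqrt pi)%:E)%E.
Proof.
move=> s0 cG G0.
have t0 : 0 < s * Num.sqrt 2 by rewrite mulr_gt0// sqrtr_gt0.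
set t := s * Num.sqrt 2 in t0 *.
pose F (x : R^o) : R^o := (x - m) / t.
have F'E : F^`()%classic = cst t^-1.
  apply/funext => x; rewrite /F derive1E deriveM// deriveD// derive_cst scaler0.
  by rewrite add0r derive_id derive_cst addr0 scaler1.
rewrite [RHS](@increasing_ge0_integration_by_substitutionT _ F).
- apply: eq_integral => x _; congr EFin; rewrite ?fctE /=.
  rewrite normal_pdf_gauss// -/t F'E !fctE /= /F.
  by rewrite -!mulrA; congr (_ * (_ * _)); rewrite mulrC.
- by move=> x y xy; rewrite /F ltr_pM2r ?invr_gt0// ltrD2r.
- by rewrite F'E => ?; exact: cvg_cst.
- by rewrite F'E; exact: is_cvg_cst.
- by rewrite F'E; exact: is_cvg_cst.
- by move=> x; rewrite /F.
- by apply/gt0_cvgMlNy; [rewrite invr_gt0|exact: cvg_addrr_Ny].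
- by apply/gt0_cvgMly; [rewrite invr_gt0|exact: cvg_addrr].
- move=> x; apply: cvgM; last exact: cvg_cst.
  exact: continuous_gauss_mul.
- by move=> x; rewrite mulr_ge0 ?invr_ge0 ?sqrtr_ge0// mulr_ge0// gauss_fun_ge0.
Qed.

Section gaussian_second_moment.
Import gauss_integral_proof.

(** The Gaussian integral, as the square root of its square. *)
Lemma cvg_integral0_gauss (R : realType) :
  @integral0_gauss R x @[x --> +oo] --> Num.sqrt pi / 2.
Proof.
have : Num.sqrt (@integral0_gauss R x ^+ 2) @[x --> +oo] --> Num.sqrt (pi / 4).
  apply: continuous_cvg; last exact: cvg_integral0_gauss_sqr.
  exact: sqrt_continuous.
rewrite sqrtrM ?pi_ge0// sqrtrV// (_ : 4 = 2 ^+ 2); last by rewrite expr2 -natrM.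
rewrite sqrtr_sqr ger0_norm// (_ : (fun _ => Num.sqrt _) = integral0_gauss)//.
by apply/funext => r; rewrite sqrtr_sqr// ger0_norm// integral0_gauss_ge0.
Qed.

Lemma is_derive_integral0_gauss (R : realType) (x : R) : 0 < x ->
  is_derive x (1 : R) (@integral0_gauss R) (gauss_fun x).
Proof.
move=> x0.
have xx1 : x < x + 1 by rewrite ltrDl.
have [|dI dIE] := continuous_FTC1_closed xx1 _ x0 (@continuous_gauss_fun R x).
  apply: continuous_compact_integrable; first exact: segment_compact.
  by apply/continuous_subspaceT; exact: continuous_gauss_fun.
apply: DeriveDef; first exact: dI.
by rewrite -derive1E dIE.
Qed.

Lemma is_derive_gauss_fun (R : realType) (x : R) :
  is_derive x (1 : R) (@gauss_fun R) (- 2 * x * gauss_fun x).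
Proof.
rewrite /gauss_fun; apply: is_derive_eq.
by rewrite /GRing.scale/= ; ring.
Qed.

Lemma cvg_mul_gauss (R : realType) : x * gauss_fun x @[x --> +oo] --> (0 : R).
Proof.
apply: (@squeeze_cvgr _ _ _ _ (fun=> 0) (fun x : R => x^-1)); last 2 first.
- exact: cvg_cst.
- apply: (iffRL (@gtr0_cvgV0 R R +oo _ id _)); last exact: cvg_id.
  exact: nbhs_pinfty_gt.
near=> x.
have x0 : 0 < x by [].
rewrite mulr_ge0 ?gauss_fun_ge0 ?ltW//= /gauss_fun expRN.
rewrite ltr_pdivrMr ?expR_gt0// ltr_pdivlMl//.
apply: lt_le_trans (expR_ge1Dx _).
by rewrite expr2 ltrDr.
Unshelve. all: by end_near. Qed.

(** Integration by parts: the function 1/2 (int_0^x exp (- u^2) du - x exp (-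
    x^2)) is a primitive of x^2 exp (- x^2). *)
Lemma integral_sqr_gauss (R : realType) :
  (\int[lebesgue_measure]_x (x ^+ 2 * gauss_fun x)%:E
   = (@Num.sqrt R pi / 2)%:E)%E.
Proof.
have cf : continuous (fun x : R => x ^+ 2 * gauss_fun x).
  by apply: continuous_gauss_mul; exact: exprn_continuous.
rewrite ge0_symfun_integralT//=; last 2 first.
- by move=> x; rewrite mulr_ge0 ?sqr_ge0 ?gauss_fun_ge0.
- by move=> x/=; rewrite sqrrN /gauss_fun sqrrN.
rewrite (_ : [set x | _] = `[0, +oo[%classic); last first.
  by apply/seteqP; split => x/=; rewrite in_itv/= andbT.
pose F := fun x : R => 2^-1 * (integral0_gauss x - x * gauss_fun x).
have dF (x : R) : 0 < x -> is_derive x (1 : R) F (x ^+ 2 * gauss_fun x).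
  move=> x0.
  have d1 := @is_derive_integral0_gauss R x x0.
  have d2 := is_derive_gauss_fun x.
  by rewrite /F; apply: is_derive_eq; rewrite /GRing.scale/=; field.
rewrite (@ge0_continuous_FTC2y _ _ F 0 (Num.sqrt pi / 4)).
- rewrite /F /integral0_gauss set_itv1 Rintegral_set1 mul0r subr0 mulr0 sube0.
  by rewrite -EFinM; congr EFin; field.
- by move=> x _; rewrite mulr_ge0 ?sqr_ge0 ?gauss_fun_ge0.
- exact: continuous_subspaceT.
- rewrite (_ : _ / 4 = 2^-1 * (Num.sqrt pi / 2 - 0)); last by field.
  apply: cvgM; first exact: cvg_cst.
  by apply: cvgB; [exact: cvg_integral0_gauss|exact: cvg_mul_gauss].
- by move=> x x0; have [] := dF x x0.
- have I0 : integral0_gauss 0 = 0 :> R.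
    by rewrite /integral0_gauss set_itv1 Rintegral_set1.
  rewrite /F I0; apply: cvg_at_right_filter.
  apply: cvgM; first exact: cvg_cst.
  apply: cvgB.
    apply: (@parameterized_integral_cvg_left R 0 1) => //.
    apply: continuous_compact_integrable; first exact: segment_compact.
    by apply/continuous_subspaceT; exact: continuous_gauss_fun.
  by apply: cvgM; [exact: cvg_id|exact: continuous_gauss_fun].
- by move=> x; rewrite in_itv/= andbT => x0; rewrite derive1E; have [] := dF x x0.
Qed.

End gaussian_second_moment.

(** The positive and the negative part of the odd function x exp (- x^2) have
    the same integral, whence Gaussian variables are centred at their
    parameter m. *)
Lemma integral_max_gauss_sym (R : realType) :
  (\int[lebesgue_measure]_x (Num.max x 0 * gauss_fun x / @Num.sqrt R pi)%:E =
   \int[lebesgue_measure]_x (Num.max (- x) 0 * gauss_fun x / @Num.sqrt R pi)%:E)%E.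
Proof.
pose G := fun x : R => Num.max (- x) 0 * gauss_fun x / @Num.sqrt R pi.
have G0 x : 0 <= G x.
  by rewrite mulr_ge0 ?invr_ge0 ?sqrtr_ge0// mulr_ge0 ?gauss_fun_ge0// le_max lexx orbT.
have cG : continuous G.
  move=> x; apply: cvgM; last exact: cvg_cst.
  apply: cvgM; last exact: continuous_gauss_fun.
  apply: (@continuous_max _ _ (fun x : R => - x) (fun=> 0)); last exact: cvg_cst.
  by apply: cvgN; exact: cvg_id.
transitivity (\int[lebesgue_measure]_(x in `]-oo, (- (0 : R))%R]) (G x)%:E)%E.
  rewrite ge0_integration_by_substitutionNy//; last exact: continuous_subspaceT.
  rewrite [RHS]integral_mkcond; apply: eq_integral => x _.
  rewrite patchE mem_setE in_itv/= andbT /G /= opprK /gauss_fun sqrrN.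
  by case: ifPn => //; rewrite -ltNge => /ltW x0; rewrite max_r// !mul0r.
rewrite [LHS]integral_mkcond; apply: eq_integral => x _.
rewrite patchE mem_setE in_itv/= oppr0 /G /=.
by case: ifPn => //; rewrite -ltNge => /ltW x0; rewrite max_r ?oppr_le0// !mul0r.
Qed.

Section law.
Context d (T : measurableType d) (R : realType) (P : probability T R).

Lemma ge0_integral_gaussian_law (X : {mfun T >-> R}) (m v : R) (G : R -> R) :
  0 < v -> has_gaussian_law P X m v -> continuous G -> (forall x, 0 <= G x) ->
  (\int[P]_w (G ((X w - m) / (Num.sqrt v * Num.sqrt 2)))%:E =
   \int[lebesgue_measure]_x (G x * gauss_fun x / Num.sqrt pi)%:E)%E.
Proof.
move=> v0 hX cG G0.
have s0 : 0 < Num.sqrt v by rewrite sqrtr_gt0.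
have mG : measurable_fun setT G by exact: continuous_measurable_fun.
pose f x : \bar R := (G ((x - m) / (Num.sqrt v * Num.sqrt 2)))%:E.
have mf : measurable_fun [set: R] f.
  apply/measurable_EFinP; apply: measurableT_comp => //.
  by apply: measurable_funM => //; exact: measurable_funB.
have f0 x : (0 <= f x)%E by rewrite lee_fin.
have mX : @measurable_fun _ _ T (measurableTypeR R) setT X.
  have h : measurable_fun setT (X : T -> R) by [].
  by move=> mT B mB; exact: (h mT B mB).
pose X' : {mfun T >-> measurableTypeR R} := @mfun_Sub _ _ T (measurableTypeR R) (X : T -> R) (mem_set mX).
rewrite -(@ge0_integral_distribution _ _ _ _ _ P X' f mf f0).
have -> : (\int[distribution P X']_y f y = \int[normal_prob m (Num.sqrt v)]_y f y)%E.
  apply: (@eq_measure_integral _ (measurableTypeR R) R setT) => A mA _.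
  by have := hX A mA; rewrite /gaussian_law gt_eqF.
rewrite ge0_integral_normal_prob// -(ge0_integral_normal_pdf m s0 cG G0).
by apply: eq_integral => x _.
Qed.

Lemma Lfun2_sqr (X : T -> R) : measurable_fun setT X ->
  (\int[P]_w (X w ^+ 2)%:E < +oo)%E -> X \in Lfun P 2%:E.
Proof.
move=> mX h; rewrite inE; apply/andP; split; rewrite inE//=.
rewrite /finite_norm unlock /=.
rewrite (_ : (fun x => _) = (fun x => (X x ^+ 2)%:E)) ?poweR_lty//.
by apply/funext => x; rewrite powR_mulrn// real_normK// num_real.
Qed.

Lemma Lfun2_add (f g : T -> R) : f \in Lfun P 2%:E -> g \in Lfun P 2%:E ->
  f \+ g \in Lfun P 2%:E.
Proof.
move=> hf hg; have h12 : (1 <= 2%:E :> \bar R)%E by rewrite lee_fin ler1n.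
by rewrite rpredD.
Qed.

(** The parameters of a Gaussian law are its mean and variance. This is what
    identifies the law of the partial sums of LAY: a Gaussian process only
    asserts that some parameters exist, and the model prescribes the moments.
    *)
Lemma gaussian_law_moments (X : {mfun T >-> R}) (m v : R) :
  0 <= v -> has_gaussian_law P X m v ->
  [/\ (X : T -> R) \in Lfun P 2%:E, 'E_P[X] = m%:E & 'V_P[X] = v%:E]%E.
Proof.
rewrite le_eqVlt => /orP[/eqP <-|v0] hX.
  have Xm : {ae P, forall w, X w = m}.
    exists (X @^-1` (~` [set m])); split.
    - by rewrite -[_ @^-1` _]setTI; apply: measurable_funP => //; exact: measurableC.
    - rewrite hX; last exact: measurableC.
      by rewrite /gaussian_law eqxx diracE memNset//=; apply.
    - by [].
  have aeX (f : R -> R) : measurable_fun setT f ->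
      (\int[P]_w (f (X w))%:E = (f m)%:E)%E.
    move=> mf; rewrite (ae_eq_integral (cst (f m)%:E))//.
    - by rewrite integral_cst// -[RHS]mule1; congr (_ * _)%E; exact: probability_setT.
    - by apply/measurable_EFinP; exact: measurableT_comp.
    - by apply: filterS Xm => w /= -> _.
  have L2 : (X : T -> R) \in Lfun P 2%:E.
    apply: Lfun2_sqr => //.
    by rewrite (aeX (fun x => x ^+ 2)) ?ltry.
  have EX : ('E_P[X] = m%:E)%E by rewrite unlock (aeX id).
  split => //.
  rewrite /variance unlock EX /= unlock.
  rewrite (aeX (fun x => (x - m) * (x - m))) ?subrr ?mul0r//.
  by apply: measurable_funM => //; exact: measurable_funB.
have s0 : 0 < Num.sqrt v * Num.sqrt 2 by rewrite mulr_gt0// sqrtr_gt0.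
set s := Num.sqrt v * Num.sqrt 2 in s0.
have tr := ge0_integral_gaussian_law v0 hX; rewrite -/s in tr.
have U2 : (\int[P]_w (((X w - m) / s) ^+ 2)%:E = 2^-1%:E)%E.
  rewrite (tr (fun x => x ^+ 2) (@exprn_continuous _ 2) (fun x => sqr_ge0 x)).
  under eq_integral do rewrite EFinM.
  rewrite ge0_integralZr//=; last 2 first.
  - apply/measurable_EFinP; apply: continuous_measurable_fun.
    by apply: continuous_gauss_mul; exact: exprn_continuous.
  - by move=> x _; rewrite lee_fin mulr_ge0 ?sqr_ge0 ?gauss_fun_ge0.
  rewrite integral_sqr_gauss -EFinM; congr EFin.
  by rewrite mulrAC divff ?mul1r// gt_eqF// sqrtr_gt0 pi_gt0.
have mU : measurable_fun setT (fun w => (X w - m) / s).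
  by apply: measurable_funM => //; exact: measurable_funB.
have UL : (fun w => (X w - m) / s) \in Lfun P 2%:E.
  by apply: Lfun2_sqr => //; rewrite U2 ltry.
have UL1 := Lfun_subset12 (fin_num_measure P _ measurableT) UL.
have EU : (\int[P]_w ((X w - m) / s)%:E = 0)%E.
  have cmax (g : R -> R) : continuous g -> continuous (fun x => Num.max (g x) 0).
    by move=> cg x; apply: (@continuous_max _ _ g (fun=> 0)); [exact: cg|exact: cvg_cst].
  have m0 (g : R -> R) x : 0 <= Num.max (g x) 0 by rewrite le_max lexx orbT.
  have hp := tr (fun x => Num.max x 0) (cmax id (fun x => cvg_id)) (m0 id).
  have cN : continuous (fun x : R => - x) by move=> x; apply: cvgN; exact: cvg_id.
  have hn := tr (fun x => Num.max (- x) 0) (cmax _ cN) (m0 -%R).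
  rewrite integralE.
  rewrite [X in (X - _)%E](_ : _ = \int[P]_w (Num.max ((X w - m) / s) 0)%:E)%E; last first.
    by apply: eq_integral => w _; rewrite funepos.unlock /= EFin_max.
  rewrite [X in (_ - X)%E](_ : _ = \int[P]_w (Num.max (- ((X w - m) / s)) 0)%:E)%E; last first.
    by apply: eq_integral => w _; rewrite funeneg.unlock /= EFin_max EFinN.
  rewrite hn hp integral_max_gauss_sym subee// -hn.
  have := Lfun1_integrable P (fun w => (X w - m) / s).
  move=> [/(_ UL1) + _] => /integrable_funeneg - /(_ measurableT) /integrable_fin_num.
  move=> /(_ measurableT); congr (_ \is a fin_num).
  by apply: eq_integral => w _; rewrite funeneg.unlock /= EFin_max EFinN.
have XE : (X : T -> R) = (s \o* (fun w => (X w - m) / s)) \+ cst m.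
  by apply/funext => w /=; rewrite divfK ?subrK// gt_eqF.
have sUL : s \o* (fun w => (X w - m) / s) \in Lfun P 2%:E.
  by apply: Lfun_scale; rewrite ?ler1n.
have XL : (X : T -> R) \in Lfun P 2%:E.
  have cL : cst m \in Lfun P 2%:E by exact: Lfun_cst.
  by rewrite XE; exact: Lfun2_add.
have EX : ('E_P[X] = m%:E)%E.
  rewrite XE expectationD ?Lfun_cst//; last first.
    exact: (Lfun_subset12 (fin_num_measure P _ measurableT) sUL).
  by rewrite expectationZl// expectation_cst [X in (_ * X)%E](_ : _ = 0%E) ?mule0 ?add0e// unlock.
split => //.
rewrite /variance unlock EX /= unlock.
have -> : (\int[P]_w (((X \- cst m) * (X \- cst m)) w)%:E =
    \int[P]_w ((s ^+ 2)%:E * (((X w - m) / s) ^+ 2)%:E))%E.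
  apply: eq_integral => w _; rewrite -EFinM; congr EFin => /=.
  have -> : ((X \- cst m) * (X \- cst m)) w = (X w - m) * (X w - m) by [].
  by field; rewrite gt_eqF.
rewrite ge0_integralZl//=; last 3 first.
- by apply/measurable_EFinP; exact: measurable_funX.
- by move=> x _; rewrite lee_fin sqr_ge0.
- by rewrite lee_fin sqr_ge0.
rewrite U2 -EFinM /s exprMn !sqr_sqrtr ?ltW//; congr EFin.
by rewrite -mulrA divff ?mulr1.
Qed.
End law.

(** * The standard normal distribution function *)

Definition Phi (R : realType) (x : R) : R := fine (normal_prob 0 1 `]-oo, x]).

Lemma PhiE (R : realType) (x : R) : normal_prob 0 1 `]-oo, x] = (Phi x)%:E.
Proof. by rewrite /Phi fineK// fin_num_measure. Qed.

Lemma Phi_itv (R : realType) (x y : R) : x <= y ->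
  normal_prob 0 1 `]x, y] = (Phi y - Phi x)%:E.
Proof.
move=> xy; have : (normal_prob 0 1 `]-oo, y] = normal_prob 0 1 `]-oo, x] + normal_prob (0 : R) 1 `]x, y])%E.
  rewrite -measureU//=.
    by congr (normal_prob _ _ _); rewrite -itv_bndbnd_setU//= bnd_simp.
  apply/seteqP; split => // u [] /=; rewrite !in_itv/= => ux /andP[xu _].
  by move: (lt_le_trans xu ux); rewrite ltxx.
rewrite !PhiE => h; rewrite EFinB h addeAC subee ?add0e//.
Qed.

Lemma lebesgue_itv_oc (R : realType) (x y : R) : x <= y ->
  lebesgue_measure `]x, y] = (y - x)%:E.
Proof.
move=> xy; rewrite lebesgue_measure_itv/= lte_fin -EFinB.
by case: ltgtP xy => // -> _; rewrite subrr.
Qed.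

(** On [-A, A] the normal density is at least its value at A. *)
Lemma Phi_ge (R : realType) (A x y : R) : x <= y -> - A <= x -> y <= A ->
  (y - x) * normal_pdf 0 1 A <= Phi y - Phi x.
Proof.
move=> xy Ax yA; rewrite -lee_fin -Phi_itv// /normal_prob.
have -> : ((y - x) * normal_pdf 0 1 A)%:E = (\int[lebesgue_measure]_(u in `]x, y]) (cst (normal_pdf 0 1 A)%:E) u)%E.
  by rewrite integral_cst// muleC EFinM; congr (_ * _)%E; exact/esym/lebesgue_itv_oc.
apply: ge0_le_integral => //=.
- by move=> u _; rewrite lee_fin normal_pdf_ge0.
- by apply/measurable_EFinP; apply: measurable_funTS; exact: measurable_normal_pdf.
- move=> u; rewrite in_itv/= => /andP[xu uy].
  rewrite lee_fin !normal_pdfE ?oner_neq0//.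
  have p1 : 0 <= ((1 : R) ^+ 2 *+ 2)^-1 by rewrite invr_ge0 expr1n mulrn_wge0.
  rewrite ler_wpM2l ?normal_peak_ge0// ler_expR !subr0 (ler_wpM2r p1)//.
  rewrite lerN2 -[leLHS]real_normK ?num_real// -[leRHS]real_normK ?num_real//.
  rewrite ler_sqr ?nnegrE ?normr_ge0//.
  have A0 : 0 <= A by lra.
  by rewrite (ger0_norm A0) ler_norml; apply/andP; split; lra.
Qed.

Lemma Phi_lip (R : realType) (x y : R) : x <= y ->
  Phi y - Phi x <= (y - x) * normal_peak 1.
Proof.
move=> xy; rewrite -lee_fin -Phi_itv// /normal_prob.
have -> : ((y - x) * normal_peak 1)%:E = (\int[lebesgue_measure]_(u in `]x, y]) (cst (@normal_peak R 1)%:E) u)%E.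
  by rewrite integral_cst// muleC EFinM; congr (_ * _)%E; exact/esym/lebesgue_itv_oc.
apply: ge0_le_integral => //=.
- by move=> u _; rewrite lee_fin normal_pdf_ge0.
- by apply/measurable_EFinP; apply: measurable_funTS; exact: measurable_normal_pdf.
- by move=> u _; rewrite lee_fin normal_pdf_ub ?oner_neq0.
Qed.

Lemma Phi_lt (R : realType) (x y : R) : x < y -> Phi x < Phi y.
Proof.
move=> xy; rewrite -subr_gt0.
apply: (lt_le_trans _ (@Phi_ge R (Num.max `|x| `|y|) x y (ltW xy) _ _)).
- rewrite mulr_gt0 ?subr_gt0// normal_pdfE ?oner_neq0//.
  by rewrite mulr_gt0 ?expR_gt0// normal_peak_gt0 ?oner_neq0.
- by rewrite lerNl le_max -normrN ler_norm.
- by rewrite le_max ler_norm orbT.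
Qed.

Lemma Phi_le (R : realType) (x y : R) : x <= y -> Phi x <= Phi y.
Proof. by rewrite le_eqVlt => /orP[/eqP -> //|/Phi_lt/ltW]. Qed.

Lemma Phi_lt1 (R : realType) (x : R) : Phi x < 1.
Proof.
apply: (lt_le_trans (Phi_lt (_ : x < x + 1))); first by rewrite ltrDl.
by rewrite -lee_fin -PhiE probability_le1.
Qed.

Lemma Phi_gt0 (R : realType) (x : R) : 0 < Phi x.
Proof.
apply: (le_lt_trans _ (Phi_lt (_ : x - 1 < x))); last by rewrite ltrBlDr ltrDl.
by rewrite -lee_fin -PhiE measure_ge0.
Qed.

(** Symmetry of the normal density, through the substitution u -> - u. *)
Lemma Phi_opp (R : realType) (x : R) : Phi (- x) = 1 - Phi x.
Proof.
apply: EFin_inj; rewrite EFinB -!PhiE.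
have <- : (normal_prob 0 1 `]x, +oo[ = 1 - normal_prob (0 : R) 1 `]-oo, x])%E.
  rewrite -(probability_setC (normal_prob (0 : R) 1))//.
  by rewrite setCitvl.
rewrite /normal_prob ge0_integration_by_substitutionNy; last 2 first.
- by apply: continuous_subspaceT; apply: continuous_normal_pdf; rewrite oner_neq0.
- by move=> u _; exact: normal_pdf_ge0.
rewrite integral_itv_obnd_cbnd; last first.
  by apply/measurable_EFinP; apply: measurable_funTS; exact: measurable_normal_pdf.
apply: eq_integral => u _ /=.
by rewrite !normal_pdfE ?oner_neq0// /normal_fun !subr0 sqrrN.
Qed.

Lemma Phi_small (R : realType) (eps : R) : 0 < eps ->
  exists M : R, forall x, x <= M -> Phi x < eps.
Proof.
move=> e0.
have mid : @measurable_fun _ _ (measurableTypeR R) R setT (fun x : R => x).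
  exact: measurable_id.
pose X : {mfun (measurableTypeR R) >-> R} :=
  @mfun_Sub _ _ (measurableTypeR R) R (fun x : R => x) (mem_set mid).
have := @cvg_cdfNy0 _ _ R (normal_prob (0 : R) 1) X.
move=> /fine_cvgP [_] /cvgrPdist_lt /(_ _ e0) [M [_ hM]].
exists (M - 1) => x xM; have := hM x.
rewrite sub0r normrN => /(_ _)/wrap[]; first by rewrite (le_lt_trans xM)// ltrBlDr ltrDl.
apply: le_lt_trans; rewrite /= (_ : fine _ = Phi x)// ler_norm//.
Qed.

(** Standardization: substitution u -> (u - m) / sqrt v in the integral of the
    density. *)
Lemma gaussian_law_cdf (R : realType) d (T : measurableType d) (P : probability T R)
  (X : T -> R) (m v x : R) : 0 < v -> has_gaussian_law P X m v ->
  P [set w | X w <= x] = (Phi ((x - m) / Num.sqrt v))%:E.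
Proof.
move=> v0 hX.
have s0 : 0 < Num.sqrt v by rewrite sqrtr_gt0.
set s := Num.sqrt v in s0 *.
have -> : [set w | X w <= x] = X @^-1` `]-oo, x].
  by apply/seteqP; split => w /=; rewrite in_itv.
rewrite hX// /gaussian_law gt_eqF// -PhiE /normal_prob -/s.
pose F (x : R^o) : R^o := (x - m) / s.
have F'E : F^`()%classic = cst s^-1.
  apply/funext => y; rewrite /F derive1E deriveM// deriveD// derive_cst scaler0.
  by rewrite add0r derive_id derive_cst addr0 scaler1.
have dF y : derivable F y 1 by rewrite /F.
have cF : continuous F by move=> y; apply: differentiable_continuous; rewrite -derivable1_diffP.
rewrite [RHS](@increasing_ge0_integration_by_substitutionNy _ F); last first.
- by move=> u _; exact: normal_pdf_ge0.
- by apply: continuous_subspaceT; apply: continuous_normal_pdf; rewrite oner_neq0.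
- by apply/gt0_cvgMlNy; [rewrite invr_gt0|exact: cvg_addrr_Ny].
- split; first by move=> y _; exact: dF.
  by apply: cvg_at_left_filter; exact: cF.
- by rewrite F'E; exact: cvg_cst.
- by rewrite F'E; exact: is_cvg_cst.
- by rewrite F'E => ? _; exact: cvg_cst.
- by move=> u y _ _ uy; rewrite /F ltr_pM2r ?invr_gt0// ltrD2r.
apply: eq_integral => u _; congr EFin; rewrite /= F'E !fctE /F.
rewrite !normal_pdf_gauss// subr0 mul1r.
rewrite -[(u - m) / s / _]mulrA -invfM; field.
by rewrite !gt_eqF// sqrtr_gt0// pi_gt0.
Qed.

Lemma Phi_continuous (R : realType) : continuous (@Phi R).
Proof.
move=> x; apply/cvgrPdist_le => e e0.
have p0 : 0 < @normal_peak R 1 by rewrite normal_peak_gt0// oner_neq0.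
near=> y.
apply: (@le_trans _ _ (`|x - y| * normal_peak 1)).
  have [xy|yx] := leP x y.
    by rewrite distrC (distrC x) !ger0_norm ?subr_ge0 ?Phi_le//; exact: Phi_lip.
  have yx' := ltW yx.
  by rewrite !ger0_norm ?subr_ge0 ?Phi_le//; exact: Phi_lip.
rewrite -ler_pdivlMr//; near: y.
by exists (e / normal_peak 1) => /=; [rewrite divr_gt0|move=> y /= /ltW].
Unshelve. all: by end_near. Qed.

Lemma measurable_rv_itv (R : realType) d (T : measurableType d) (X : {mfun T >-> R})
  (i : interval R) (E : set T) : (forall w, E w = (X w \in i)) -> measurable E.
Proof.
move=> h; rewrite (_ : E = setT `&` X @^-1` [set` i]); first exact: (measurable_funP X).
by rewrite setTI; apply/funext => w; rewrite h.
Qed.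

Section limit_law.
Context d (T : measurableType d) (R : realType) (P : probability T R).

(** If almost every point of E lies in F k for all large k, then E is, up to a
    null set, in the increasing union of the tails, on each of which P is
    eventually below P (F k). *)
Lemma prob_le_eventually (E : set T) (F : nat -> set T) (c : \bar R) :
  measurable E -> (forall k, measurable (F k)) ->
  {ae P, forall w, E w -> \forall k \near \oo, F k w} ->
  P (F k) @[k --> \oo] --> c -> (P E <= c)%E.
Proof.
move=> mE mF [N [mN PN hN]] Fc.
pose G K := \bigcap_(k in [set k | (K <= k)%N]) F k.
have mG K : measurable (G K) by apply: bigcap_measurable => //; exists K => /=.
have EG : E `<=` N `|` \bigcup_K G K.
  move=> w Ew; have [Nw|nNw] := pselect (N w); first by left.
  right; have /contrapT/(_ Ew) [K _ hK] : ~ ~ (E w -> \forall k \near \oo, F k w).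
    by move=> h; apply: nNw; exact: hN.
  by exists K => // k /= Kk; exact: hK.
have mUG : measurable (\bigcup_K G K) by exact: bigcup_measurable.
apply: (@le_trans _ _ (P (\bigcup_K G K))).
  apply: (@le_trans _ _ (P (N `|` \bigcup_K G K))).
    by apply: le_measure; rewrite ?inE//; exact: measurableU.
  apply: (le_trans (measureU2 _ _ _)) => //.
  by rewrite [X in (X + _)%E]PN add0e.
have ndG : {homo G : n m / (n <= m)%N >-> (n <= m)%O}.
  move=> n m nm; apply/subsetPset => w hw k /= mk; apply: hw => /=.
  exact: leq_trans mk.
have GU : P (G K) @[K --> \oo] --> P (\bigcup_K G K).
  exact: nondecreasing_cvg_mu.
apply: (lee_cvg_to GU Fc); near=> K.
apply: le_measure; rewrite ?inE//.
by apply: bigcap_inf => /=.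
Unshelve. all: by end_near. Qed.

(** An almost sure limit of Gaussian variables is Gaussian as soon as the
    parameters converge to a nondegenerate limit. The two bounds of
    [prob_le_eventually] for < and > sandwich the distribution function of the
    limit, and the Lipschitz continuity of Phi closes the gap. *)
Lemma limit_gaussian_cdf (X : {mfun T >-> R}) (S : nat -> {mfun T >-> R})
  (m v : R) (mk vk : nat -> R) :
  (forall k, has_gaussian_law P (S k) (mk k) (vk k)) ->
  mk @ \oo --> m -> vk @ \oo --> v -> 0 < v ->
  {ae P, forall w, S k w @[k --> \oo] --> X w} ->
  forall x, P [set w | X w <= x] = (Phi ((x - m) / Num.sqrt v))%:E /\
            P [set w | X w < x] = (Phi ((x - m) / Num.sqrt v))%:E.
Proof.
move=> hS mkm vkv v0 SX.
pose F x := Phi ((x - m) / Num.sqrt v).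
have s0 : 0 < Num.sqrt v by rewrite sqrtr_gt0.
have vk0 : \forall k \near \oo, 0 < vk k by exact: cvgr_gt vkv _ v0.
have cPhi := @Phi_continuous R.
have cF x : P [set w | S k w <= x] @[k --> \oo] --> (F x)%:E.
  have : (Phi ((x - mk k) / Num.sqrt (vk k)))%:E @[k --> \oo] --> (F x)%:E.
    apply/fine_cvgP; split; first by near=> k.
    apply: (@continuous_cvg _ _ _ _ _ _ (@Phi R)); first exact: cPhi.
    apply: cvgM; first by apply: cvgB => //; exact: cvg_cst.
    apply: cvgV; first by rewrite gt_eqF.
    by apply: continuous_cvg => //; exact: sqrt_continuous.
  apply: cvg_trans; apply: near_eq_cvg; near=> k.
  rewrite (gaussian_law_cdf x _ (hS k))//.
  by near: k.
have meas_le (Y : {mfun T >-> R}) x : measurable [set w | Y w <= x].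
  by apply: (@measurable_rv_itv _ _ _ Y `]-oo, x]) => w; rewrite in_itv.
have meas_lt (Y : {mfun T >-> R}) x : measurable [set w | Y w < x].
  by apply: (@measurable_rv_itv _ _ _ Y `]-oo, x[) => w; rewrite in_itv.
have meas_gt (Y : {mfun T >-> R}) x : measurable [set w | x < Y w].
  by apply: (@measurable_rv_itv _ _ _ Y `]x, +oo[) => w; rewrite in_itv/= andbT.
have lt_F x : (P [set w | (X w < x)%R] <= (F x)%:E)%E.
  apply: (prob_le_eventually _ _ _ (cF x)) => //.
  apply: filterS SX => w Sw /= Xx.
  by apply: filterS (cvgr_lt _ Sw _ Xx) => k /ltW.
have CE (Y : {mfun T >-> R}) x : (P [set w | (x < Y w)%R] = 1 - P [set w | (Y w <= x)%R])%E.
  rewrite -(probability_setC P)//; congr (P _).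
  by apply/seteqP; split => w /=; rewrite ltNge => /negP.
have gt_F x : (P [set w | (x < X w)%R] <= 1 - (F x)%:E)%E.
  apply: (@prob_le_eventually _ (fun k => [set w | x < S k w])) => //.
    apply: filterS SX => w Sw /= Xx.
    exact: (cvgr_gt _ Sw _ Xx).
  under eq_fun do rewrite CE.
  by apply: cvgeB; [by []|exact: cvg_cst|exact: cF].
have le_F x : ((F x)%:E <= P [set w | (X w <= x)%R])%E.
  have := gt_F x; rewrite CE.
  rewrite -[P [set w | X w <= x]]fineK ?fin_num_measure//.
  by rewrite -!EFinB !lee_fin lerD2l lerN2.
have lipF x e : 0 < e -> F (x + e) <= F x + e / Num.sqrt v * normal_peak 1.
  move=> e0; rewrite -lerBlDl.
  have -> : e / Num.sqrt v = (x + e - m) / Num.sqrt v - (x - m) / Num.sqrt v.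
    by rewrite -mulrBl; congr (_ / _); ring.
  by apply: Phi_lip; rewrite ler_pM2r ?invr_gt0// lerD2r lerDl ltW.
have sp0 : 0 < (Num.sqrt v)^-1 * @normal_peak R 1.
  apply: mulr_gt0; first by rewrite invr_gt0.
  by apply: normal_peak_gt0; rewrite oner_neq0.
have F_le x (c : R) : (forall e, 0 < e -> c <= F (x + e)) -> c <= F x.
  move=> h; apply/ler_addgt0Pr => e e0.
  have e0' : 0 < e / ((Num.sqrt v)^-1 * normal_peak 1) by rewrite divr_gt0.
  apply: (le_trans (h _ e0')); apply: (le_trans (lipF _ _ e0')).
  by rewrite lerD2l -mulrA divfK// gt_eqF.
have F_ge x (c : R) : (forall e, 0 < e -> F (x - e) <= c) -> F x <= c.
  move=> h; apply/ler_addgt0Pr => e e0.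
  have e0' : 0 < e / ((Num.sqrt v)^-1 * normal_peak 1) by rewrite divr_gt0.
  have := lipF (x - e / ((Num.sqrt v)^-1 * normal_peak 1)) _ e0'.
  rewrite subrK => /le_trans; apply.
  by rewrite -mulrA divfK ?lerD2r ?h// gt_eqF.
move=> x.
have fle := fin_num_measure P _ (meas_le X x).
have flt := fin_num_measure P _ (meas_lt X x).
split.
- rewrite -[LHS](fineK fle); congr EFin; apply: le_anti.
  apply/andP; split; last by rewrite -lee_fin (fineK fle); exact: le_F.
  apply: F_le => e e0; rewrite -lee_fin (fineK fle).
  apply: le_trans (lt_F _); apply: le_measure; rewrite ?inE// => w /= Xx.
  by rewrite (le_lt_trans Xx)// ltrDl.
- rewrite -[LHS](fineK flt); congr EFin; apply: le_anti.
  apply/andP; split; first by rewrite -lee_fin (fineK flt); exact: lt_F.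
  apply: F_ge => e e0; rewrite -lee_fin (fineK flt).
  apply: (le_trans (le_F _)); apply: le_measure; rewrite ?inE// => w /= Xx.
  by rewrite (le_lt_trans Xx)// ltrBlDr ltrDl.
Unshelve. all: by end_near. Qed.
End limit_law.

(** * The coverage as a function of bias and spread *)

(** Since z is negative, the coverage is the probability that X lies in the
    nonempty interval from v + z s to v - z s. *)
Lemma coverage_cdf (R : realType) d (T : measurableType d) (P : probability T R)
  (X : {mfun T >-> R}) (F : R -> R) (z s v : R) :
  (forall x, P [set w | X w <= x] = (F x)%:E /\ P [set w | X w < x] = (F x)%:E) ->
  z * s <= 0 ->
  coverage P X z s v = (F (v - z * s) - F (v + z * s))%:E.
Proof.
move=> hF zs.
have mlt x : measurable [set w | X w < x].
  by apply: (@measurable_rv_itv _ _ _ X `]-oo, x[) => w; rewrite in_itv.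
have mC : measurable [set w | v + z * s <= X w <= v - z * s].
  by apply: (@measurable_rv_itv _ _ _ X `[v + z * s, v - z * s]) => w; rewrite in_itv.
rewrite /coverage.
have -> : [set w | X w + z * s <= v <= X w - z * s] =
          [set w | v + z * s <= X w <= v - z * s].
  by apply/seteqP; split => w /= /andP[h1 h2]; apply/andP; split; lra.
have : (P [set w | (X w <= v - z * s)%R] =
  P [set w | (X w < v + z * s)%R] + P [set w | (v + z * s <= X w <= v - z * s)%R])%E.
  rewrite -measureU//; last first.
    by apply/seteqP; split => // w [/= h1] /andP[h2 _]; lra.
  congr (P _); apply/seteqP; split => w /=.
    by move=> h; have [h1|h1] := ltP (X w) (v + z * s); [left|right; rewrite h].
  by case; [lra|move=> /andP[]].
rewrite (hF _).1 (hF _).2 EFinB => ->.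
by rewrite addeAC subee ?add0e.
Qed.

Section white_noise.
Context (R : realType) (H : normedModType R) (ip : {dot H for idfun}).
Context d (T : measurableType d) (P : probability T R).
Variables (Y : H -> {mfun T >-> R}) (x : H) (n : nat).
Hypothesis hY : white_noise_model ip P Y x n.

Lemma white_noise_Lfun2 h : (Y h : T -> R) \in Lfun P 2%:E.
Proof.
have [hG _ _] := hY.
have [m [v [v0 hl]]] := hG 1%N (fun=> h) (fun=> 1).
have {}hl : has_gaussian_law P (Y h) m v.
  move: hl; rewrite (_ : (fun w => _) = Y h)//.
  by apply/funext => w; rewrite big_ord_recl big_ord0 mul1r addr0.
by have [] := gaussian_law_moments v0 hl.
Qed.

Definition white_noise_sum (f : nat -> H) (a : nat -> R) (k : nat) : T -> R :=
  fun w => \sum_(j < k) a j * Y (f j) w.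

Lemma white_noise_sumS f a k : white_noise_sum f a k.+1 =
  white_noise_sum f a k \+ a k \o* Y (f k).
Proof.
by apply/funext => w; rewrite /white_noise_sum big_ord_recr/= [_ * a k]mulrC.
Qed.

Lemma white_noise_sum_Lfun2 f a k : white_noise_sum f a k \in Lfun P 2%:E.
Proof.
elim: k => [|k IH].
  rewrite (_ : white_noise_sum f a 0 = cst 0) ?Lfun_cst//.
  by apply/funext => w; rewrite /white_noise_sum big_ord0.
rewrite white_noise_sumS; apply: Lfun2_add => //.
by apply: Lfun_scale; rewrite ?ler1n// white_noise_Lfun2.
Qed.

Let PT : P setT \is a fin_num := fin_num_measure P _ measurableT.

Lemma white_noise_sum_E f a k :
  ('E_P[white_noise_sum f a k] = (\sum_(j < k) a j * ip x (f j))%:E)%E.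
Proof.
have [_ hE _] := hY.
elim: k => [|k IH].
  rewrite (_ : white_noise_sum f a 0 = cst 0) ?expectation_cst ?big_ord0//.
  by apply/funext => w; rewrite /white_noise_sum big_ord0.
have L1 := Lfun_subset12 PT (white_noise_Lfun2 (f k)).
rewrite white_noise_sumS expectationD; last 2 first.
- exact: (Lfun_subset12 PT (white_noise_sum_Lfun2 f a k)).
- by apply: Lfun_scale.
by rewrite expectationZl// IH hE big_ord_recr/= EFinD EFinM.
Qed.

Lemma white_noise_sum_cov f a k g :
  covariance P (white_noise_sum f a k) (Y g) =
  (n%:R^-1 * \sum_(j < k) a j * ip (f j) g)%:E.
Proof.
have [_ _ hC] := hY.
elim: k => [|k IH].
  rewrite (_ : white_noise_sum f a 0 = cst 0) ?covariance_cst_l ?big_ord0 ?mulr0//.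
  by apply/funext => w; rewrite /white_noise_sum big_ord0.
have L2 := white_noise_Lfun2 (f k); have L2g := white_noise_Lfun2 g.
have L1 := Lfun_subset12 PT L2; have L1g := Lfun_subset12 PT L2g.
rewrite white_noise_sumS covarianceDl//; last 2 first.
- exact: white_noise_sum_Lfun2.
- by apply: Lfun_scale; rewrite ?ler1n.
rewrite IH covarianceZl//; last exact: Lfun2_mul_Lfun1.
by rewrite hC big_ord_recr/= mulrDr EFinD -EFinM mulrCA.
Qed.

(** The variables Y (f i) are uncorrelated for orthonormal f, so that
    variances add. *)
Lemma white_noise_sum_V f a k : (forall i j, ip (f i) (f j) = (i == j)%:R) ->
  ('V_P[white_noise_sum f a k] = (n%:R^-1 * \sum_(j < k) a j ^+ 2)%:E)%E.
Proof.
move=> fo; have [_ _ hC] := hY; rewrite /variance.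
elim: k => [|k IH].
  rewrite (_ : white_noise_sum f a 0 = cst 0) ?covariance_cst_l ?big_ord0 ?mulr0//.
  by apply/funext => w; rewrite /white_noise_sum big_ord0.
have L2 := white_noise_Lfun2 (f k).
have L1 := Lfun_subset12 PT L2.
have LS := white_noise_sum_Lfun2 f a k.
have LS1 := Lfun_subset12 PT LS.
have La : a k \o* Y (f k) \in Lfun P 2%:E by apply: Lfun_scale; rewrite ?ler1n.
have La1 := Lfun_subset12 PT La.
have c0 : covariance P (white_noise_sum f a k) (Y (f k)) = 0%:E.
  rewrite white_noise_sum_cov big1 ?mulr0// => i _.
  by rewrite fo ltn_eqF ?mulr0.
rewrite white_noise_sumS covarianceDl//; last exact: Lfun2_add.
rewrite !covarianceDr// IH.
rewrite [X in ((_ + X) + _)%E](_ : _ = 0%:E); last first.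
  by rewrite covarianceZr ?c0 ?mule0//; exact: Lfun2_mul_Lfun1.
rewrite [X in (_ + (X + _))%E](_ : _ = 0%:E); last first.
  by rewrite covarianceC covarianceZr ?c0 ?mule0//; exact: Lfun2_mul_Lfun1.
rewrite covarianceZl//; last exact: Lfun2_mul_Lfun1.
rewrite covarianceZr//; last exact: Lfun2_mul_Lfun1.
rewrite hC fo eqxx -!EFinM -!EFinD big_ord_recr/=; congr EFin; ring.
Qed.

Lemma white_noise_sum_law f a k : (forall i j, ip (f i) (f j) = (i == j)%:R) ->
  has_gaussian_law P (white_noise_sum f a k)
    (\sum_(j < k) a j * ip x (f j)) (n%:R^-1 * \sum_(j < k) a j ^+ 2).
Proof.
move=> fo; have [hG _ _] := hY.
have [m [v [v0 hl]]] := hG k (fun j => f j) (fun j => a j).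
have mS : measurable_fun setT (white_noise_sum f a k).
  by have := white_noise_sum_Lfun2 f a k; rewrite inE => /andP[+ _]; rewrite inE.
pose S : {mfun T >-> R} := mfun_Sub (mem_set mS).
have [_ hE hV] := @gaussian_law_moments _ _ _ P S m v v0 hl.
have hE' := white_noise_sum_E f a k; have hV' := white_noise_sum_V a k fo.
have -> : \sum_(j < k) a j * ip x (f j) = m.
  by apply: EFin_inj; exact: (etrans (esym hE') hE).
have -> : n%:R^-1 * \sum_(j < k) a j ^+ 2 = v.
  by apply: EFin_inj; exact: (etrans (esym hV') hV).
exact: hl.
Qed.

End white_noise.

(** The vectors f_i = K e_i / kappa_i are orthonormal and <K mu, f_i> =
    kappa_i mu_i, by the eigenvalue equation for K^T K. The partial sums of
    LAY are thus Gaussian with the parameters of the hypotheses, and LAY is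
    their almost sure limit. *)
Lemma coverage_white_noise (R : realType) (H1 H2 : normedModType R)
  (ip1 : {dot H1 for idfun}) (ip2 : {dot H2 for idfun})
  (K : {linear H1 -> H2}) (KT : {linear H2 -> H1}) (hKT : adjoint ip1 ip2 K KT)
  (e : nat -> H1) (he : forall i j, ip1 (e i) (e j) = (i == j)%:R)
  (kappa : nat -> R) (hkappa : forall i, KT (K (e i)) = kappa i ^+ 2 *: e i)
  (hk0 : forall i, 0 < kappa i)
  d (T : measurableType d) (P : probability T R)
  (Y : H2 -> {mfun T >-> R}) (n : nat) (mu : H1)
  (hY : white_noise_model ip2 P Y (K mu) n)
  (X : {mfun T >-> R}) (c : nat -> R)
  (hX : {ae P, forall w,
     series (fun i => c i * Y ((kappa i)^-1 *: K (e i)) w) @ \oo --> X w})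
  (m t z s v : R) :
  series (fun i => c i * (kappa i * ip1 mu (e i))) @ \oo --> m ->
  series (fun i => c i ^+ 2 / n%:R) @ \oo --> t ^+ 2 -> 0 < t ->
  z * s <= 0 ->
  coverage P X z s v =
  (Phi ((v - m - z * s) / t) - Phi ((v - m + z * s) / t))%:E.
Proof.
move=> hm ht t0 zs.
pose f i := (kappa i)^-1 *: K (e i).
have ipKf i u : ip2 (K u) (f i) = kappa i * ip1 u (e i).
  rewrite /f linearZr_LR/= hKT hkappa linearZr_LR/= /GRing.scale/= mulrA; congr (_ * _).
  by rewrite expr2 mulrA mulVf ?mul1r// gt_eqF.
have fo i j : ip2 (f i) (f j) = (i == j)%:R.
  rewrite {1}/f linearZl_LR/= ipKf he /GRing.scale/=.
  by case: eqVneq => [->|_]; rewrite ?mulr0// mulr1 mulVf// gt_eqF.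
have mS k : measurable_fun setT (white_noise_sum Y f c k).
  by have := white_noise_sum_Lfun2 hY f c k; rewrite inE => /andP[+ _]; rewrite inE.
pose S k : {mfun T >-> R} := mfun_Sub (mem_set (mS k)).
have hS k : has_gaussian_law P (S k) (series (fun i => c i * (kappa i * ip1 mu (e i))) k)
    (series (fun i => c i ^+ 2 / n%:R) k).
  have := white_noise_sum_law hY c k fo.
  rewrite /series/= !big_mkord mulr_sumr.
  under [X in has_gaussian_law _ _ X _]eq_bigr do rewrite ipKf.
  by under [X in has_gaussian_law _ _ _ X]eq_bigr do rewrite mulrC.
have SX : {ae P, forall w, S k w @[k --> \oo] --> X w}.
  apply: filterS hX => w; rewrite (_ : series _ = (fun k => S k w))//.
  by apply/funext => k; rewrite /series/= big_mkord.
have t20 : 0 < t ^+ 2 by rewrite exprn_gt0.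
have := @limit_gaussian_cdf _ _ _ P X S _ _ _ _ hS hm ht t20 SX.
rewrite sqrtr_sqr gtr0_norm// => hF.
rewrite (@coverage_cdf _ _ _ P X (fun x => Phi ((x - m) / t)) _ _ v hF zs).
have -> : v - z * s - m = v - m - z * s by ring.
by have -> : v + z * s - m = v - m + z * s by ring.
Qed.

(** * Uniform bounds for slowly varying functions *)

(** By uniqueness of Lebesgue measure, as translations preserve the length of
    intervals. *)
Lemma lebesgue_measure_translate (R : realType) (c : R) (A : set R) :
  measurable A ->
  lebesgue_measure [set x | A (x + c)] = lebesgue_measure A.
Proof.
move=> mA.
have mf : @measurable_fun _ _ (measurableTypeR R) (measurableTypeR R) setT (fun x : R => x + c).
  have h : measurable_fun setT (fun x : R => x + c) by exact: measurable_funD.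
  by move=> mT B mB; exact: (h mT B mB).
pose f : {mfun (measurableTypeR R) >-> (measurableTypeR R)} :=
  @mfun_Sub _ _ (measurableTypeR R) (measurableTypeR R) (fun x : R => x + c) (mem_set mf).
apply/esym.
apply: (@lebesgue_measure_unique R (pushforward lebesgue_measure f)) => // X.
move=> [[a b]] /= _ <-; rewrite /pushforward /=.
rewrite [in RHS](_ : _ @^-1` _ = `]a - c, b - c]%classic); last first.
  by apply/seteqP; split => x /=; rewrite !in_itv/= ltrBlDr lerBrDr.
rewrite !lebesgue_measure_itv/= !lte_fin ltrD2r; case: ifP => // _.
by rewrite -!EFinB; congr EFin; ring.
Qed.

(** The set where |g m| <= eps for all m >= n increases with n to the interval
    [0, c], hence its measure tends to c (as in the theorem of Egorov). *)
Lemma near_full_measure (R : realType) (g : nat -> R -> R) (c eps del : R) :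
  (forall m, measurable_fun setT (g m)) ->
  (forall x, g m x @[m --> \oo] --> 0) -> 0 <= c -> 0 < eps -> 0 < del ->
  let A n := [set x | 0 <= x <= c /\ forall m, (n <= m)%N -> `|g m x| <= eps] in
  (forall n, measurable (A n)) /\
  \forall n \near \oo, ((c - del)%:E < lebesgue_measure (A n))%E.
Proof.
move=> mg g0 c0 e0 d0 A.
have mA n : measurable (A n).
  have -> : A n = `[0, c]%classic `&` \bigcap_(m in [set m | (n <= m)%N]) [set x | `|g m x| <= eps].
    apply/seteqP; split => x /=.
      by move=> [h1 h2]; split; [rewrite in_itv|move=> m /= nm; exact: h2].
    by rewrite in_itv/= => -[h1 h2]; split => // m nm; exact: h2.
  apply: measurableI; first exact: measurable_itv.
  apply: bigcap_measurable; first by exists n => /=.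
  move=> m _.
  have mn : measurable_fun setT (fun x => `|g m x|) by exact: measurableT_comp.
  rewrite (_ : [set x | _] = setT `&` (fun x => `|g m x|) @^-1` `]-oo, eps]); last first.
    by rewrite setTI; apply/seteqP; split => w /=; rewrite in_itv/= ?andbT.
  exact: mn.
split => //.
have nd : {homo A : n m / (n <= m)%N >-> (n <= m)%O}.
  move=> n m nm; apply/subsetPset => w [h1 h2]; split => // k mk; apply: h2.
  exact: leq_trans mk.
have UA : \bigcup_n A n = `[0, c]%classic.
  apply/seteqP; split => x /=.
    by move=> [n _ [h _]]; rewrite in_itv.
  rewrite in_itv/= => h.
  have /cvgrPdist_le /(_ _ e0) [n _ hn] := g0 x.
  exists n => //; split => // m nm; have := hn m nm; by rewrite sub0r normrN.
have mu0c : lebesgue_measure (`[0, c]%classic : set R) = c%:E.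
  rewrite lebesgue_measure_itv/= lte_fin oppr0 adde0.
  by case: ltgtP c0 => // <-.
have := @nondecreasing_cvg_mu _ (measurableTypeR R) R lebesgue_measure A mA.
move=> /(_ (bigcupT_measurable _ mA) nd) h0.
have {h0}h : (lebesgue_measure \o A) x @[x --> \oo] --> c%:E.
  by rewrite -mu0c -UA; exact: h0.
have [h1 h2] : c%:E \is a fin_num /\ (c - del < c) by split => //; rewrite ltrBlDr ltrDl.
move/fine_cvgP : h => [hf hc].
near=> n.
rewrite -(@fineK _ (lebesgue_measure (A n))); last by near: n.
rewrite lte_fin; near: n.
exact: (cvgr_gt c hc).
Unshelve. all: by end_near. Qed.

(** The uniform convergence theorem of Karamata for measurable functions, in
    additive form. If it failed, there would be x_n tending to infinity and
    u_n in [0, 1] with |f (x_n + u_n) - f x_n| > eps. The points l for which f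
    (x_n + l) is close to f x_n fill most of [0, 3], and those for which f
    (x_n + l) is close to f (x_n + u_n) fill, being a translate by u_n of most
    of [0, 2], a set of measure nearly 2 in [0, 3]; so the two sets meet, a
    contradiction. *)
Lemma uniform_convergence_additive (R : realType) (f : R -> R) :
  measurable_fun setT f ->
  (forall u, f (x + u) - f x @[x --> +oo] --> 0) ->
  forall eps : R, 0 < eps -> exists X : R, forall x u : R, X <= x -> 0 <= u <= 1 ->
    `|f (x + u) - f x| <= eps.
Proof.
move=> mf f0 eps e0; apply: contrapT => hno.
have hx (n : nat) : exists xu : R * R,
   [/\ n%:R <= xu.1, 0 <= xu.2 <= 1 & eps < `|f (xu.1 + xu.2) - f xu.1|].
  apply: contrapT => hn; apply: hno; exists n%:R => x u nx hu.
  by rewrite leNgt; apply/negP => h; apply: hn; exists (x, u).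
have [xu hxu] := choice hx.
pose x n := (xu n).1; pose u n := (xu n).2.
have xoo : x n @[n --> \oo] --> +oo.
  apply: (@ger_cvgy _ _ _ _ (fun n => n%:R)); last exact: cvgr_idn.
  by near=> n; have [] := hxu n.
have xuoo : x n + u n @[n --> \oo] --> +oo.
  apply: (@ger_cvgy _ _ _ _ x) => //.
  by near=> n; have [_ /andP[h _] _] := hxu n; rewrite lerDl.
pose g m l := f (x m + l) - f (x m).
pose h m l := f (x m + u m + l) - f (x m + u m).
have mg m : measurable_fun setT (g m).
  apply: measurable_funB => //; apply: measurableT_comp => //.
  exact: measurable_funD.
have mh m : measurable_fun setT (h m).
  apply: measurable_funB => //; apply: measurableT_comp => //.
  exact: measurable_funD.
have g0 l : g m l @[m --> \oo] --> 0 by exact: (cvg_comp _ _ xoo (f0 l)).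
have h0 l : h m l @[m --> \oo] --> 0 by exact: (cvg_comp _ _ xuoo (f0 l)).
have e20 : 0 < eps / 2 by rewrite divr_gt0.
have d0 : 0 < 2^-1 :> R by [].
(* V, in [0, 3], has measure above 5/2, and the translate of W, also in [0,
   3], above 3/2. *)
have [mV hV] := @near_full_measure R g 3 (eps / 2) 2^-1 mg g0 (ler0n _ _) e20 d0.
have [mW hW] := @near_full_measure R h 2 (eps / 2) 2^-1 mh h0 (ler0n _ _) e20 d0.
have [NV _ HV] := hV; have [NW _ HW] := hW.
pose n := maxn NV NW.
have /= Vn := HV n (leq_maxl _ _); have /= Wn := HW n (leq_maxr _ _).
move: Vn Wn (mV n) (mW n).
set V := (X in lebesgue_measure X); set W := (X in _ -> (_ < lebesgue_measure X)%E -> _).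
move=> Vn Wn {}mV {}mW.
pose Wu := [set l | W (l + - u n)].
have mWu : lebesgue_measure Wu = lebesgue_measure W by exact: lebesgue_measure_translate.
have mesWu : measurable Wu.
  have mt : measurable_fun setT (fun l : R => l + - u n) by exact: measurable_funD.
  by rewrite -[Wu]setTI; exact: mt.
have [_ /andP[u0 u1] epsn] := hxu n.
have [[l [Vl Wl]]|disj] := pselect (exists l, V l /\ Wu l).
  have [_ /(_ n (leqnn n))] := Vl; have [_ /(_ n (leqnn n))] := Wl.
  rewrite /g /h (_ : x n + u n + (l - u n) = x n + l); last by ring.
  move=> h1 h2.
  have : `|f (x n + u n) - f (x n)| <= eps.
    rewrite (_ : f _ - _ = (f (x n + l) - f (x n)) - (f (x n + l) - f (x n + u n))); last by ring.
    rewrite (le_trans (ler_normB _ _))// (splitr eps) lerD//.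
  by rewrite leNgt epsn.
have : (lebesgue_measure (V `|` Wu) <= lebesgue_measure (`[0%R, 3%R]%classic : set R))%E.
  apply: le_measure; rewrite ?inE//; first exact: measurableU.
  move=> l /= [[h1 _]|[/andP[h1 h2] _]]; rewrite in_itv//=.
  by apply/andP; split; lra.
rewrite measureU//=; last first.
  by apply/seteqP; split => // l hl; apply: disj; exists l.
rewrite mWu lebesgue_measure_itv/= lte_fin ltr0n/= oppr0 adde0 leNgt.
move=> /negP; apply.
have -> : (3%:E = (3 - 2^-1)%:E + 2^-1%:E :> \bar R)%E by rewrite -EFinD subrK.
apply: lteD => //; apply: le_lt_trans Wn; rewrite lee_fin; lra.
Unshelve. all: by end_near. Qed.

(** Chaining steps of length at most one. *)
Lemma potter_additive (R : realType) (f : R -> R) (eps X : R) : 0 <= eps ->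
  (forall x u : R, X <= x -> 0 <= u <= 1 -> `|f (x + u) - f x| <= eps) ->
  forall x y : R, X <= x -> X <= y -> `|f y - f x| <= eps * (`|y - x| + 1).
Proof.
move=> e0 hX.
have step n : forall x y : R, X <= x -> x <= y -> y - x <= n%:R ->
    `|f y - f x| <= eps * n%:R.
  elim: n => [|n IH] x y Xx xy yxn.
    have -> : y = x by lra.
    by rewrite subrr normr0 mulr0.
  have [h|h] := leP (y - x) 1.
    have := hX x (y - x) Xx; rewrite subrKC subr_ge0 xy h => /(_ isT) /le_trans; apply.
    by rewrite ler_peMr// ler1n.
  have h1 : `|f (x + 1) - f x| <= eps by apply: hX => //; rewrite ler01 lexx.
  have h2 : `|f y - f (x + 1)| <= eps * n%:R.
    by apply: IH; [lra|lra|rewrite -natr1 in yxn; lra].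
  have -> : f y - f x = (f y - f (x + 1)) + (f (x + 1) - f x) by ring.
  rewrite (le_trans (ler_normD _ _))// -natr1 mulrDr mulr1 lerD//.
have main x y : X <= x -> x <= y -> `|f y - f x| <= eps * (`|y - x| + 1).
  move=> Xx xy.
  have yx0 : 0 <= y - x by rewrite subr_ge0.
  have [h1 h2] : (Num.truncn (y - x))%:R <= y - x /\ y - x <= (Num.truncn (y - x)).+1%:R.
    by split; [rewrite truncn_le|exact/ltW/truncnS_gt].
  apply: (le_trans (step _ _ _ Xx xy h2)); rewrite ler_wpM2l//.
  by rewrite -natr1 lerD2r ger0_norm.
move=> x y Xx Xy; have [xy|yx] := leP x y; first exact: main.
by rewrite distrC (distrC y); apply: main => //; exact: ltW.
Qed.

(** The bounds of Potter, in a form symmetric in the two points. The sum of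
    the two powers is comparable to max (y / x, x / y)^eps. *)
Definition potter (R : realType) (A : R -> R) : Prop :=
  forall eps : R, 0 < eps -> exists C X : R, [/\ 1 <= C, 1 <= X &
    forall x y, X <= x -> X <= y ->
      0 < A x /\ A y <= C * A x * ((y / x) `^ eps + (x / y) `^ eps)].

(** With x = ln t, slow variation of S becomes additive: the increments of ln
    |S (exp x)| tend to 0. *)
Lemma slowly_varying_ln (R : realType) (S : R -> R) : slowly_varying S ->
  (\forall t \near +oo, S t != 0) /\
  (forall u : R, ln `|S (expR (x + u))| - ln `|S (expR x)| @[x --> +oo] --> 0).
Proof.
move=> [mS hS].
have ne : \forall t \near +oo, S t != 0.
  have h := hS 1 ltr01; have : \forall t \near +oo, 0 < S (t * 1) / S t.
    exact: (cvgr_gt _ h).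
  by apply: filterS => t; apply: contraTneq => ->; rewrite invr0 mulr0 ltxx.
split => // u.
have exp_oo : @expR R x @[x --> +oo] --> +oo.
  apply: (@ger_cvgy _ _ _ _ id); last exact: cvg_id.
  by near=> x; rewrite (le_trans _ (expR_ge1Dx x))// lerDr.
have h := hS (expR u) (expR_gt0 u).
have h1 : `|S (t * expR u) / S t| @[t --> +oo] --> (1 : R).
  by rewrite -[X in _ --> X]normr1; apply: cvg_norm.
have h2 := cvg_comp _ _ h1 (continuous_ln ltr01); rewrite ln1 in h2.
have h3 := cvg_comp _ _ exp_oo h2.
apply: cvg_trans h3; apply: near_eq_cvg => /=.
have ne1 : \forall x \near +oo, S (expR x) != 0 by exact: (exp_oo _ ne).
have ne2 : \forall x \near +oo, S (expR (x + u)) != 0.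
  have xu : x + u @[x --> +oo] --> +oo by exact: cvg_addrr.
  exact: (cvg_comp _ _ xu exp_oo _ ne).
near=> x => /=.
have n1 : S (expR x) != 0 by near: x.
have n2 : S (expR (x + u)) != 0 by near: x.
rewrite -expRD normrM normfV lnM ?posrE ?invr_gt0 ?normr_gt0//.
by rewrite lnV ?posrE ?normr_gt0.
Unshelve. all: by end_near. Qed.

(** The uniform convergence theorem makes the increments of ln |S (exp x)|
    over unit steps eventually at most eps; chaining and exponentiating give
    the bound. *)
Lemma slowly_varying_potter (R : realType) (S : R -> R) : slowly_varying S ->
  potter (fun x => `|S x|).
Proof.
move=> sv eps e0; have [ne hln] := slowly_varying_ln sv.
have [mS _] := sv.
pose f (x : R) := ln `|S (expR x)|.
have mf : measurable_fun setT f.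
  apply: measurableT_comp; first exact: measurable_ln.
  apply: measurableT_comp => //.
  have sub : (@expR R) @` setT `<=` `[0, +oo[%classic.
    by move=> y /= [x _ <-]; rewrite in_itv/= andbT expR_ge0.
  move=> _ B mB; rewrite (_ : _ `&` _ = setT `&` @expR R @^-1` (`[0%R, +oo[ `&` S @^-1` B)).
    have mB' : measurable (`[0%R, +oo[%classic `&` S @^-1` B).
      by apply: mS => //; exact: measurable_itv.
    have mE : measurable_fun setT (@expR R) by exact: measurable_expR.
    exact: (mE measurableT _ mB').
  apply/seteqP; split => y /= [_ h]; split => //; last by have [] := h.
  by split => //; rewrite in_itv/= andbT expR_ge0.
have [X0 hX0] := uniform_convergence_additive mf hln e0.
have hp := potter_additive (ltW e0) hX0.
have [M [_ hM]] := ne.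
exists (expR eps), (Num.max 1 (Num.max (expR X0) (M + 1))).
split; [by rewrite -expR0 ler_expR ltW|by rewrite le_max lexx|].
move=> x y; rewrite !ge_max => /and3P[x1 xX xM] /and3P[y1 yX yM].
have x0 : 0 < x by lra.
have y0 : 0 < y by lra.
have Sx : S x != 0 by apply: hM => /=; lra.
have Sy : S y != 0 by apply: hM => /=; lra.
split; first by rewrite normr_gt0.
have lx : X0 <= ln x by rewrite -[X0]expRK ler_ln// posrE expR_gt0.
have ly : X0 <= ln y by rewrite -[X0]expRK ler_ln// posrE expR_gt0.
have := hp _ _ lx ly; rewrite /f !lnK ?posrE// => h.
have e1 : `|S y| = `|S x| * expR (ln `|S y| - ln `|S x|).
  by rewrite expRD expRN !lnK ?posrE ?normr_gt0// mulrCA divff ?mulr1// normr_eq0.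
rewrite {}e1 [expR eps * _]mulrC -mulrA ler_wpM2l//.
apply: (@le_trans _ _ (expR (eps * (`|ln y - ln x| + 1)))).
  by rewrite ler_expR (le_trans (ler_norm _)).
rewrite mulrDr mulr1 expRD mulrC ler_wpM2l ?expR_ge0//.
have lyx : ln (y / x) = ln y - ln x by rewrite lnM ?posrE ?invr_gt0// lnV ?posrE.
have lxy : ln (x / y) = ln x - ln y by rewrite lnM ?posrE ?invr_gt0// lnV ?posrE.
have d1 : y / x != 0 by rewrite mulf_neq0 ?invr_eq0 ?gt_eqF.
have d2 : x / y != 0 by rewrite mulf_neq0 ?invr_eq0 ?gt_eqF.
rewrite /powR (negbTE d1) (negbTE d2) lyx lxy.
have [h0|h0] := leP 0 (ln y - ln x).
  by rewrite (ger0_norm h0) lerDl expR_ge0.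
by rewrite (ltr0_norm h0) opprB lerDr expR_ge0.
Qed.

(** * Sums of regularly varying sequences *)

Ltac solve_gt0 := first [assumption | lazymatch goal with
  | |- is_true (0 < _ * _) => apply: mulr_gt0; solve_gt0
  | |- is_true (0 < _^-1) => rewrite invr_gt0; solve_gt0
  | |- is_true (0 < _ ^+ _) => apply: exprn_gt0; solve_gt0
  | |- is_true (0 < _ `^ _) => apply: powR_gt0; solve_gt0
  | |- is_true (0 < _ + _) => first [lra | apply: addr_gt0; solve_gt0]
  | |- _ => first [done | rewrite ltr0n; done | lra]
  end].
Ltac solve_ge0 := first [assumption | lazymatch goal with
  | |- is_true (0 <= _ * _) => apply: mulr_ge0; solve_ge0
  | |- is_true (0 <= _^-1) => rewrite invr_ge0; solve_ge0
  | |- is_true (0 <= _ ^+ 2) => apply: sqr_ge0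
  | |- is_true (0 <= _ ^+ _) => apply: exprn_ge0; solve_ge0
  | |- is_true (0 <= _ `^ _) => apply: powR_ge0
  | |- is_true (0 <= _ + _) => first [lra | apply: addr_ge0; solve_ge0]
  | |- _ => first [done | apply: ltW; solve_gt0 | lra]
  end].

Section powers.
Context (R : realType).
Implicit Types a b w x y d : R.

Lemma powRE w a : 0 < w -> w `^ a = expR (a * ln w).
Proof. by move=> w0; rewrite /powR gt_eqF. Qed.

Lemma powR_le1_anti w a b : 0 < w -> w <= 1 -> b <= a -> w `^ a <= w `^ b.
Proof.
move=> w0 w1 ba; rewrite !powRE// ler_expR.
by rewrite -subr_ge0 -mulrBl mulr_le0// ?subr_le0// ln_le0.
Qed.

Lemma powR_ge1 w a : 1 <= w -> 0 <= a -> 1 <= w `^ a.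
Proof. by move=> w1 a0; rewrite -(powRr0 w) ler_powR. Qed.

Lemma powR_le1 w a : 0 < w -> w <= 1 -> 0 <= a -> w `^ a <= 1.
Proof. by move=> w0 w1 a0; rewrite -(powRr0 w); exact: powR_le1_anti. Qed.

Lemma powR_mono x y a : 0 <= a -> 0 <= x -> x <= y -> x `^ a <= y `^ a.
Proof. by move=> a0 x0 xy; rewrite ge0_ler_powR// nnegrE// (le_trans x0). Qed.

Lemma powRDp w a b : 0 < w -> w `^ (a + b) = w `^ a * w `^ b.
Proof. by move=> w0; apply: powRD; apply/implyP => _; rewrite gt_eqF. Qed.

Lemma powRVp w a : 0 < w -> (w^-1) `^ a = w `^ (- a).
Proof. by move=> w0; rewrite !powRE ?invr_gt0// lnV ?posrE// mulrN mulNr. Qed.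

Lemma powR_divp x y a : 0 < x -> 0 < y -> (x / y) `^ a = x `^ a / y `^ a.
Proof. by move=> x0 y0; rewrite powRM ?invr_ge0 ?ltW// powRVp// powRN. Qed.

Lemma powR_sqr w a : (w `^ a) ^+ 2 = w `^ (2 * a).
Proof. by rewrite mulrC powRrM powR_mulrn ?powR_ge0. Qed.

(** A Bernoulli type bound, from ln (1 + t) >= t / (1 + t). *)
Lemma powR_1D_ge d t : 0 <= d -> 0 <= t -> t <= 1 -> 1 + d * t / 2 <= (1 + t) `^ d.
Proof.
move=> d0 t0 t1; have p : 0 < 1 + t by lra.
rewrite powRE//; apply: le_trans (expR_ge1Dx _).
rewrite lerD2l -mulrA ler_wpM2l//.
have : ln (1 + t)^-1 <= (1 + t)^-1 - 1.
  have := @le_ln1Dx R ((1 + t)^-1 - 1); rewrite subrKC; apply.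
  by rewrite ltrBrDl addrN invr_gt0.
rewrite lnV ?posrE// => h.
have e1 : 1 - (1 + t)^-1 = t / (1 + t) by field; rewrite gt_eqF.
have : t / 2 <= t / (1 + t) by rewrite ler_wpM2l// lef_pV2 ?posrE//; lra.
lra.
Qed.
End powers.

Section sums.
Context (R : realType).

(** The terms are at most a constant times the increments of the bounded
    sequence y / (1 + y); this discretizes the fact that y / (1 + y)^2 times d
    ln y is the differential of y / (1 + y). *)
Lemma logistic_step (del rho : R) (i : nat) : 0 < del -> 0 < rho ->
  forall y : nat -> R, y = (fun j => (j.+1%:R / rho) `^ del) ->
  i.+1%:R^-1 * (y i / (1 + y i) ^+ 2) <=
  (2 `^ del * 2 / del) * (y i.+1 / (1 + y i.+1) - y i / (1 + y i)).
Proof.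
move=> d0 r0 y ydef.
have n0 : 0 < i.+1%:R :> R by rewrite ltr0n.
have y0 j : 0 < y j by rewrite ydef powR_gt0// divr_gt0// ltr0n.
have t1 : i.+1%:R^-1 <= 1 :> R by rewrite invf_le1// ler1n.
have t0 : 0 <= i.+1%:R^-1 :> R by rewrite invr_ge0 ltW.
have yE : y i.+1 = y i * (1 + i.+1%:R^-1) `^ del.
  rewrite ydef -powRM; [|solve_ge0|solve_ge0].
  congr (_ `^ _); rewrite -[i.+2%:R]natr1; field.
  by rewrite !gt_eqF.
set b := (1 + i.+1%:R^-1) `^ del in yE.
have b1 : 1 + del * i.+1%:R^-1 / 2 <= b by apply: powR_1D_ge => //; exact: ltW.
have b2 : b <= 2 `^ del.
  by apply: powR_mono; [exact: ltW|exact: addr_ge0|rewrite -[2]/(1 + 1) lerD2l].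
set Y := y i in yE *; have Y0 : 0 < Y by exact: y0.
have P0 : 0 < 2 `^ del :> R by rewrite powR_gt0.
have P1 : 1 <= 2 `^ del :> R by apply: powR_ge1; [rewrite ler1n|exact: ltW].
have bge1 : 1 <= b.
  by apply: le_trans b1; rewrite lerDl divr_ge0// mulr_ge0// ltW.
rewrite yE.
have -> : Y * b / (1 + Y * b) - Y / (1 + Y) = Y * (b - 1) / ((1 + Y) * (1 + Y * b)).
  by field; rewrite !gt_eqF//; nra.
have D1 : 0 < 1 + Y by lra.
have D2 : 0 < 1 + Y * b by nra.
have D3 : 1 + Y * b <= 2 `^ del * (1 + Y) by nra.
have b3 : del * i.+1%:R^-1 / 2 <= b - 1 by rewrite lerBrDl.
rewrite (_ : i.+1%:R^-1 * (Y / (1 + Y) ^+ 2) =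
  (2 `^ del * 2 / del) * (Y * (del * i.+1%:R^-1 / 2) / ((1 + Y) * (2 `^ del * (1 + Y))))).
  apply: ler_wpM2l; first by solve_ge0.
  apply: ler_pM.
  - by solve_ge0.
  - by solve_ge0.
  - by rewrite ler_pM2l.
  - rewrite lef_pV2 ?posrE; [|solve_gt0|solve_gt0].
    by rewrite ler_pM2l.
by field; rewrite !gt_eqF//.
Qed.

(** A bound uniform in rho: the weights concentrate on indices of the order of
    rho. It replaces the comparison of sums with integrals in the upper bounds
    below. *)
Lemma sum_logistic (del rho : R) (k : nat) : 0 < del -> 0 < rho ->
  \sum_(0 <= i < k) i.+1%:R^-1 *
     ((i.+1%:R / rho) `^ del / (1 + (i.+1%:R / rho) `^ del) ^+ 2) <= 2 `^ del * 2 / del.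
Proof.
move=> d0 r0.
(* The increments of y / (1 + y) telescope, and this sequence has values in
   [0, 1]. *)
pose y j := (j.+1%:R / rho) `^ del.
have y0 j : 0 < y j by rewrite powR_gt0// divr_gt0// ltr0n.
apply: (@le_trans _ _ (\sum_(0 <= i < k)
   (2 `^ del * 2 / del) * (y i.+1 / (1 + y i.+1) - y i / (1 + y i)))).
  by apply: ler_sum => i _; exact: (@logistic_step del rho i d0 r0 y).
rewrite -mulr_sumr telescope_sumr//; apply: ler_piMr; first by solve_ge0.
have yp j : 0 < 1 + y j by have := y0 j; lra.
have h1 : y k / (1 + y k) <= 1 by rewrite ler_pdivrMr// mul1r lerDr.
have h2 : 0 <= y 0%N / (1 + y 0%N) by rewrite divr_ge0// ltW.
lra.
Qed.

Variable A : R -> R.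
Hypothesis A0 : forall x, 0 <= A x.
Hypothesis hA : potter A.

(** The bounds of Potter hold beyond a threshold only; here one of the two
    points is any positive integer, and the constant absorbs the finitely many
    integers below the threshold. *)
Lemma potter_nat (eps : R) : 0 < eps -> exists C X : R, [/\ 1 <= C, 1 <= X &
  forall rho, X <= rho -> 0 < A rho /\
    forall i, A i.+1%:R <= C * A rho * ((i.+1%:R / rho) `^ eps + (rho / i.+1%:R) `^ eps)].
Proof.
move=> e0; have [C [X [C1 X1 hX]]] := hA e0.
have X0 : 0 < X by lra.
have AX : 0 < A X by have [] := hX X X (lexx _) (lexx _).
pose M := \sum_(0 <= j < Num.truncn X) A j.+1%:R.
have M0 : 0 <= M by apply: sumr_ge0.
exists (C + M / A X * C * 2), X; split => //.
  by rewrite -[leLHS]addr0; apply: lerD => //; solve_ge0.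
move=> rho Xr; have [Ar hr] := hX rho rho Xr Xr; split => // i.
have r0 : 0 < rho by lra.
have p0 : 0 <= (i.+1%:R / rho) `^ eps + (rho / i.+1%:R) `^ eps by rewrite addr_ge0// powR_ge0.
have [Xn|nX] := leP X i.+1%:R.
  have [_ /le_trans] := hX rho i.+1%:R Xr Xn; apply.
  apply: ler_wpM2r => //; apply: ler_wpM2r; first by solve_ge0.
  by rewrite lerDl; solve_ge0.
have AM : A i.+1%:R <= M.
  rewrite /M (bigD1_seq i) ?iota_uniq//=; first by rewrite lerDl sumr_ge0.
  by rewrite mem_index_iota/= truncn_ge_nat; exact: ltW.
apply: (le_trans AM).
have [_ h] := hX rho X Xr (lexx _).
have h2 : A X <= C * A rho * 2 * (rho / i.+1%:R) `^ eps.
  apply: (le_trans h); rewrite -!mulrA ler_wpM2l//; first by lra.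
  apply: ler_wpM2l; first by solve_ge0.
  have q1 : (X / rho) `^ eps <= (rho / i.+1%:R) `^ eps.
    apply: powR_mono; [solve_ge0|solve_ge0|].
    apply: (@le_trans _ _ 1); first by rewrite ler_pdivrMr// mul1r.
    by rewrite ler_pdivlMr// mul1r; lra.
  have q2 : (rho / X) `^ eps <= (rho / i.+1%:R) `^ eps.
    apply: powR_mono; [solve_ge0|solve_ge0|].
    by rewrite ler_pM2l// lef_pV2 ?posrE//; exact: ltW.
  lra.
apply: (@le_trans _ _ (M / A X * A X)); first by rewrite divfK// gt_eqF.
apply: (@le_trans _ _ (M / A X * (C * A rho * 2 * (rho / i.+1%:R) `^ eps))).
  by apply: ler_wpM2l => //; solve_ge0.
have q3 : 0 <= M / A X by solve_ge0.
set Q := M / A X in q3 *.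
set p := (i.+1%:R / rho) `^ eps in p0 *; set r := (rho / i.+1%:R) `^ eps in p0 *.
have p1 : 0 <= p by exact: powR_ge0.
have q6 : 0 <= C * A rho by solve_ge0.
have q7 : 0 <= Q * (C * A rho) * p by solve_ge0.
have q8 : 0 <= C * A rho * (p + r) by solve_ge0.
have -> : (C + Q * C * 2) * A rho * (p + r) = C * A rho * (p + r) +
  2 * (Q * (C * A rho) * p) + Q * (C * A rho * 2 * r) by ring.
lra.
Qed.

Lemma potter_local : exists c X : R, [/\ 0 < c, 1 <= X & forall x y, X <= x ->
  x <= y -> y <= 2 * x -> c * A x <= A y /\ c * A y <= A x].
Proof.
have [C [X [C1 X1 hX]]] := hA (@ltr01 R).
exists (3 * C)^-1, X; split => //; first by rewrite invr_gt0; lra.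
move=> x y Xx xy yx.
have x0 : 0 < x by lra.
have y0 : 0 < y by lra.
have [Ax hxy] := hX x y Xx (le_trans Xx xy).
have [Ay hyx] := hX y x (le_trans Xx xy) Xx.
have w1 : 0 <= x / y by solve_ge0.
have w2 : 0 <= y / x by solve_ge0.
move: hxy hyx; rewrite !powRr1// => hxy hyx.
have q1 : y / x <= 2 by rewrite ler_pdivrMr.
have q2 : x / y <= 1 by rewrite ler_pdivrMr// mul1r.
have CA x' : 0 < A x' -> 0 < C * A x' by move=> ?; rewrite mulr_gt0//; lra.
have CAx := CA _ Ax; have CAy := CA _ Ay.
by split; rewrite ler_pdivrMl; nra.
Qed.

(** The weight i^(-1 - u) min (1, (i / rho)^v) behaves like i^(v - u - 1) up
    to rho and like i^(- u - 1) after it, so that the indices near rho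
    dominate the sum, which is of the order of its terms there times rho. The
    slowly varying factor costs powers (i / rho)^(+ del), (i / rho)^(- del)
    with 2 del <= min (u, v - u), and what remains is dominated by the
    summable weights of [sum_logistic]. *)
Lemma sum_upper (u v : R) : 0 < u -> u < v -> exists C X : R,
  [/\ 0 < C, 1 <= X & forall rho k, X <= rho ->
   \sum_(0 <= i < k) i.+1%:R `^ (- 1 - u) * A i.+1%:R ^+ 2 * Num.min 1 ((i.+1%:R / rho) `^ v)
   <= C * rho `^ (- u) * A rho ^+ 2].
Proof.
move=> u0 uv.
pose del := Num.min u (v - u) / 2.
have d0 : 0 < del by rewrite divr_gt0// lt_min u0 subr_gt0.
have du : 2 * del <= u by rewrite /del mulrC divfK// ge_min lexx.
have dv : 2 * del <= v - u by rewrite /del mulrC divfK// ge_min lexx orbT.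
have e0 : 0 < del / 2 by rewrite divr_gt0.
have [C [X [C1 X1 hX]]] := potter_nat e0.
pose B := 2 `^ del * 2 / del.
have B0 : 0 < B by rewrite divr_gt0// mulr_gt0// powR_gt0.
exists (16 * C ^+ 2 * B), X; split => //.
  by solve_gt0.
move=> rho k Xr; have [Ar hr] := hX _ Xr.
have r0 : 0 < rho by lra.
pose y i := (i.+1%:R / rho) `^ del.
apply: (@le_trans _ _ (\sum_(0 <= i < k) (16 * C ^+ 2 * rho `^ (- u) * A rho ^+ 2) *
    (i.+1%:R^-1 * (y i / (1 + y i) ^+ 2)))); last first.
  rewrite -mulr_sumr [leRHS](_ : _ = (16 * C ^+ 2 * rho `^ (- u) * A rho ^+ 2) * B); last by ring.
  by apply: ler_wpM2l; [solve_ge0|exact: sum_logistic].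
apply: ler_sum => i _.
have n0 : 0 < i.+1%:R :> R by rewrite ltr0n.
set w := i.+1%:R / rho.
have w0 : 0 < w by rewrite divr_gt0.
have nE : i.+1%:R `^ (- 1 - u) = rho `^ (- u) * i.+1%:R^-1 * w `^ (- u).
  have nV : i.+1%:R `^ (- 1) = i.+1%:R^-1 :> R by apply: powR_inv1; exact: ltW.
  rewrite powRDp// nV /w powR_divp//.
  by field; rewrite !gt_eqF ?powR_gt0.
have A2 : A i.+1%:R ^+ 2 <= C ^+ 2 * A rho ^+ 2 * (2 * (w `^ del + w `^ (- del))).
  have h := hr i.
  have wV : rho / i.+1%:R = w^-1 by rewrite /w invfM invrK mulrC.
  rewrite wV powRVp// in h.
  have -> : w `^ del = (w `^ (del / 2)) ^+ 2 by rewrite powR_sqr mulrCA divff ?mulr1.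
  have -> : w `^ (- del) = (w `^ (- (del / 2))) ^+ 2.
    by rewrite powR_sqr mulrN mulrCA divff ?mulr1.
  set p := w `^ _ in h *; set q := w `^ _ in h *.
  have p0 : 0 <= p by rewrite powR_ge0.
  have q0 : 0 <= q by rewrite powR_ge0.
  apply: (@le_trans _ _ ((C * A rho * (p + q)) ^+ 2)).
    by rewrite ler_sqr ?nnegrE//; solve_ge0.
  rewrite !exprMn; apply: ler_wpM2l; first by solve_ge0.
  by rewrite -subr_ge0 (_ : _ - _ = (p - q) ^+ 2) ?sqr_ge0//; ring.
have key : w `^ (- u) * (w `^ del + w `^ (- del)) * Num.min 1 (w `^ v) <=
    8 * (y i / (1 + y i) ^+ 2).
  rewrite /y -/w.
  have D0 : 0 < w `^ del by rewrite powR_gt0.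
  have D1 : 0 < (1 + w `^ del) ^+ 2 by rewrite exprn_gt0// addr_gt0.
  have [w1|w1] := leP w 1.
    have d1 : w `^ del <= 1 by apply: powR_le1 => //; exact: ltW.
    have wv : w `^ v <= 1 by apply: powR_le1 => //; lra.
    rewrite min_r//.
    rewrite mulrAC mulrC -powRDp// mulrDl -!powRDp//.
    have s1 : w `^ (del + (- u + v)) <= w `^ del by apply: powR_le1_anti => //; lra.
    have s2 : w `^ (- del + (- u + v)) <= w `^ del by apply: powR_le1_anti => //; lra.
    apply: (@le_trans _ _ (2 * w `^ del)); first by lra.
    rewrite mulrA ler_pdivlMr//; nra.
  have w1' := ltW w1.
  have d1 : 1 <= w `^ del by apply: powR_ge1 => //; exact: ltW.
  have wv : 1 <= w `^ v by apply: powR_ge1 => //; lra.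
  rewrite min_l// mulr1 mulrDr -!powRDp//.
  have s1 : w `^ (- u + del) <= w `^ (- del) by apply: ler_powR => //; lra.
  have s2 : w `^ (- u - del) <= w `^ (- del) by apply: ler_powR => //; lra.
  apply: (@le_trans _ _ (2 * w `^ (- del))); first by lra.
  rewrite powRN; set D := w `^ del in D0 D1 d1 *.
  have -> : 2 * D^-1 = 8 * (D / (4 * D ^+ 2)) by field; rewrite gt_eqF.
  rewrite ler_pM2l// ler_pM2l// lef_pV2 ?posrE//; [nra|solve_gt0].
rewrite nE.
have m0 : 0 <= Num.min 1 (w `^ v) by rewrite le_min ler01 powR_ge0.
apply: (@le_trans _ _ (rho `^ (- u) * i.+1%:R^-1 * w `^ (- u) *
   (C ^+ 2 * A rho ^+ 2 * (2 * (w `^ del + w `^ (- del)))) * Num.min 1 (w `^ v))).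
  by apply: ler_wpM2r => //; apply: ler_wpM2l => //; solve_ge0.
rewrite [leLHS](_ : _ = (2 * C ^+ 2 * rho `^ (- u) * A rho ^+ 2 * i.+1%:R^-1) *
  (w `^ (- u) * (w `^ del + w `^ (- del)) * Num.min 1 (w `^ v))); last by ring.
rewrite [leRHS](_ : _ = (2 * C ^+ 2 * rho `^ (- u) * A rho ^+ 2 * i.+1%:R^-1) *
   (8 * (y i / (1 + y i) ^+ 2))); last by ring.
by apply: ler_wpM2l => //; solve_ge0.
Qed.

End sums.

(** At least rho / 2 integers lie between rho and 2 rho. *)
Lemma block_lower (R : realType) (f : nat -> R) (rho m : R) :
  (forall i, 0 <= f i) -> 0 <= m -> 2 <= rho ->
  (forall i, rho <= i.+1%:R -> i.+1%:R <= 2 * rho -> m <= f i) ->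
  exists k : nat, k%:R <= 2 * rho /\ m * rho / 2 <= \sum_(0 <= i < k) f i.
Proof.
move=> f0 m0 r2 hf.
have r0 : 0 <= rho by lra.
have r20 : 0 <= 2 * rho by lra.
pose k := Num.truncn (2 * rho); pose k0 := Num.truncn rho.
have hk : k%:R <= 2 * rho by rewrite truncn_le.
have hk' : 2 * rho < k.+1%:R by exact: truncnS_gt.
have h0 : k0%:R <= rho by rewrite truncn_le.
have h0' : rho < k0.+1%:R by exact: truncnS_gt.
exists k; split => //.
have k0k : (k0 <= k)%N.
  by rewrite -ltnS -(ltr_nat R); apply: le_lt_trans hk'; lra.
rewrite (@big_cat_nat _ _ _ k0)//=.
apply: (@le_trans _ _ (\sum_(k0 <= i < k) f i)); last by rewrite lerDr sumr_ge0.
apply: (@le_trans _ _ (\sum_(k0 <= i < k) m)).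
  rewrite sumr_const_nat -[leRHS]mulr_natr -[leLHS]mulrA; apply: ler_wpM2l => //.
  rewrite natrB//; move: hk' h0; rewrite -[k.+1%:R]natr1; lra.
rewrite big_nat [leRHS]big_nat; apply: ler_sum => i /andP[ki ik].
apply: hf; first by apply/ltW/(lt_le_trans h0'); rewrite ler_nat.
by apply: le_trans hk; rewrite ler_nat.
Qed.

(** * Sums weighted by the shrinkage factors *)

Section sequences.
Context (R : realType) (A : R -> R) (A0 : forall x, 0 <= A x) (hA : potter A).

Lemma potter_pos : exists X : R, 1 <= X /\ forall x, X <= x -> 0 < A x.
Proof.
have [C [X [_ X1 h]]] := hA (@ltr01 R); exists X; split => // x Xx.
by have [] := h x x Xx Xx.
Qed.

(** [sum_upper] at one fixed point Y, where the minimum is at least Y^(- 2 u).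
    *)
Lemma sum_bounded (u : R) : 0 < u -> exists M : R, 0 < M /\
  forall k, \sum_(0 <= i < k) i.+1%:R `^ (- 1 - u) * A i.+1%:R ^+ 2 <= M.
Proof.
move=> u0; have uv : u < 2 * u by lra.
have [C [X [C0 X1 h]]] := sum_upper A0 hA u0 uv.
have X0 : 0 < X by lra.
have [X' [X'1 hX']] := potter_pos.
pose Y := Num.max X X'.
have XY : X <= Y by rewrite le_max lexx.
have AY : 0 < A Y by apply: hX'; rewrite le_max lexx orbT.
have Y0 : 0 < Y by lra.
have Y1 : 1 <= Y by lra.
exists (Y `^ (2 * u) * (C * Y `^ (- u) * A Y ^+ 2)); split; first by solve_gt0.
move=> k; have := h Y k XY.
rewrite -(ler_pM2l (_ : 0 < Y `^ (2 * u))); last by solve_gt0.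
apply: le_trans; rewrite mulr_sumr; apply: ler_sum => i _.
rewrite [leRHS]mulrCA; apply: ler_peMr; first by solve_ge0.
have n1 : 1 <= i.+1%:R :> R by rewrite ler1n.
have Yu : 1 <= Y `^ (2 * u) by apply: powR_ge1 => //; lra.
rewrite minEle; case: ifP => _; first by rewrite mulr1.
rewrite powR_divp//.
rewrite mulrC divfK; last by rewrite gt_eqF// powR_gt0.
by apply: powR_ge1 => //; lra.
Qed.

(** The slowly varying function that appears in the critical case beta + q = 1
    + 2 alpha + 2 p. *)
Definition log_sum (r : R) : R :=
  \sum_(0 <= i < Num.truncn r) i.+1%:R^-1 * A i.+1%:R ^+ 2.

Lemma nat_lt_truncn (r : R) (i : nat) : (i < Num.truncn r)%N -> i.+1%:R <= r.
Proof. by rewrite truncn_gt_nat. Qed.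

Lemma nat_ge_truncn (r : R) (i : nat) : (Num.truncn r <= i)%N -> r < i.+1%:R.
Proof. by move=> h; apply: (lt_le_trans (truncnS_gt r)); rewrite ler_nat. Qed.

Lemma sum_nonneg_le (f : nat -> R) (k k' : nat) : (forall i, 0 <= f i) ->
  (k <= k')%N -> \sum_(0 <= i < k) f i <= \sum_(0 <= i < k') f i.
Proof.
move=> f0 kk; rewrite [leRHS](@big_cat_nat _ _ _ k)//= lerDl.
by apply: sumr_ge0.
Qed.

Lemma log_sum_mono (r r' : R) : r <= r' -> log_sum r <= log_sum r'.
Proof.
move=> rr; apply: sum_nonneg_le; first by move=> i; solve_ge0.
by exact: le_truncn.
Qed.

(** The indices between r / 2 and r already contribute a multiple of (A r)^2.
    *)
Lemma log_sum_lower : exists c X : R, [/\ 0 < c, 1 <= X &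
  forall r, X <= r -> c * A r ^+ 2 <= log_sum r].
Proof.
have [c [X [c0 X1 h]]] := potter_local hA.
exists (c ^+ 2 / 4), (Num.max 4 (2 * X)); split; first by solve_gt0.
  by rewrite le_max ler1n.
move=> r; rewrite ge_max => /andP[r4 rX].
have r0 : 0 < r by lra.
have [] := @block_lower R (fun i => i.+1%:R^-1 * A i.+1%:R ^+ 2) (r / 2) (r^-1 * (c ^+ 2 * A r ^+ 2)).
- by move=> i; solve_ge0.
- by solve_ge0.
- by lra.
- move=> i h1 h2; have n0 : 0 < i.+1%:R :> R by rewrite ltr0n.
  have nr : i.+1%:R <= r by lra.
  have [_ hc] : c * A i.+1%:R <= A r /\ c * A r <= A i.+1%:R by apply: h; lra.
  apply: ler_pM; [by solve_ge0|by solve_ge0| |].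
    by rewrite lef_pV2 ?posrE.
  by rewrite -exprMn ler_sqr ?nnegrE//; solve_ge0.
move=> k [hk hsum].
apply: (@le_trans _ _ (r^-1 * (c ^+ 2 * A r ^+ 2) * (r / 2) / 2)).
  rewrite le_eqVlt; apply/orP; left; apply/eqP; field; rewrite gt_eqF//.
apply: (le_trans hsum); apply: sum_nonneg_le; first by move=> i; solve_ge0.
by rewrite truncn_ge_nat; [lra|exact: ltW].
Qed.

Lemma potter_up (eps : R) : 0 < eps -> exists C X : R, [/\ 1 <= C, 1 <= X &
  forall x y, X <= x -> x <= y ->
    A x <= C * (y / x) `^ eps * A y /\ A y <= C * (y / x) `^ eps * A x].
Proof.
move=> e0; have [C [X [C1 X1 h]]] := hA e0.
exists (2 * C), X; split => //; first by lra.
move=> x y Xx xy.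
have x0 : 0 < x by lra.
have y0 : 0 < y by lra.
have yx : 1 <= y / x by rewrite ler_pdivlMr ?mul1r.
have xy1 : x / y <= 1 by rewrite ler_pdivrMr ?mul1r.
have p1 : 1 <= (y / x) `^ eps by apply: powR_ge1 => //; lra.
have p2 : (x / y) `^ eps <= 1 by apply: powR_le1 => //; [solve_gt0|lra].
have [Ax h1] := h x y Xx (le_trans Xx xy).
have [Ay h2] := h y x (le_trans Xx xy) Xx.
have q1 : 0 <= C * A x by solve_ge0.
have q2 : 0 <= C * A y by solve_ge0.
split.
  apply: (le_trans h2); rewrite (_ : 2 * C * (y / x) `^ eps * A y = C * A y * (2 * (y / x) `^ eps)); last by ring.
  by apply: ler_wpM2l => //; lra.
apply: (le_trans h1); rewrite (_ : 2 * C * (y / x) `^ eps * A x = C * A x * (2 * (y / x) `^ eps)); last by ring.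
by apply: ler_wpM2l => //; lra.
Qed.

(** The increment of the sum from x to y has, for every i in between, A i <= C
    (i / x)^(eps / 2) A x, and D = (i / y)^eps <= 1 is at most 4 D / (1 +
    D)^2, so that [sum_logistic] applies; the increment is at most a multiple
    of (y / x)^eps (A x)^2, which is at most a multiple of (y / x)^eps times
    the sum up to x. *)
Lemma log_sum_potter (eps : R) : 0 < eps -> exists C X : R, [/\ 1 <= C, 1 <= X &
  forall x y, X <= x -> x <= y -> log_sum y <= C * (y / x) `^ eps * log_sum x].
Proof.
move=> e0; have e20 : 0 < eps / 2 by lra.
have [C [X [C1 X1 h]]] := potter_up e20.
have [c [X' [c0 X'1 h']]] := log_sum_lower.
pose B := 2 `^ eps * 2 / eps.
have B0 : 0 < B by rewrite /B; solve_gt0.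
exists (1 + 4 * C ^+ 2 * B / c), (Num.max X X'); split.
- by rewrite lerDl; solve_ge0.
- by rewrite le_max X1.
move=> x y; rewrite ge_max => /andP[Xx X'x] xy.
have x0 : 0 < x by lra.
have y0 : 0 < y by lra.
have yx : 1 <= y / x by rewrite ler_pdivlMr ?mul1r.
have p1 : 1 <= (y / x) `^ eps by apply: powR_ge1 => //; lra.
have hx := h' x X'x.
have L0 : 0 <= log_sum x by apply: le_trans hx; solve_ge0.
rewrite {1}/log_sum (@big_cat_nat _ _ _ (Num.truncn x))//=; last exact: le_truncn.
rewrite -/(log_sum x).
have key : \sum_(Num.truncn x <= i < Num.truncn y) i.+1%:R^-1 * A i.+1%:R ^+ 2 <=
   4 * C ^+ 2 * (y / x) `^ eps * A x ^+ 2 * B.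
  apply: (@le_trans _ _ (\sum_(Num.truncn x <= i < Num.truncn y)
     (4 * C ^+ 2 * (y / x) `^ eps * A x ^+ 2) * (i.+1%:R^-1 *
     ((i.+1%:R / y) `^ eps / (1 + (i.+1%:R / y) `^ eps) ^+ 2)))); last first.
    rewrite -mulr_sumr; apply: ler_wpM2l; first by solve_ge0.
    apply: le_trans (sum_logistic (Num.truncn y) e0 y0).
    rewrite [leRHS](@big_cat_nat _ _ _ (Num.truncn x))//=; last exact: le_truncn.
    by rewrite lerDr; apply: sumr_ge0 => i _; solve_ge0.
  rewrite big_nat [leRHS]big_nat; apply: ler_sum => i /andP[xi iy].
  have n0 : 0 < i.+1%:R :> R by rewrite ltr0n.
  have xn := nat_ge_truncn xi; have ny := nat_lt_truncn iy.
  have [_ hi] := h x i.+1%:R Xx (ltW xn).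
  set D := (i.+1%:R / y) `^ eps.
  have D0 : 0 < D by rewrite /D; solve_gt0.
  have D1 : D <= 1.
    by apply: powR_le1; [solve_gt0|rewrite ler_pdivrMr ?mul1r|exact: ltW].
  have A2 : A i.+1%:R ^+ 2 <= C ^+ 2 * ((y / x) `^ eps * D) * A x ^+ 2.
    have -> : (y / x) `^ eps * D = ((i.+1%:R / x) `^ (eps / 2)) ^+ 2.
      rewrite powR_sqr mulrCA divff// mulr1 /D -powRM; [|solve_ge0|solve_ge0].
      by congr (_ `^ _); field; rewrite !gt_eqF.
    by rewrite -!exprMn ler_sqr ?nnegrE//; solve_ge0.
  rewrite [leRHS]mulrCA; apply: ler_wpM2l; first by solve_ge0.
  apply: (le_trans A2).
  rewrite (_ : C ^+ 2 * _ * _ = 4 * C ^+ 2 * (y / x) `^ eps * A x ^+ 2 * (D / 4)); last by field.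
  apply: ler_wpM2l; first by solve_ge0.
  apply: ler_wpM2l; first by exact: ltW.
  rewrite lef_pV2 ?posrE//; [nra|solve_gt0].
rewrite mulrDl mul1r mulrDl; apply: lerD; first by rewrite ler_peMl.
apply: (le_trans key).
rewrite (_ : _ * B = 4 * C ^+ 2 * B / c * (y / x) `^ eps * (c * A x ^+ 2)); last first.
  by field; rewrite gt_eqF.
by apply: ler_wpM2l => //; solve_ge0.
Qed.

Section comparison.
Variables (a D : R).
Hypotheses (a0 : 0 < a) (D1 : 1 <= D).

(** Satisfied by x_i = n lambda_i kappa_i^2 with rho = rho_n, and all that is
    used about x. *)
Definition comparable_to (rho : R) (x : nat -> R) : Prop :=
  forall i, D^-1 * (rho / i.+1%:R) `^ a <= x i <= D * (rho / i.+1%:R) `^ a.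

Let D0 : 0 < D. Proof. exact: lt_le_trans ltr01 D1. Qed.

Lemma comparable_ge0 (rho : R) (x : nat -> R) (i : nat) : comparable_to rho x -> 0 <= x i.
Proof. by move=> h; have /andP[h1 _] := h i; apply: le_trans h1; solve_ge0. Qed.

Lemma shrink_upper (rho : R) (x : nat -> R) (i : nat) : 0 < rho -> comparable_to rho x ->
  (1 + x i)^-1 <= D * Num.min 1 ((i.+1%:R / rho) `^ a).
Proof.
move=> r0 h; have x0 := comparable_ge0 i h; have /andP[h1 _] := h i.
have n0 : 0 < i.+1%:R :> R by rewrite ltr0n.
have P0 : 0 < (rho / i.+1%:R) `^ a by solve_gt0.
have -> : (i.+1%:R / rho) `^ a = ((rho / i.+1%:R) `^ a)^-1.
  by rewrite -powRN -powRVp ?invf_div//; solve_gt0.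
rewrite minEle; case: ifP => _.
  by rewrite mulr1; apply: le_trans D1; rewrite invf_le1; lra.
rewrite -[D in leRHS]invrK -invfM lef_pV2 ?posrE; [lra|lra|solve_gt0].
Qed.

Lemma shrink_lower_small (rho : R) (x : nat -> R) (i : nat) : 0 < rho -> comparable_to rho x -> i.+1%:R <= rho ->
  (i.+1%:R / rho) `^ a <= 2 * D * (1 + x i)^-1.
Proof.
move=> r0 h nr; have x0 := comparable_ge0 i h; have /andP[_ h1] := h i.
have n0 : 0 < i.+1%:R :> R by rewrite ltr0n.
have P0 : 1 <= (rho / i.+1%:R) `^ a by apply: powR_ge1; [rewrite ler_pdivlMr ?mul1r|exact: ltW].
have -> : (i.+1%:R / rho) `^ a = ((rho / i.+1%:R) `^ a)^-1.
  by rewrite -powRN -powRVp ?invf_div//; solve_gt0.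
rewrite ler_pdivlMr; last by lra.
rewrite mulrC; set P := (_ `^ a) in h1 P0 *.
have D1' := D1; rewrite ler_pdivrMr; nra.
Qed.

(** A common lower bound for the shrinkage factors 1 / (1 + x_i), 1 / (1 +
    x_i)^2 and x_i / (1 + x_i)^2 when i lies between rho and 2 rho, where x_i
    is of order one. *)
Definition block_const : R := (D * 2 `^ a)^-1 / (1 + D * 2 `^ a) ^+ 2.

Lemma block_const_gt0 : 0 < block_const.
Proof. by rewrite /block_const; solve_gt0. Qed.

Lemma block_shrink (rho : R) (x : nat -> R) (i : nat) : 0 < rho -> comparable_to rho x ->
  rho <= i.+1%:R -> i.+1%:R <= 2 * rho ->
  [/\ block_const <= x i / (1 + x i) ^+ 2, block_const <= ((1 + x i) ^+ 2)^-1 &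
      block_const <= (1 + x i)^-1].
Proof.
move=> r0 h rn nr; have x0 := comparable_ge0 i h; have /andP[h1 h2] := h i.
have n0 : 0 < i.+1%:R :> R by rewrite ltr0n.
set E := D * 2 `^ a.
have P2 : 1 <= 2 `^ a :> R by apply: powR_ge1; [rewrite ler1n|exact: ltW].
have D1' := D1; have E1 : 1 <= E by rewrite /E; nra.
have xE : x i <= E.
  apply: (le_trans h2); apply: ler_wpM2l; first by exact: ltW.
  apply: (le_trans _ P2); apply: powR_le1; [solve_gt0| |exact: ltW].
  by rewrite ler_pdivrMr ?mul1r.
have Ex : E^-1 <= x i.
  apply: le_trans h1; rewrite /E invfM; apply: ler_wpM2l; first by solve_ge0.
  rewrite -powRN -powRVp; last by lra.
  apply: powR_mono; [exact: ltW|solve_ge0|].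
  by rewrite ler_pdivlMr// mulrC ler_pdivrMr; lra.
have Ei : E^-1 <= 1 by rewrite invf_le1; lra.
have Ei0 : 0 < E^-1 by rewrite invr_gt0; lra.
have D2 : ((1 + E) ^+ 2)^-1 <= ((1 + x i) ^+ 2)^-1.
  by rewrite lef_pV2 ?posrE ?ler_sqr ?nnegrE; try lra; apply: exprn_gt0; lra.
have P : 0 <= ((1 + E) ^+ 2)^-1 by rewrite invr_ge0 sqr_ge0.
have D3 : block_const <= ((1 + x i) ^+ 2)^-1.
  by rewrite /block_const -/E; apply: le_trans D2; rewrite ler_piMl.
split => //.
  by rewrite /block_const -/E; apply: ler_pM => //; exact: ltW.
apply: (le_trans D3); rewrite lef_pV2 ?posrE; try (apply: exprn_gt0; lra); try lra.
by rewrite expr2; nra.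
Qed.

Lemma block_sum (j : nat) (u : R) : -1 < u -> exists c X : R, [/\ 0 < c, 1 <= X &
  forall rho (h : nat -> R), X <= rho -> (forall i, 0 <= h i) ->
   (forall i, rho <= i.+1%:R -> i.+1%:R <= 2 * rho -> block_const <= h i) ->
   exists k, c * (rho `^ (- u) * A rho ^+ j) <=
      \sum_(0 <= i < k) i.+1%:R `^ (- 1 - u) * A i.+1%:R ^+ j * h i].
Proof.
move=> u1; have [c [X [c0 X1 hc]]] := potter_local hA.
have b0 := block_const_gt0.
exists (2 `^ (- 1 - u) * c ^+ j * block_const / 2), (Num.max 2 X); split.
- by solve_gt0.
- by rewrite le_max ler1n.
move=> rho h; rewrite ge_max => /andP[r2 Xr] h0 hb.
have r0 : 0 < rho by lra.
have [] := @block_lower R (fun i => i.+1%:R `^ (- 1 - u) * A i.+1%:R ^+ j * h i) rho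
  ((2 * rho) `^ (- 1 - u) * (c * A rho) ^+ j * block_const).
- by move=> i; have := h0 i; move=> ?; solve_ge0.
- by solve_ge0.
- by [].
- move=> i rn nr; have n0 : 0 < i.+1%:R :> R by rewrite ltr0n.
  have [hcl _] := hc rho i.+1%:R Xr rn nr.
  apply: ler_pM; [by solve_ge0|exact: ltW| |exact: hb].
  apply: ler_pM; [by solve_ge0|by solve_ge0| |].
    have -> : - 1 - u = - (1 + u) by ring.
    rewrite !powRN lef_pV2 ?posrE; [|solve_gt0|solve_gt0].
    by apply: powR_mono; lra.
  by apply: lerXn2r; rewrite ?nnegrE //; solve_ge0.
move=> k [_ hk]; exists k; apply: le_trans hk.
rewrite powRM; [|lra|lra].
rewrite [rho `^ (- 1 - u)]powRDp// powR_inv1; last by lra.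
rewrite exprMn le_eqVlt; apply/orP; left; apply/eqP; field.
by rewrite gt_eqF.
Qed.

Lemma spread_upper (u : R) : 0 < u -> u < a -> exists C X : R, [/\ 0 < C, 1 <= X &
  forall (rho : R) (x : nat -> R) k, X <= rho -> comparable_to rho x ->
   \sum_(0 <= i < k) i.+1%:R `^ (- 1 - u) * A i.+1%:R ^+ 2 * (1 + x i)^-1 <=
   C * (rho `^ (- u) * A rho ^+ 2)].
Proof.
move=> u0 ua; have [C [X [C0 X1 h]]] := sum_upper A0 hA u0 ua.
exists (D * C), X; split => //; first by solve_gt0.
move=> rho x k Xr cx; have r0 : 0 < rho by lra.
rewrite -mulrA [C * _]mulrA; apply: le_trans (ler_wpM2l (ltW D0) (h rho k Xr)).
rewrite mulr_sumr; apply: ler_sum => i _.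
rewrite [leRHS]mulrCA; apply: ler_wpM2l; first by solve_ge0.
exact: shrink_upper.
Qed.

Lemma shrink_sqr_upper (rho : R) (x : nat -> R) (i : nat) : 0 < rho -> comparable_to rho x ->
  ((1 + x i)^-1) ^+ 2 <= D ^+ 2 * Num.min 1 ((i.+1%:R / rho) `^ (2 * a)).
Proof.
move=> r0 cx; have h := shrink_upper i r0 cx; have x0 := comparable_ge0 i cx.
have n0 : 0 < i.+1%:R :> R by rewrite ltr0n.
have w0 : 0 < i.+1%:R / rho by solve_gt0.
set w := i.+1%:R / rho in h w0 *.
have -> : Num.min 1 (w `^ (2 * a)) = Num.min 1 (w `^ a) ^+ 2.
  rewrite -powR_sqr; set P := w `^ a.
  have P0 : 0 <= P by rewrite /P; solve_ge0.
  have [P1|P1] := leP P 1; first by rewrite !min_r// expr_le1.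
  by rewrite !min_l ?expr1n// ltW// exprn_egt1.
rewrite -exprMn ler_sqr// nnegrE; first by rewrite invr_ge0; lra.
by apply: le_trans h; rewrite invr_ge0; lra.
Qed.

(** The quantity gamma_n^2 of the balancing condition, as a function of rho_n.
    *)
Definition gam2_at (b r : R) : R :=
  if b < a then A r ^+ 2 else if b == a then log_sum r else 1.

(** The squared factor 1 / (1 + x_i)^2 behaves like min (1, (i / rho)^(2 a)).
    For b < a the sum is dominated by indices near rho; for b > a by small
    indices, and it is a convergent sum times rho^(- 2 a); for b = a all
    indices up to rho contribute, and their sum is logarithmic. *)
Lemma bias_upper (b : R) : 0 < b -> exists C X : R, [/\ 0 < C, 1 <= X &
  forall (rho : R) (x : nat -> R) k, X <= rho -> comparable_to rho x ->
   \sum_(0 <= i < k) i.+1%:R `^ (- 1 - 2 * b) * A i.+1%:R ^+ 2 * ((1 + x i)^-1) ^+ 2 <=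
   C * ((rho `^ (- Num.min b a)) ^+ 2 * gam2_at b rho)].
Proof.
move=> b0; rewrite /gam2_at; have D0' := D0; have a0' := a0.
case: ltgtP => [ba|ab|ba].
- have u0 : 0 < 2 * b by lra.
  have uv : 2 * b < 2 * a by lra.
  have [C [X [C0 X1 h]]] := sum_upper A0 hA u0 uv.
  exists (D ^+ 2 * C), X; split => //; first by solve_gt0.
  move=> rho x k Xr cx; have r0 : 0 < rho by lra.
  rewrite powR_sqr mulrN.
  rewrite -mulrA [C * _]mulrA; apply: le_trans (ler_wpM2l (sqr_ge0 D) (h rho k Xr)).
  rewrite mulr_sumr; apply: ler_sum => i _.
  rewrite [leRHS]mulrCA; apply: ler_wpM2l; first by solve_ge0.
  exact: shrink_sqr_upper.
- have d0 : 0 < 2 * b - 2 * a by lra.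
  have [M [M0 hM]] := sum_bounded d0.
  exists (D ^+ 2 * M), 1; split => //; first by solve_gt0.
  move=> rho x k Xr cx; have r0 : 0 < rho by lra.
  rewrite mulr1 powR_sqr.
  have Q0 : 0 <= D ^+ 2 * rho `^ (2 * - a) by solve_ge0.
  rewrite mulrAC; apply: le_trans (ler_wpM2l Q0 (hM k)).
  rewrite mulr_sumr; apply: ler_sum => i _.
  have n0 : 0 < i.+1%:R :> R by rewrite ltr0n.
  have hs := shrink_sqr_upper i r0 cx.
  have {}hs : (1 + x i)^-1 ^+ 2 <= D ^+ 2 * (i.+1%:R / rho) `^ (2 * a).
    by apply: (le_trans hs); apply: ler_wpM2l; [solve_ge0|rewrite ge_min lexx orbT].
  apply: (@le_trans _ _ (i.+1%:R `^ (- 1 - 2 * b) * A i.+1%:R ^+ 2 *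
     (D ^+ 2 * (i.+1%:R / rho) `^ (2 * a)))); first by apply: ler_wpM2l => //; solve_ge0.
  rewrite powR_divp// mulrN powRN le_eqVlt; apply/orP; left; apply/eqP.
  have -> : - 1 - (2 * b - 2 * a) = (- 1 - 2 * b) + 2 * a by ring.
  by rewrite [_ `^ (_ + 2 * a)]powRDp//; ring.
- rewrite {}ba in b0 *.
  have u0 : 0 < 2 * a by lra.
  have uv : 2 * a < 3 * a by lra.
  have [C [X [C0 X1 h]]] := sum_upper A0 hA u0 uv.
  have [c [X' [c0 X'1 hc]]] := log_sum_lower.
  exists (D ^+ 2 * (1 + C / c)), (Num.max X X'); split.
  + by solve_gt0.
  + by rewrite le_max X1.
  move=> rho x k; rewrite ge_max => /andP[Xr X'r] cx; have r0 : 0 < rho by lra.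
  rewrite powR_sqr mulrN.
  have hcr := hc _ X'r.
  have A2 : 0 <= A rho ^+ 2 by solve_ge0.
  have L0 : 0 <= log_sum rho by apply: le_trans hcr; solve_ge0.
  pose f i := i.+1%:R^-1 * A i.+1%:R ^+ 2.
  apply: (@le_trans _ _ (D ^+ 2 * (rho `^ (- (2 * a)) * log_sum rho + C * rho `^ (- (2 * a)) * A rho ^+ 2))).
    apply: (@le_trans _ _ (D ^+ 2 * \sum_(0 <= i < k)
       (rho `^ (- (2 * a)) * (if (i < Num.truncn rho)%N then f i else 0) +
        i.+1%:R `^ (- 1 - 2 * a) * A i.+1%:R ^+ 2 * Num.min 1 ((i.+1%:R / rho) `^ (3 * a))))); last first.
      apply: ler_wpM2l; first by solve_ge0.
      rewrite big_split/= -mulr_sumr; apply: lerD; last exact: h.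
      apply: ler_wpM2l; first by solve_ge0.
      rewrite -big_mkcond /log_sum.
      apply: (@le_trans _ _ (\sum_(0 <= i < maxn k (Num.truncn rho) | (i < Num.truncn rho)%N) f i)).
        rewrite big_mkcond [leRHS]big_mkcond; apply: sum_nonneg_le; last exact: leq_maxl.
        by move=> i; case: ifP => // _; rewrite /f; solve_ge0.
      rewrite [leRHS](big_nat_widen _ _ (maxn k (Num.truncn rho)))//; exact: leq_maxr.
    rewrite mulr_sumr; apply: ler_sum => i _.
    have n0 : 0 < i.+1%:R :> R by rewrite ltr0n.
    have hs := shrink_sqr_upper i r0 cx.
    apply: (@le_trans _ _ (i.+1%:R `^ (- 1 - 2 * a) * A i.+1%:R ^+ 2 *
       (D ^+ 2 * Num.min 1 ((i.+1%:R / rho) `^ (2 * a))))); first by apply: ler_wpM2l => //; solve_ge0.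
    rewrite mulrCA; apply: ler_wpM2l; first by solve_ge0.
    have f0 : 0 <= f i by rewrite /f; solve_ge0.
    have m0 : 0 <= Num.min 1 ((i.+1%:R / rho) `^ (3 * a)) by rewrite le_min ler01 powR_ge0.
    case: ltnP => hi.
      apply: (@le_trans _ _ (rho `^ (- (2 * a)) * f i)); last by rewrite lerDl; solve_ge0.
      apply: (@le_trans _ _ (i.+1%:R `^ (- 1 - 2 * a) * A i.+1%:R ^+ 2 * (i.+1%:R / rho) `^ (2 * a))).
        by apply: ler_wpM2l; [solve_ge0|rewrite ge_min lexx orbT].
      rewrite powR_divp// powRDp// powR_inv1; last exact: ltW.
      rewrite le_eqVlt; apply/orP; left; apply/eqP; rewrite /f !powRN; field.
      by rewrite !gt_eqF//; solve_gt0.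
    rewrite mulr0 add0r; apply: ler_wpM2l; first by solve_ge0.
    have w1 : 1 <= i.+1%:R / rho by rewrite ler_pdivlMr// mul1r; apply/ltW/nat_ge_truncn.
    rewrite le_min ge_min lexx/=; rewrite ge_min; apply/orP; left; apply: powR_ge1 => //; lra.
  rewrite -[leRHS]mulrA; apply: ler_wpM2l; first by solve_ge0.
  have -> : (1 + C / c) * (rho `^ (- (2 * a)) * log_sum rho) =
    rho `^ (- (2 * a)) * log_sum rho + (C / c * rho `^ (- (2 * a))) * log_sum rho by ring.
  rewrite lerD2l.
  have -> : C * rho `^ (- (2 * a)) * A rho ^+ 2 = (C / c * rho `^ (- (2 * a))) * (c * A rho ^+ 2).
    by field; rewrite gt_eqF.
  by apply: ler_wpM2l => //; solve_ge0.
Qed.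

(** A single term, at an index where A is positive. *)
Lemma head_lower (u : R) (j : nat) : exists c X : R, exists k : nat, [/\ 0 < c, 1 <= X &
  forall (rho : R) (x : nat -> R), X <= rho -> comparable_to rho x ->
   c * (rho `^ (- a)) ^+ j <= \sum_(0 <= i < k) i.+1%:R `^ u * A i.+1%:R ^+ j * ((1 + x i)^-1) ^+ j].
Proof.
have [X0 [X01 hX0]] := potter_pos; have a0' := a0; have D0' := D0.
(* n = i0 + 1 is the first integer above the threshold X0. *)
pose i0 := Num.truncn X0.
have n0 : 0 < i0.+1%:R :> R by rewrite ltr0n.
have Ai : 0 < A i0.+1%:R by apply: hX0; apply/ltW/truncnS_gt.
exists (i0.+1%:R `^ u * A i0.+1%:R ^+ j * ((2 * D)^-1 * i0.+1%:R `^ a) ^+ j), i0.+1%:R, i0.+1; split.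
- by solve_gt0.
- by rewrite ler1n.
move=> rho x Xr cx.
have r0 : 0 < rho by exact: lt_le_trans Xr.
apply: (@le_trans _ _ (i0.+1%:R `^ u * A i0.+1%:R ^+ j * ((1 + x i0)^-1) ^+ j)); last first.
  rewrite big_nat_recr//= lerDr; apply: sumr_ge0 => i _.
  have xi := comparable_ge0 i cx.
  have Xi : 0 <= (1 + x i)^-1 by rewrite invr_ge0; lra.
  by solve_ge0.
rewrite -mulrA; apply: ler_wpM2l; first by solve_ge0.
rewrite -exprMn; apply: lerXn2r; rewrite ?nnegrE.
- by solve_ge0.
- have xi := comparable_ge0 i0 cx; rewrite invr_ge0; lra.
have := shrink_lower_small r0 cx Xr; rewrite powR_divp// powRN.
by move=> hs; rewrite -[leLHS]mulrA ler_pdivrMl; [|solve_gt0].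
Qed.

Lemma bias_lower (b : R) : 0 < b -> exists c X : R, [/\ 0 < c, 1 <= X &
  forall (rho : R) (x : nat -> R), X <= rho -> comparable_to rho x -> exists k,
   c * ((rho `^ (- Num.min b a)) ^+ 2 * gam2_at b rho) <=
   \sum_(0 <= i < k) i.+1%:R `^ (- 1 - 2 * b) * A i.+1%:R ^+ 2 * ((1 + x i)^-1) ^+ 2].
Proof.
move=> b0; rewrite /gam2_at; have D0' := D0; have a0' := a0.
case: ltgtP => [ba|ab|ba].
- have u1 : -1 < 2 * b by lra.
  have [c [X [c0 X1 h]]] := @block_sum 2 (2 * b) u1.
  exists c, X; split => // rho x Xr cx.
  have r0 : 0 < rho by lra.
  rewrite powR_sqr mulrN; apply: h => //; first by move=> i; solve_ge0.
  by move=> i h1 h2; have [_ + _] := block_shrink r0 cx h1 h2; rewrite exprVn.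
- have [c [X [k [c0 X1 h]]]] := head_lower (- 1 - 2 * b) 2.
  exists c, X; split => // rho x Xr cx; exists k.
  by rewrite mulr1; apply: h.
- rewrite {}ba in b0 *.
  exists (4 * D ^+ 2)^-1, 1; split => //; first by solve_gt0.
  move=> rho x Xr cx; exists (Num.truncn rho).
  have r0 : 0 < rho by lra.
  rewrite /log_sum !mulr_sumr big_nat [leRHS]big_nat; apply: ler_sum => i /andP[_ hi].
  have n0 : 0 < i.+1%:R :> R by rewrite ltr0n.
  have := shrink_lower_small r0 cx (nat_lt_truncn hi).
  have x0 := comparable_ge0 i cx.
  have P0 : 0 <= (i.+1%:R / rho) `^ a by solve_ge0.
  set Z := (1 + x i)^-1 => hZ.
  have h2 : (i.+1%:R / rho) `^ a ^+ 2 <= (2 * D * Z) ^+ 2.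
    by rewrite ler_sqr// nnegrE//; apply: le_trans hZ.
  have -> : (4 * D ^+ 2)^-1 * (rho `^ (- a) ^+ 2 * (i.+1%:R^-1 * A i.+1%:R ^+ 2)) =
     i.+1%:R `^ (- 1 - 2 * a) * A i.+1%:R ^+ 2 * ((4 * D ^+ 2)^-1 * (i.+1%:R / rho) `^ a ^+ 2).
    rewrite powR_divp// powRDp// powR_inv1; last exact: ltW.
    rewrite !powRN -powR_sqr; field.
    by rewrite !gt_eqF//; solve_gt0.
  apply: ler_wpM2l; first by solve_ge0.
  rewrite ler_pdivrMl; last by solve_gt0.
  by apply: (le_trans h2); rewrite !exprMn; lra.
Qed.

Lemma gam2_at_potter (b eps : R) : 0 < eps -> exists C X : R, [/\ 0 < C, 1 <= X &
  forall x y, X <= x -> x <= y -> [/\ 0 < gam2_at b x,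
    gam2_at b x <= C * (y / x) `^ eps * gam2_at b y & gam2_at b y <= C * (y / x) `^ eps * gam2_at b x]].
Proof.
move=> e0; rewrite /gam2_at; have e20 : 0 < eps / 2 by lra.
have [X0 [X01 hX0]] := potter_pos.
case: (b < a); last case: (b == a).
- have [C [X [C1 X1 h]]] := potter_up e20.
  exists (C ^+ 2), (Num.max X X0); split; first by solve_gt0.
    by rewrite le_max X1.
  move=> x y; rewrite ge_max => /andP[Xx X0x] xy.
  have x0 : 0 < x by lra.
  have y0 : 0 < y by lra.
  have [h1 h2] := h x y Xx xy; have Ax := hX0 _ X0x.
  have -> : (y / x) `^ eps = (y / x) `^ (eps / 2) ^+ 2.
    by rewrite powR_sqr mulrCA divff// mulr1.
  split; first by solve_gt0.
    by rewrite -!exprMn ler_sqr ?nnegrE//; solve_ge0.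
  by rewrite -!exprMn ler_sqr ?nnegrE//; solve_ge0.
- have [C [X [C1 X1 h]]] := log_sum_potter e0.
  have [c [X' [c0 X'1 hc]]] := log_sum_lower.
  exists C, (Num.max X (Num.max X0 X')); split.
  + by lra.
  + by rewrite le_max X1.
  move=> x y; rewrite !ge_max => /and3P[Xx X0x X'x] xy.
  have x0 : 0 < x by lra.
  have y0 : 0 < y by lra.
  have yx : 1 <= y / x by rewrite ler_pdivlMr ?mul1r.
  have p1 : 1 <= (y / x) `^ eps by apply: powR_ge1 => //; lra.
  have Ax := hX0 _ X0x.
  have Lx : 0 < log_sum x by apply: lt_le_trans (hc _ X'x); solve_gt0.
  have Lxy := log_sum_mono xy.
  split => //; last exact: h.
  apply: (le_trans Lxy); apply: ler_peMl; first by lra.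
  by nra.
- exists 1, 1; split => // x y x1 xy.
  have x0 : 0 < x by lra.
  have yx : 1 <= y / x by rewrite ler_pdivlMr ?mul1r.
  have p1 : 1 <= (y / x) `^ eps by apply: powR_ge1 => //; lra.
  by split; lra.
Qed.

(** For b < a this is the block of indices near rho. For b >= a one term gives
    rho^(- a), and the slowly varying factor [gam2_at] is at most a multiple
    of rho^(2 eps). *)
Lemma fixed_lower (b eps : R) : 0 < b -> 0 < eps -> exists c X : R, [/\ 0 < c, 1 <= X &
  forall (rho : R) (x : nat -> R), X <= rho -> comparable_to rho x -> exists k,
   c * (rho `^ (- eps) * rho `^ (- Num.min b a) * Num.sqrt (gam2_at b rho)) <=
   \sum_(0 <= i < k) i.+1%:R `^ (- 1 - (b + eps)) * A i.+1%:R * (1 + x i)^-1].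
Proof.
move=> b0 e0; have D0' := D0; have a0' := a0.
have [ba|ab] := ltP b a.
  have u1 : -1 < b + eps by lra.
  have [c [X [c0 X1 h]]] := @block_sum 1 (b + eps) u1.
  exists c, X; split => // rho x Xr cx.
  have r0 : 0 < rho by lra.
  rewrite /gam2_at ba sqrtr_sqr (ger0_norm (A0 _)) -powRDp//.
  have [||k hk] := h rho (fun i => (1 + x i)^-1) Xr.
  - by move=> i; have := comparable_ge0 i cx => ?; rewrite invr_ge0; lra.
  - by move=> i h1 h2; have [] := block_shrink r0 cx h1 h2.
  exists k; rewrite !expr1 in hk.
  by rewrite -opprD [eps + b]addrC.
have e20 : 0 < 2 * eps by lra.
have [C [X [C0 X1 hG]]] := gam2_at_potter b e20.
have [c [X' [k [c0 X'1 h]]]] := head_lower (- 1 - (b + eps)) 1.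
have G0 : 0 < gam2_at b X by have [] := hG X X (lexx _) (lexx _).
have X0 : 0 < X by lra.
pose E := Num.sqrt (C * X `^ (- (2 * eps)) * gam2_at b X).
have E0 : 0 < E by rewrite sqrtr_gt0; solve_gt0.
exists (c / E), (Num.max X X'); split; [by solve_gt0|by rewrite le_max X1|].
move=> rho x; rewrite ge_max => /andP[Xr X'r] cx; exists k.
have r0 : 0 < rho by lra.
have := h rho x X'r cx; rewrite expr1; under eq_bigr do rewrite !expr1.
apply: le_trans.
have [_ _ hr] := hG X rho (lexx _) Xr.
have sq : Num.sqrt (gam2_at b rho) <= E * rho `^ eps.
  apply: (@le_trans _ _ (Num.sqrt (C * (rho / X) `^ (2 * eps) * gam2_at b X))).
    by apply: ler_wsqrtr.
  rewrite -[rho `^ eps]ger0_norm ?powR_ge0// -sqrtr_sqr powR_sqr /E -sqrtrM; last by solve_ge0.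
  by apply: ler_wsqrtr; rewrite powR_divp// !powRN; lra.
rewrite -[leLHS]mulrA ler_pM2l// ler_pdivrMl// mulrAC; apply: ler_wpM2r; first by solve_ge0.
rewrite powRN ler_pdivrMl; last by solve_gt0.
by rewrite mulrC.
Qed.

End comparison.
End sequences.

(** * Series and coordinates in a Hilbert space *)

Lemma nonneg_series (R : realType) (f : nat -> R) (M : R) :
  (forall i, 0 <= f i) -> (forall k, \sum_(0 <= i < k) f i <= M) ->
  [/\ series f @ \oo --> limn (series f),
      forall k, \sum_(0 <= i < k) f i <= limn (series f) & limn (series f) <= M].
Proof.
move=> f0 hM.
have nd : nondecreasing_seq (series f).
  by apply/nondecreasing_seqP => n; rewrite /series/= big_nat_recr//= lerDl.
have ub : has_ubound (range (series f)).
  by exists M => _ [k _ <-]; exact: hM.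
have cv : cvgn (series f) by exact: nondecreasing_is_cvgn.
split => //.
  by move=> k; exact: (nondecreasing_cvgn_le nd cv).
by apply: limr_le => //; near=> n; exact: hM.
Unshelve. all: by end_near. Qed.

Lemma nonneg_partial_le (R : realType) (f : nat -> R) (L : R) (k : nat) : (forall i, 0 <= f i) ->
  series f @ \oo --> L -> \sum_(0 <= i < k) f i <= L.
Proof.
move=> f0 fL; rewrite -(cvg_lim _ fL)//.
have nd : nondecreasing_seq (series f).
  by apply/nondecreasing_seqP => n; rewrite /series/= big_nat_recr//= lerDl.
by apply: (nondecreasing_cvgn_le nd); apply: cvgP fL.
Qed.

Lemma dominated_series (R : realType) (f g : nat -> R) (M : R) :
  (forall i, `|f i| <= g i) -> (forall k, \sum_(0 <= i < k) g i <= M) ->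
  series f @ \oo --> limn (series f) /\ `|limn (series f)| <= M.
Proof.
move=> fg hM.
have f0 i : 0 <= `|f i| by exact: normr_ge0.
have hM' k : \sum_(0 <= i < k) `|f i| <= M.
  by apply: le_trans (hM k); apply: ler_sum => i _; exact: fg.
have [h1 h2 h3] := nonneg_series f0 hM'.
have cv : cvgn [normed series f] by apply: cvgP h1.
have cf : cvgn (series f) by exact: normed_cvg.
split => //.
apply: (le_trans (lim_series_norm cv)).
exact: h3.
Qed.

Section hilbert.
Context (R : realType) (H : completeNormedModType R) (ip : {dot H for idfun}).
Hypothesis hip : norm_of_dot ip.
Variable e : nat -> H.
Hypothesis he : forall i j, ip (e i) (e j) = (i == j)%:R.

Lemma dotC (x y : H) : ip x y = ip y x.
Proof. by rewrite hermC expr0 mul1r. Qed.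

Lemma dot_coord_le (x : H) (i : nat) : `|ip x (e i)| <= `|x|.
Proof.
set c := ip x (e i).
have : 0 <= ip (x - c *: e i) (x - c *: e i) by rewrite hip sqr_ge0.
rewrite linearBl linearBr linearBr !linearZl_LR/= !linearZr_LR/= hip.
rewrite (dotC (e i) x) -/c he eqxx /GRing.scale/= mulr1 => h.
have : c ^+ 2 <= `|x| ^+ 2 by rewrite expr2; lra.
by rewrite -[c ^+ 2]real_normK ?num_real// ler_sqr ?nnegrE ?normr_ge0.
Qed.

Lemma dot_sum_coord (m : nat -> R) (a b i : nat) :
  ip (\sum_(a <= j < b) m j *: e j) (e i) = if (a <= i < b)%N then m i else 0.
Proof.
rewrite linear_sumlz (eq_bigr (fun j => m j * (j == i)%:R)); last first.
  by move=> j _; rewrite linearZl_LR/= he.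
case: ifP => hi.
  rewrite (bigD1_seq i) ?iota_uniq ?mem_index_iota//= eqxx mulr1 big1 ?addr0// => j ji.
  by rewrite (negbTE ji) mulr0.
rewrite big_nat_cond big1// => j /andP[hj _].
case: eqVneq => [ji|_]; last by rewrite mulr0.
by rewrite ji hi in hj.
Qed.

Lemma norm_sum_coord (m : nat -> R) (a b : nat) :
  `|\sum_(a <= j < b) m j *: e j| ^+ 2 = \sum_(a <= j < b) m j ^+ 2.
Proof.
rewrite -hip linear_sumr big_nat [RHS]big_nat; apply: eq_bigr => i hi.
by rewrite linearZr_LR/= dot_sum_coord hi /GRing.scale/= expr2.
Qed.

(** The theorem of Riesz and Fischer. *)
Lemma exists_coord (m : nat -> R) (M : R) :
  (forall k, \sum_(0 <= i < k) m i ^+ 2 <= M) ->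
  exists mu : H, forall i, ip mu (e i) = m i.
Proof.
move=> hM.
pose u := series (fun j => m j *: e j).
have [cm _ _] := nonneg_series (fun i => sqr_ge0 (m i)) hM.
have cu : cvgn u.
  apply: cauchy_cvg; apply/cauchy_seriesP => eps eps0.
  have cs : cauchy (series (fun i => m i ^+ 2) @ \oo) by exact: cvg_cauchy.
  have := (iffLR (cauchy_seriesP _) cs) (eps ^+ 2).
  rewrite exprn_gt0// => /(_ isT); apply: filterS => -[a b] /=.
  rewrite ger0_norm; last by apply: sumr_ge0 => i _; exact: sqr_ge0.
  rewrite -norm_sum_coord => h.
  by rewrite -ltr_sqr ?nnegrE ?normr_ge0// ltW.
exists (limn u) => i.
have h1 : ip (u k) (e i) @[k --> \oo] --> ip (limn u) (e i).
  apply/cvgrPdist_le => eps eps0.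
  have /cvgrPdist_le /(_ _ eps0) := cu.
  apply: filterS => k; rewrite -linearBl => h.
  by apply: (le_trans (dot_coord_le _ _)).
have h2 : ip (u k) (e i) @[k --> \oo] --> m i.
  apply: cvg_near_cst; exists i.+1 => // k /= ik.
  by rewrite /u /series/= dot_sum_coord ik.
exact: (cvg_unique _ h1 h2).
Qed.

(** Turns the extended real valued Sobolev norm into bounds on real partial
    sums. *)
Lemma sobolev_normP (beta : R) (mu : H) (M : R) : 0 <= M ->
  (sobolev_norm ip e beta mu <= M%:E)%E <->
  forall k, \sum_(0 <= i < k) ip mu (e i) ^+ 2 * i.+1%:R `^ (2 * beta) <= M ^+ 2.
Proof.
move=> M0; rewrite /sobolev_norm.
set f : nat -> R := fun i => ip mu (e i) ^+ 2 * i.+1%:R `^ (2 * beta).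
have f0 i : 0 <= f i by rewrite mulr_ge0 ?sqr_ge0 ?powR_ge0.
have fE0 i : (0%N <= i)%N -> true -> (0 <= (f i)%:E)%E by rewrite lee_fin.
have S0 : (0 <= \sum_(0 <= i <oo) (f i)%:E)%E by apply: nneseries_ge0 => i _ _; exact: fE0.
have step : ((\sum_(0 <= i <oo) (f i)%:E) `^ 2^-1 <= M%:E)%E <->
            (\sum_(0 <= i <oo) (f i)%:E <= (M ^+ 2)%:E)%E.
  move: S0; case: (\sum_(0 <= i <oo) (f i)%:E)%E => [r| |] //=.
    rewrite !lee_fin => r0; rewrite powR12_sqrt//; split => h.
      by rewrite -[r]sqr_sqrtr// ler_sqr ?nnegrE ?sqrtr_ge0.
    by rewrite -(ger0_norm M0) -sqrtr_sqr ler_wsqrtr.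
  by move=> _; rewrite invr_eq0 pnatr_eq0.
rewrite step; split => h.
  move=> k; rewrite -lee_fin; apply: le_trans h.
  rewrite -sumEFin; apply: nneseries_lim_ge => i _; exact: fE0.
apply: lime_le; first by apply: is_cvg_nneseries.
by near=> k; rewrite sumEFin lee_fin.
Unshelve. all: by end_near. Qed.

End hilbert.

(** * Orders of magnitude of spread and bias *)

Lemma powR_rho (R : realType) (alpha p : R) (n : nat) (t : R) :
  0 < 1 + 2 * alpha + 2 * p -> (0 < n)%N -> 0 < t ->
  rho alpha p n t `^ (1 + 2 * alpha + 2 * p) = n%:R * t ^+ 2.
Proof.
move=> a0 n0 t0; have N0 : 0 < n%:R * t ^+ 2 by rewrite mulr_gt0 ?ltr0n ?exprn_gt0.
rewrite /rho -powRrM mulVf ?gt_eqF// powRr1//; exact: ltW.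
Qed.

Lemma potter_one (R : realType) : potter (fun=> 1 : R).
Proof.
move=> eps e0; exists 1, 1; split => // x y x1 y1; split => //.
have x0 : 0 < x by lra.
have y0 : 0 < y by lra.
rewrite !mul1r; have [xy|yx] := leP x y.
  have : 1 <= (y / x) `^ eps by apply: powR_ge1; [rewrite ler_pdivlMr ?mul1r|lra].
  by have := powR_ge0 (x / y) eps; lra.
have : 1 <= (x / y) `^ eps by apply: powR_ge1; [rewrite ler_pdivlMr ?mul1r ?ltW|lra].
by have := powR_ge0 (y / x) eps; lra.
Qed.

Lemma powR_decay (R : realType) (eps c : R) : 0 < eps -> 0 < c ->
  exists X : R, 1 <= X /\ forall r, X <= r -> r `^ (- eps) <= c.
Proof.
move=> e0 c0; exists (Num.max 1 (c^-1 `^ eps^-1)); split; first by rewrite le_max lexx.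
move=> r; rewrite ge_max => /andP[r1 rc].
have r0 : 0 < r by lra.
rewrite powRN -[leRHS]invrK lef_pV2 ?posrE ?powR_gt0 ?invr_gt0//.
have -> : c^-1 = (c^-1 `^ eps^-1) `^ eps.
  by rewrite -powRrM mulVf ?gt_eqF// powRr1// invr_ge0 ltW.
by apply: powR_mono => //; [exact: ltW|exact: powR_ge0].
Qed.

Lemma potter_decay (R : realType) (A : R -> R) (eps c : R) :
  (forall x, 0 <= A x) -> potter A -> 0 < eps -> 0 < c ->
  exists X : R, 1 <= X /\ forall r, X <= r -> r `^ (- eps) <= c * A r.
Proof.
move=> A0 hA e0 c0; have e20 : 0 < eps / 2 by lra.
have [C [X [C1 X1 h]]] := potter_up A0 hA e20.
have [X' [X'1 hX']] := potter_pos hA.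
pose Y := Num.max X X'.
have AY : 0 < A Y by apply: hX'; rewrite le_max lexx orbT.
have Y1 : 1 <= Y by rewrite le_max X1.
have Y0 : 0 < Y by lra.
have C0 : 0 < C by lra.
pose d := c * (A Y / (C * Y `^ (- (eps / 2)))).
have d0 : 0 < d by rewrite /d; solve_gt0.
have [Z [Z1 hZ]] := powR_decay e20 d0.
exists (Num.max Y Z); split; first by rewrite le_max Y1.
move=> r; rewrite ge_max => /andP[rY rZ]; have r0 : 0 < r by lra.
have [h1 _] := h Y r (ltac:(by rewrite le_max lexx)) rY.
have P0 : 0 < r `^ (eps / 2) by rewrite powR_gt0.
have key : A Y / (C * Y `^ (- (eps / 2))) * r `^ (- (eps / 2)) <= A r.
  rewrite (powRN r) ler_pdivrMr// ler_pdivrMr; last by solve_gt0.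
  apply: (le_trans h1); rewrite powR_divp// powRN.
  by rewrite [leRHS](_ : _ = C * (r `^ (eps / 2) / Y `^ (eps / 2)) * A r)//; ring.
have -> : - eps = - (eps / 2) + - (eps / 2) by field.
rewrite powRDp//; apply: (@le_trans _ _ (d * r `^ (- (eps / 2)))).
  by apply: ler_wpM2r; [solve_ge0|exact: hZ].
by rewrite /d -mulrA; apply: ler_wpM2l => //; exact: ltW.
Qed.

Lemma amgm_weighted (R : realType) (th u w : R) : 0 < th -> `|u * w| <= (th * u ^+ 2 + th^-1 * w ^+ 2) / 2.
Proof.
move=> th0; rewrite ler_norml; apply/andP; split.
  have : 0 <= th^-1 * (th * u + w) ^+ 2 by solve_ge0.
  rewrite (_ : th^-1 * (th * u + w) ^+ 2 = th * u ^+ 2 + 2 * (u * w) + th^-1 * w ^+ 2); first lra.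
  by field; rewrite gt_eqF.
have : 0 <= th^-1 * (th * u - w) ^+ 2 by solve_ge0.
rewrite (_ : th^-1 * (th * u - w) ^+ 2 = th * u ^+ 2 - 2 * (u * w) + th^-1 * w ^+ 2); first lra.
by field; rewrite gt_eqF.
Qed.

Section model.
Context (R : realType) (alpha p beta C q : R) (S : R -> R) (l kappa : nat -> R).
Hypotheses (halpha : 0 < alpha) (hp : 0 <= p) (hbeta : 0 < beta) (hC : 1 <= C).
Hypothesis hkappaC : forall i,
     C^-1 * i.+1%:R `^ (- p) <= kappa i <= C * i.+1%:R `^ (- p).
Hypotheses (hqbeta : - beta < q) (hqp : q < p) (hS : slowly_varying S).
Hypothesis hlS : forall i, `|l i| = i.+1%:R `^ (- q - 2^-1) * S i.+1%:R.
Hypothesis hqalpha : - 2^-1 - alpha < q.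

Let a := 1 + 2 * alpha + 2 * p.
Let b := beta + q.
Let A x := `|S x|.
Notation lam t := (prior_eigenvalue alpha t).
Notation xx n t := (fun i => n%:R * lam t i * kappa i ^+ 2).

Lemma model_a_gt0 : 0 < a.
Proof. have h1 := halpha; have h2 := hp; rewrite /a; lra. Qed.

Lemma model_b_gt0 : 0 < b.
Proof. have h := hqbeta; rewrite /b; lra. Qed.

Let a0 := model_a_gt0.
Let b0 := model_b_gt0.

Let A0 x : 0 <= A x. Proof. exact: normr_ge0. Qed.
Let hA : potter A. Proof. exact: slowly_varying_potter. Qed.
Let D1 : 1 <= C ^+ 2. Proof. by have h := hC; rewrite expr_ge1//; lra. Qed.

Lemma kappa_gt0 i : 0 < kappa i.
Proof.
have /andP[h _] := hkappaC i; apply: lt_le_trans h.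
by have h := hC; rewrite mulr_gt0 ?powR_gt0 ?ltr0n// invr_gt0; lra.
Qed.

Lemma lam_gt0 t i : 0 < t -> 0 < lam t i.
Proof. by move=> t0; rewrite /prior_eigenvalue mulr_gt0 ?exprn_gt0 ?powR_gt0 ?ltr0n. Qed.

Lemma rho_gt0 (n : nat) (t : R) : (0 < n)%N -> 0 < t -> 0 < rho alpha p n t.
Proof. by move=> n0 t0; rewrite /rho powR_gt0// mulr_gt0 ?exprn_gt0 ?ltr0n. Qed.

Lemma model_comparable (n : nat) (t : R) : (0 < n)%N -> 0 < t ->
  comparable_to a (C ^+ 2) (rho alpha p n t) (xx n t).
Proof.
move=> n0 t0 i; have r0 := rho_gt0 n0 t0.
have m0 : 0 < i.+1%:R :> R by rewrite ltr0n.
have C0 : 0 < C by have h := hC; lra.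
have nR : 0 < n%:R :> R by rewrite ltr0n.
rewrite powR_divp// (powR_rho a0 n0 t0).
have -> : n%:R * lam t i * kappa i ^+ 2 =
  (n%:R * t ^+ 2 / i.+1%:R `^ a) * (kappa i / i.+1%:R `^ (- p)) ^+ 2.
  rewrite /prior_eigenvalue expr_div_n powR_sqr.
  have -> : i.+1%:R `^ (- 1 - 2 * alpha) = (i.+1%:R `^ (2 * - p))^-1 / i.+1%:R `^ a.
    have -> : - 1 - 2 * alpha = - (2 * - p) + - a by rewrite /a; ring.
    by rewrite powRDp ?ltr0n// !powRN.
  by field; rewrite !gt_eqF ?powR_gt0.
set Q := _ / _; have Q0 : 0 <= Q by rewrite /Q; solve_ge0.
have /andP[k1 k2] := hkappaC i.
set k := kappa i / _.
have P0 : 0 < i.+1%:R `^ (- p) :> R by rewrite powR_gt0.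
have h1 : C^-1 <= k by rewrite /k ler_pdivlMr.
have h2 : k <= C by rewrite /k ler_pdivrMr.
have Ci0 : 0 < C^-1 by rewrite invr_gt0.
rewrite -exprVn; apply/andP; split.
  by rewrite mulrC; apply: ler_wpM2l => //; rewrite ler_sqr ?nnegrE//; lra.
by rewrite [leRHS]mulrC; apply: ler_wpM2l => //; rewrite ler_sqr ?nnegrE//; lra.
Qed.

Lemma lE i : `|l i| = i.+1%:R `^ (- q - 2^-1) * A i.+1%:R.
Proof. by rewrite -[LHS]normr_id hlS normrM (ger0_norm (powR_ge0 _ _)). Qed.

Lemma l_sqr i : l i ^+ 2 = i.+1%:R `^ (- 1 - 2 * q) * A i.+1%:R ^+ 2.
Proof.
rewrite -[LHS]real_normK ?num_real// lE exprMn powR_sqr; congr (_ `^ _ * _).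
by field.
Qed.

Definition spread_order (n : nat) (t : R) : R := t * rho alpha p n t `^ (- (2^-1 + alpha + q)) * A (rho alpha p n t).

Lemma spread_rateE (n : nat) (t : R) : (0 < n)%N -> 0 < t ->
  spread_rate alpha p q S n t = spread_order n t.
Proof.
move=> n0 t0; rewrite /spread_rate /spread_order sqrtr_sqr -/(A _); congr (_ * _ * _).
rewrite -(powR_rho a0 n0 t0).
rewrite -powRrM; congr (_ `^ _); rewrite min_l; last first.
  by rewrite ler_pdivrMr; [have h := hqp; rewrite /a; lra|exact: a0].
by field; rewrite gt_eqF//; exact: a0.
Qed.

(** The variance t^2 of LAY is at most s^2 because x / (1 + x)^2 <= 1 / (1 +
    x). The difference of the two variances has the terms l_i^2 lambda_i / (1
    + x_i)^2; the indices between rho and 2 rho show that it is at least a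
    multiple of the common order, so that s / t is bounded away from 1. *)
Lemma spread_limits : exists r1 r2 c1 c2 X : R,
  [/\ 1 < r1, 0 < c1, 0 < c2, 1 <= X & forall (n : nat) (t : R), (0 < n)%N -> 0 < t -> X <= rho alpha p n t ->
   0 < spread_order n t /\
   exists sd : R, [/\ 0 < sd,
     series (fun i => LA_coef n l (lam t) kappa i ^+ 2 / n%:R) @ \oo --> sd ^+ 2,
     r1 * sd <= posterior_sd n l (lam t) kappa <= r2 * sd &
     c1 * spread_order n t <= sd <= c2 * spread_order n t]].
Proof.
have h1 := halpha; have h2 := hp; have h3 := hqalpha; have h4 := hqp.
pose u := 1 + 2 * alpha + 2 * q.
have u0 : 0 < u by rewrite /u; lra.
have u1 : -1 < u by lra.
have ua : u < a by rewrite /u /a; lra.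
have [C1 [X1 [C10 X11 hup]]] := spread_upper A0 hA D1 u0 ua.
have [c [X2 [c0 X21 hlow]]] := block_sum A0 hA a D1 2 u1.
have [X3 [X31 hX3]] := potter_pos hA.
exists (Num.sqrt (1 + c / C1)), (Num.sqrt (C1 / c)), (Num.sqrt c), (Num.sqrt C1).
exists (Num.max X1 (Num.max X2 X3)); split.
- rewrite -[X in X < _]sqrtr1 ltr_sqrt; last by rewrite addr_gt0// divr_gt0.
  by rewrite ltrDl divr_gt0.
- by rewrite sqrtr_gt0.
- by rewrite sqrtr_gt0.
- by rewrite le_max X11.
move=> n t n0 t0; rewrite !ge_max => /and3P[rX1 rX2 rX3].
set r := rho alpha p n t in rX1 rX2 rX3 *.
have r0 : 0 < r by exact: rho_gt0.
have Ar : 0 < A r by exact: hX3.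
have cx : comparable_to a (C ^+ 2) r (xx n t) by exact: model_comparable.
have sg0 : 0 < spread_order n t by rewrite /spread_order; solve_gt0.
split => //.
set sg := spread_order n t in sg0 *.
have sg2 : sg ^+ 2 = t ^+ 2 * (r `^ (- u) * A r ^+ 2).
  rewrite /sg /spread_order -/r !exprMn powR_sqr -mulrA; congr (_ * (_ `^ _ * _)).
  by rewrite /u; field.
pose x := xx n t.
have x0 i : 0 <= x i by exact: (comparable_ge0 D1 i cx).
have x10 i : 0 < 1 + x i by have := x0 i; lra.
pose w i := i.+1%:R `^ (- 1 - u) * A i.+1%:R ^+ 2.
have w0 i : 0 <= w i by rewrite /w; solve_ge0.
have llam i : l i ^+ 2 * lam t i = t ^+ 2 * w i.
  rewrite l_sqr /prior_eigenvalue /w.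
  have -> : - 1 - u = (- 1 - 2 * q) + (- 1 - 2 * alpha) by rewrite /u; ring.
  by rewrite [in RHS]powRDp ?ltr0n//; ring.
pose fS i := l i ^+ 2 * lam t i / (1 + n%:R * lam t i * kappa i ^+ 2).
pose fT i := LA_coef n l (lam t) kappa i ^+ 2 / n%:R.
have fSE i : fS i = t ^+ 2 * (w i * (1 + x i)^-1) by rewrite /fS llam mulrA.
have nR : 0 < n%:R :> R by rewrite ltr0n.
have fTE i : fT i = t ^+ 2 * (w i * (x i / (1 + x i) ^+ 2)).
  rewrite mulrA -llam /fT /LA_coef /x; field.
  by rewrite !gt_eqF//; exact: x10.
have ST i : fS i = fT i + t ^+ 2 * (w i * ((1 + x i) ^+ 2)^-1).
  by rewrite fSE fTE; field; rewrite gt_eqF.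
have fS0 i : 0 <= fS i.
  by rewrite fSE; have := x10 i; have := w0 i => ? ?; solve_ge0.
have fT0 i : 0 <= fT i.
  by rewrite /fT; solve_ge0.
have SM k : \sum_(0 <= i < k) fS i <= C1 * sg ^+ 2.
  under eq_bigr do rewrite fSE.
  rewrite -mulr_sumr sg2 mulrCA; apply: ler_wpM2l; first by solve_ge0.
  exact: hup.
have [cS leS leSM] := nonneg_series fS0 SM.
set s2 := limn (series fS) in cS leS leSM.
have [k1 hk1] : exists k, c * sg ^+ 2 <= \sum_(0 <= i < k) t ^+ 2 * (w i * ((1 + x i) ^+ 2)^-1).
  have [||k hk] := hlow r (fun i => ((1 + x i) ^+ 2)^-1) rX2.
  - by move=> i; solve_ge0.
  - by move=> i i1 i2; have [] := block_shrink a0 D1 r0 cx i1 i2.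
  exists k; rewrite -mulr_sumr sg2 mulrCA; apply: ler_wpM2l => //; solve_ge0.
have [k2 hk2] : exists k, c * sg ^+ 2 <= \sum_(0 <= i < k) fT i.
  have [||k hk] := hlow r (fun i => x i / (1 + x i) ^+ 2) rX2.
  - by move=> i; have := x0 i => ?; solve_ge0.
  - by move=> i i1 i2; have [] := block_shrink a0 D1 r0 cx i1 i2.
  exists k; under eq_bigr do rewrite fTE.
  rewrite -mulr_sumr sg2 mulrCA; apply: ler_wpM2l => //; solve_ge0.
have TM k : \sum_(0 <= i < k) fT i <= s2 - c * sg ^+ 2.
  apply: (@le_trans _ _ (\sum_(0 <= i < maxn k k1) fT i)).
    by apply: sum_nonneg_le => //; exact: leq_maxl.
  rewrite lerBrDr; apply: le_trans (leS (maxn k k1)).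
  under [leRHS]eq_bigr do rewrite ST.
  rewrite big_split/= lerD2l; apply: (le_trans hk1).
  apply: sum_nonneg_le; last exact: leq_maxr.
  by move=> i; have := w0 i => ?; solve_ge0.
have [cT leT leTM] := nonneg_series fT0 TM.
set t2 := limn (series fT) in cT leT leTM.
have t2low : c * sg ^+ 2 <= t2 by apply: le_trans (leT k2).
have sg20 : 0 < sg ^+ 2 by rewrite exprn_gt0.
have csg0 : 0 < c * sg ^+ 2 by rewrite mulr_gt0.
have t20 : 0 < t2 by lra.
exists (Num.sqrt t2); split.
- by rewrite sqrtr_gt0.
- by rewrite sqr_sqrtr ?ltW.
- rewrite /posterior_sd -/fS -/s2 -!sqrtrM; try solve_ge0.
  apply/andP; split; apply: ler_wsqrtr.
    rewrite mulrDl mul1r.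
    have : c / C1 * t2 <= c * sg ^+ 2.
      rewrite -mulrA; apply: ler_wpM2l; first exact: ltW.
      by rewrite ler_pdivrMl//; lra.
    by lra.
  rewrite -mulrA; apply: (le_trans leSM); apply: ler_wpM2l; first exact: ltW.
  by rewrite ler_pdivlMl.
- have sgE : sg = Num.sqrt (sg ^+ 2) by rewrite sqrtr_sqr gtr0_norm.
  rewrite {1 2}sgE -!sqrtrM; try exact: ltW.
  by apply/andP; split; apply: ler_wsqrtr; lra.
Qed.

Definition bias_order (n : nat) (t : R) : R :=
  rho alpha p n t `^ (- Num.min b a) * Num.sqrt (gam2_at A a b (rho alpha p n t)).

Lemma bias_rateE (n : nat) (t : R) : (0 < n)%N -> 0 < t ->
  bias_rate alpha p beta q S n t = bias_order n t.
Proof.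
move=> n0 t0; have ap := a0.
rewrite /bias_rate /bias_order -/a -/b; congr (_ * Num.sqrt _).
  rewrite -(powR_rho ap n0 t0) -powRrM; congr (_ `^ _).
  rewrite -/a mulrN; congr (- _).
  have [ba|ab] := leP b a.
    by rewrite !min_l// ?ler_pdivrMr ?mul1r// mulrC divfK// gt_eqF.
  by rewrite !min_r ?ler_pdivlMr ?mul1r ?mulr1// ltW.
rewrite /gam2 /gam2_at -/a -/b.
case: ifP => _; first by rewrite /A real_normK// num_real.
case: ifP => // _.
rewrite /log_sum big_add1/=; apply: eq_bigr => i _.
by rewrite /A real_normK ?num_real// mulrC.
Qed.

(** The sequence l_i^2 i^(- 2 beta), which is dual to the Sobolev weights. *)
Lemma weighted_sqr i : l i ^+ 2 * i.+1%:R `^ (- (2 * beta)) = i.+1%:R `^ (- 1 - 2 * b) * A i.+1%:R ^+ 2.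
Proof.
rewrite l_sqr mulrAC -powRDp ?ltr0n//; congr (_ `^ _ * _).
by rewrite /b; ring.
Qed.

(** The Cauchy-Schwarz inequality for the sum of l_i m_i h_i, in the form with
    a free parameter th. It yields convergence of the series at the same time.
    *)
Lemma cauchy_schwarz_series (m h : nat -> R) (th M W : R) : 0 < th ->
  (forall k, \sum_(0 <= i < k) m i ^+ 2 * i.+1%:R `^ (2 * beta) <= M) ->
  (forall k, \sum_(0 <= i < k) i.+1%:R `^ (- 1 - 2 * b) * A i.+1%:R ^+ 2 * h i ^+ 2 <= W) ->
  series (fun i => l i * m i * h i) @ \oo --> limn (series (fun i => l i * m i * h i)) /\
  `|limn (series (fun i => l i * m i * h i))| <= (th * W + th^-1 * M) / 2.
Proof.
move=> th0 hM hW.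
apply: (@dominated_series _ _ (fun i => (th * (i.+1%:R `^ (- 1 - 2 * b) * A i.+1%:R ^+ 2 * h i ^+ 2)
  + th^-1 * (m i ^+ 2 * i.+1%:R `^ (2 * beta))) / 2)).
  move=> i; have P0 : 0 < i.+1%:R `^ beta :> R by rewrite powR_gt0 ?ltr0n.
  have -> : l i * m i * h i = (l i * i.+1%:R `^ (- beta) * h i) * (m i * i.+1%:R `^ beta).
    by rewrite powRN; field; rewrite gt_eqF.
  apply: (le_trans (amgm_weighted _ _ th0)).
  by rewrite !exprMn !powR_sqr mulrN weighted_sqr.
move=> k; rewrite -mulr_suml big_split/= -!mulr_sumr.
apply: ler_wpM2r; first by solve_ge0.
by apply: lerD; apply: ler_wpM2l => //; solve_ge0.
Qed.

(** With th equal to the ratio of the two norms, [cauchy_schwarz_series]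
    becomes the sharp bound. *)
Lemma bias_bound : exists K X : R, [/\ 0 < K, 1 <= X &
  forall (n : nat) (t : R), (0 < n)%N -> 0 < t -> X <= rho alpha p n t ->
  0 < bias_order n t /\
  forall (m : nat -> R) (M : R), 0 < M ->
  (forall k, \sum_(0 <= i < k) m i ^+ 2 * i.+1%:R `^ (2 * beta) <= M ^+ 2) ->
  exists v w : R, [/\ series (fun i => l i * m i) @ \oo --> v,
    series (fun i => LA_coef n l (lam t) kappa i * (kappa i * m i)) @ \oo --> w,
    series (fun i => l i * m i * (1 + xx n t i)^-1) @ \oo --> v - w &
    `|v - w| <= K * bias_order n t * M]].
Proof.
have [Mb [Mb0 hMb]] := sum_bounded A0 hA (mulr_gt0 (ltr0n R 2) b0).
have [K [X [K0 X1 hK]]] := bias_upper A0 hA a0 D1 b0.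
have [CG [X' [CG0 X'1 hG]]] := gam2_at_potter A0 hA a b ltr01.
exists (Num.sqrt K), (Num.max X X'); split.
- by rewrite sqrtr_gt0.
- by rewrite le_max X1.
move=> n t n0 t0; rewrite ge_max => /andP[rX rX'].
have r0 : 0 < rho alpha p n t by exact: rho_gt0.
have cx := model_comparable n0 t0.
have [G0 _ _] := hG _ _ rX' (lexx _).
have s0 : 0 < bias_order n t by apply: mulr_gt0; [exact: powR_gt0|rewrite sqrtr_gt0].
split => // m M M0 hM.
set x := xx n t in cx *.
have x0 i : 0 <= x i by exact: (comparable_ge0 D1 i cx).
have x10 i : 0 < 1 + x i by have := x0 i; lra.
have bnd (h : nat -> R) : (forall i, h i ^+ 2 <= 1) -> forall k,
  \sum_(0 <= i < k) i.+1%:R `^ (- 1 - 2 * b) * A i.+1%:R ^+ 2 * h i ^+ 2 <= Mb.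
  move=> h1 k; apply: le_trans (hMb k); apply: ler_sum => i _.
  by apply: ler_piMr => //; solve_ge0.
have y1 i : (x i / (1 + x i)) ^+ 2 <= 1.
  have h : 0 <= x i / (1 + x i) by have := x0 i; have := x10 i => ? ?; solve_ge0.
  by rewrite expr_le1// ler_pdivrMr// mul1r; lra.
have [v c1] : exists v : R, series (fun i => l i * m i * 1) @ \oo --> v.
  have [c1 _] := cauchy_schwarz_series ltr01 hM (bnd (fun=> 1) (fun=> ltac:(by rewrite expr1n))).
  by eexists; exact: c1.
have [w c2] : exists w : R, series (fun i => l i * m i * (x i / (1 + x i))) @ \oo --> w.
  have [c2 _] := cauchy_schwarz_series ltr01 hM (bnd (fun i => x i / (1 + x i)) y1).
  by eexists; exact: c2.
have E1 : (fun i => l i * m i * 1) = (fun i => l i * m i) by apply/funext => i; rewrite mulr1.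
rewrite E1 in c1.
have c3 : series (fun i => l i * m i * (1 + x i)^-1) @ \oo --> v - w.
  rewrite (_ : series _ = series (fun i => l i * m i) \- series (fun i => l i * m i * (x i / (1 + x i)))).
    exact: cvgB c1 c2.
  apply/funext => k; rewrite /series/= -sumrB; apply: eq_bigr => i _.
  by have := x10 i => ?; field; rewrite gt_eqF.
have E2 : (fun i => l i * m i * (x i / (1 + x i))) =
    (fun i => LA_coef n l (lam t) kappa i * (kappa i * m i)).
  apply/funext => i; rewrite /LA_coef /x.
  by have := x10 i; rewrite /x => ?; field; rewrite gt_eqF.
rewrite E2 in c2.
exists v, w; split => //.
pose s := bias_order n t.
have [|c4] := cauchy_schwarz_series (th := M / (Num.sqrt K * s)) _ hM
  (fun k => hK _ _ k rX cx).
  by rewrite divr_gt0// mulr_gt0 ?sqrtr_gt0.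
rewrite (cvg_lim _ c3)//.
move=> h; apply: (le_trans h).
have -> : rho alpha p n t `^ (- Num.min b a) ^+ 2 * gam2_at A a b (rho alpha p n t) = s ^+ 2.
  by rewrite /s /bias_order exprMn sqr_sqrtr// ltW.
have -> : K * s ^+ 2 = (Num.sqrt K * s) ^+ 2 by rewrite [RHS]exprMn (sqr_sqrtr (ltW K0)).
have Q0 : 0 < Num.sqrt K * s by rewrite mulr_gt0 ?sqrtr_gt0.
rewrite -/s; set Q := Num.sqrt K * s in Q0 *.
rewrite [leLHS](_ : _ = Q * M)//; field.
by rewrite !gt_eqF.
Qed.

(** The case of equality in the Cauchy-Schwarz inequality: coordinates
    proportional to l_i i^(- 2 beta) / (1 + x_i), cut off after finitely many.
    *)
Lemma bias_extremal : exists c X : R, [/\ 0 < c, 1 <= X &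
  forall (n : nat) (t : R), (0 < n)%N -> 0 < t -> X <= rho alpha p n t ->
  exists m : nat -> R, exists k : nat, [/\
    forall i, 0 <= l i * m i,
    forall k', \sum_(0 <= i < k') m i ^+ 2 * i.+1%:R `^ (2 * beta) <= 1 &
    c * bias_order n t <= \sum_(0 <= i < k) l i * m i * (1 + xx n t i)^-1]].
Proof.
have [c [X [c0 X1 h]]] := bias_lower A0 hA a0 D1 b0.
have [CG [X' [CG0 X'1 hG]]] := gam2_at_potter A0 hA a b ltr01.
exists (Num.sqrt c), (Num.max X X'); split.
- by rewrite sqrtr_gt0.
- by rewrite le_max X1.
move=> n t n0 t0; rewrite ge_max => /andP[rX rX'].
have r0 : 0 < rho alpha p n t by exact: rho_gt0.
have cx := model_comparable n0 t0.
have [G0 _ _] := hG _ _ rX' (lexx _).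
have s0 : 0 < bias_order n t by apply: mulr_gt0; [exact: powR_gt0|rewrite sqrtr_gt0].
have [k] := h _ _ rX cx.
set x := xx n t in cx *.
have x0 i : 0 <= x i by exact: (comparable_ge0 D1 i cx).
have x10 i : 0 < 1 + x i by have := x0 i; lra.
have -> : rho alpha p n t `^ (- Num.min b a) ^+ 2 * gam2_at A a b (rho alpha p n t) = bias_order n t ^+ 2.
  by rewrite /bias_order exprMn sqr_sqrtr// ltW.
set Z := \sum_(0 <= i < k) _ => hZ.
have Z0 : 0 < Z by apply: lt_le_trans hZ; rewrite mulr_gt0 ?exprn_gt0.
have sZ0 : 0 < Num.sqrt Z by rewrite sqrtr_gt0.
pose m i := if (i < k)%N then l i * i.+1%:R `^ (- (2 * beta)) * (1 + x i)^-1 / Num.sqrt Z else 0.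
exists m, k; split.
- move=> i; rewrite /m; case: ifP => _; last by rewrite mulr0.
  rewrite !mulrA -expr2; have := x10 i => ?; by solve_ge0.
- move=> k'.
  have mE i : m i ^+ 2 * i.+1%:R `^ (2 * beta) = if (i < k)%N then
     i.+1%:R `^ (- 1 - 2 * b) * A i.+1%:R ^+ 2 * (1 + x i)^-1 ^+ 2 / Z else 0.
    rewrite /m; case: ifP => _; last by rewrite expr0n mul0r.
    rewrite -weighted_sqr -[in RHS](sqr_sqrtr (ltW Z0)).
    have P0 : 0 < i.+1%:R `^ (2 * beta) :> R by rewrite powR_gt0 ?ltr0n.
    by rewrite powRN; field; rewrite !gt_eqF//; exact: x10.
  under eq_bigr do rewrite mE.
  apply: (@le_trans _ _ (\sum_(0 <= i < maxn k' k) if (i < k)%N then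
     i.+1%:R `^ (- 1 - 2 * b) * A i.+1%:R ^+ 2 * (1 + x i)^-1 ^+ 2 / Z else 0)).
    apply: sum_nonneg_le; last exact: leq_maxl.
    by move=> i; case: ifP => // _; have := x10 i => ?; solve_ge0.
  rewrite (@big_cat_nat _ _ _ k)//=; last exact: leq_maxr.
  rewrite [X in _ + X]big_nat_cond [X in _ + X]big1 ?addr0; last first.
    by move=> i; rewrite andbT => /andP[ki _]; rewrite ltnNge ki.
  have -> : \sum_(0 <= i < k) (if (i < k)%N then
      i.+1%:R `^ (- 1 - 2 * b) * A i.+1%:R ^+ 2 * (1 + x i)^-1 ^+ 2 / Z else 0) = Z / Z.
    rewrite {2}/Z mulr_suml big_nat [RHS]big_nat; apply: eq_bigr => i /andP[_ ik].
    by rewrite ik.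
  by rewrite divff ?gt_eqF.
- have -> : \sum_(0 <= i < k) l i * m i * (1 + x i)^-1 = Num.sqrt Z.
    have -> : Num.sqrt Z = Z / Num.sqrt Z.
      by rewrite -[X in X / _](sqr_sqrtr (ltW Z0)) expr2 mulfK// gt_eqF.
    set sZ := Num.sqrt Z in sZ0 m *; rewrite /Z mulr_suml big_nat [RHS]big_nat.
    apply: eq_bigr => i /andP[_ ik].
    rewrite /m ik -weighted_sqr -/(x i).
    by field; rewrite !gt_eqF//; exact: x10.
  rewrite -(ger0_norm (ltW s0)) -sqrtr_sqr -sqrtrM; last exact: ltW.
  by apply: ler_wsqrtr.
Qed.

(** The sequence sgn (l_i) i^(- beta - 1/2 - eps) just belongs to the Sobolev
    space; its bias is the sum estimated in [fixed_lower]. *)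
Lemma bias_fixed (eps : R) : 0 < eps -> exists (m : nat -> R) (M c X : R), [/\
  0 < M /\ 0 < c, forall i, 0 <= l i * m i,
  forall k, \sum_(0 <= i < k) m i ^+ 2 * i.+1%:R `^ (2 * beta) <= M ^+ 2 &
  forall (n : nat) (t : R), (0 < n)%N -> 0 < t -> X <= rho alpha p n t ->
  exists k : nat, c * (rho alpha p n t `^ (- eps) * bias_order n t) <=
    \sum_(0 <= i < k) l i * m i * (1 + xx n t i)^-1].
Proof.
move=> e0.
have [c [X [c0 X1 h]]] := fixed_lower A0 hA a0 D1 b0 e0.
have [M [M0 hM]] := sum_bounded (fun=> ler01) (@potter_one R) (mulr_gt0 (ltr0n R 2) e0).
pose m i := Num.sg (l i) * i.+1%:R `^ (- beta - 2^-1 - eps).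
have lm i : l i * m i = i.+1%:R `^ (- 1 - (b + eps)) * A i.+1%:R.
  rewrite /m mulrA (mulrC (l i)) -normrEsg lE mulrAC -powRDp ?ltr0n//.
  by congr (_ `^ _ * _); rewrite /b; field.
exists m, (Num.sqrt M), c, X; split.
- by rewrite sqrtr_gt0.
- by move=> i; rewrite lm; solve_ge0.
- move=> k; rewrite (sqr_sqrtr (ltW M0)); apply: le_trans (hM k).
  apply: ler_sum => i _; rewrite /m exprMn powR_sqr -mulrA -powRDp ?ltr0n//.
  rewrite expr1n mulr1.
  have -> : 2 * (- beta - 2^-1 - eps) + 2 * beta = - 1 - 2 * eps by field.
  by apply: ler_piMl; [solve_ge0|rewrite sqr_sg; case: (_ != _)].
- move=> n t n0 t0 rX.
  have [k hk] := h _ _ rX (model_comparable n0 t0); exists k.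
  rewrite /bias_order [X in c * X]mulrA; apply: (le_trans hk).
  by under [leRHS]eq_bigr do rewrite lm.
Qed.

(** Split mu into the first k0 coordinates and the rest. The rest has small
    Sobolev norm, hence a bias at most a small multiple of the rate; the bias
    due to finitely many coordinates is of the order rho^(- a), which is
    negligible compared to rho^(- b) when b < a. *)
Lemma bias_fixed_small (m : nat -> R) (M eta : R) : b < a -> 0 < M -> 0 < eta ->
  (forall k, \sum_(0 <= i < k) m i ^+ 2 * i.+1%:R `^ (2 * beta) <= M ^+ 2) ->
  exists X : R, forall (n : nat) (t : R), (0 < n)%N -> 0 < t -> X <= rho alpha p n t ->
  exists v w : R, [/\ series (fun i => l i * m i) @ \oo --> v,
    series (fun i => LA_coef n l (lam t) kappa i * (kappa i * m i)) @ \oo --> w &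
    `|v - w| <= eta * bias_order n t].
Proof.
move=> ba M0 eta0 hM; have [K [X [K0 X1 hK]]] := bias_bound.
have Dg := D1; have D0 : 0 < C ^+ 2 by lra.
pose f i := m i ^+ 2 * i.+1%:R `^ (2 * beta).
have f0 i : 0 <= f i by rewrite /f; solve_ge0.
have [cT leT _] := nonneg_series f0 hM.
set T := limn _ in cT leT.
pose del := eta / 2 / K.
have del0 : 0 < del by rewrite /del; solve_gt0.
have [k0 hk0] : exists k0, T - \sum_(0 <= i < k0) f i <= del ^+ 2.
  have /cvgrPdist_le /(_ (del ^+ 2)) := cT.
  rewrite exprn_gt0// => /(_ isT) [k0 _ h]; exists k0.
  by apply: le_trans (h k0 (leqnn _)); exact: ler_norm.
pose m' i := if (i < k0)%N then 0 else m i.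
have hm' k : \sum_(0 <= i < k) m' i ^+ 2 * i.+1%:R `^ (2 * beta) <= del ^+ 2.
  apply: le_trans hk0.
  apply: (@le_trans _ _ (\sum_(0 <= i < maxn k k0) m' i ^+ 2 * i.+1%:R `^ (2 * beta))).
    by apply: sum_nonneg_le; [move=> i; solve_ge0|exact: leq_maxl].
  rewrite lerBrDr; apply: le_trans (leT (maxn k k0)).
  rewrite (@big_cat_nat _ _ _ k0)//=; last exact: leq_maxr.
  rewrite [leRHS](@big_cat_nat _ _ _ k0)//=; last exact: leq_maxr.
  rewrite big_nat big1 => [|i /andP[_ ik]]; last by rewrite /m' ik expr0n mul0r.
  rewrite add0r [leLHS]addrC lerD2l big_nat [leRHS]big_nat; apply: ler_sum => i /andP[ki _].
  by rewrite /m' ltnNge ki.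
pose H0 := \sum_(0 <= i < k0) `|l i * m i| * (C ^+ 2 * i.+1%:R `^ a).
have H00 : 0 <= H0.
  by apply: sumr_ge0 => i _; apply: mulr_ge0 => //; apply: mulr_ge0; [exact: ltW|exact: powR_ge0].
have ab0 : 0 < a - b by lra.
have H1 : 0 < H0 + 1 by lra.
have c0 : 0 < eta / 2 / (H0 + 1) by solve_gt0.
have [X' [X'1 hX']] := potter_decay A0 hA ab0 c0.
exists (Num.max X X') => n t n0 t0; rewrite ge_max => /andP[rX rX'].
have r0 : 0 < rho alpha p n t by exact: rho_gt0.
have [s0 hb] := hK n t n0 t0 rX.
have [v [w [c1 c2 c3 _]]] := hb m M M0 hM.
have [v' [w' [_ _ c3' b']]] := hb m' del del0 hm'.
exists v, w; split => //.
have cx := model_comparable n0 t0.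
set x := xx n t in cx c3 c3'.
have x0 i : 0 <= x i by exact: (comparable_ge0 D1 i cx).
pose Hd := \sum_(0 <= i < k0) l i * m i * (1 + x i)^-1.
have E : v - w = Hd + (v' - w').
  have c4 : (fun k => Hd + series (fun i => l i * m' i * (1 + x i)^-1) k) @ \oo --> Hd + (v' - w').
    by apply: cvgD c3'; exact: cvg_cst.
  apply: (cvg_unique _ c3); rewrite //; apply: cvg_trans c4; apply: near_eq_cvg.
  exists k0 => // k /= kk; rewrite /series/=.
  rewrite [in LHS](@big_cat_nat _ _ _ k0 0 k)//= [in RHS](@big_cat_nat _ _ _ k0 0 k)//=.
  have -> : \sum_(0 <= i < k0) l i * m' i / (1 + x i) = 0.
    by rewrite big_nat big1 => [|i /andP[_ ik]]//; rewrite /m' ik mulr0 mul0r.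
  rewrite add0r; congr (_ + _).
  rewrite big_nat [RHS]big_nat; apply: eq_bigr => i /andP[ki _].
  by rewrite /m' ltnNge ki.
rewrite E; apply: (le_trans (ler_normD _ _)).
have -> : eta * bias_order n t = eta / 2 * bias_order n t + eta / 2 * bias_order n t by field.
apply: lerD; last first.
  apply: (le_trans b'); rewrite /del [leLHS](_ : _ = eta / 2 * bias_order n t)//.
  by field; rewrite gt_eqF.
set r := rho alpha p n t in rX rX' r0 cx *.
have sE : bias_order n t = r `^ (- b) * A r.
  rewrite /bias_order -/r /gam2_at ba min_l; last exact: ltW.
  by rewrite sqrtr_sqr ger0_norm.
apply: (@le_trans _ _ (H0 * r `^ (- a))).
  apply: (le_trans (ler_norm_sum _ _ _)); rewrite /H0 mulr_suml; apply: ler_sum => i _.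
  rewrite normrM -mulrA; apply: ler_wpM2l => //.
  rewrite ger0_norm; last by have := x0 i => ?; rewrite invr_ge0; lra.
  apply: (le_trans (shrink_upper D1 i r0 cx)); rewrite -[leRHS]mulrA.
  apply: ler_wpM2l; first exact: ltW.
  by rewrite ge_min; apply/orP; right; rewrite powR_divp ?ltr0n// powRN.
have -> : - a = - (a - b) + - b by ring.
rewrite powRDp// sE [leRHS](_ : _ = (eta / 2 * A r) * r `^ (- b)); last by ring.
rewrite mulrA; apply: ler_wpM2r; first exact: powR_ge0.
have h1 := hX' r rX'.
apply: (@le_trans _ _ ((H0 + 1) * (eta / 2 / (H0 + 1) * A r))).
  by apply: ler_pM => //; [exact: powR_ge0|lra].
by rewrite [leLHS](_ : _ = eta / 2 * A r)//; field; rewrite gt_eqF//; lra.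
Qed.

End model.

(** * Coverage in the three regimes *)

Lemma normal_quantile_Phi (R : realType) (g z : R) : normal_quantile g z -> Phi z = g.
Proof. by rewrite /normal_quantile PhiE => h; exact: EFin_inj h. Qed.

Lemma Phi0 (R : realType) : Phi 0 = 2^-1 :> R.
Proof. by have := Phi_opp (0 : R); rewrite oppr0; lra. Qed.

Lemma Phi_inj_lt (R : realType) (x y : R) : Phi x < Phi y -> x < y.
Proof. by move=> h; rewrite ltNge; apply/negP => /Phi_le; lra. Qed.

Section regimes.
Context (R : realType) (w0 r1 r2 : R).
Hypotheses (hw0 : 0 < w0) (hr1 : 1 < r1).

(** Without bias the coverage is 1 - 2 Phi (- w), where w exceeds w0 by a
    factor at least r1 > 1; a bias eta that eats up half of the excess is
    harmless. *)
Lemma coverage_small_bias : exists eta c0 c1 : R, [/\ 0 < eta, 1 - 2 * Phi (- w0) < c0, c1 < 1 &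
  forall y w : R, `|y| <= eta -> r1 * w0 <= w <= r2 * w0 ->
    c0 <= Phi (y + w) - Phi (y - w) <= c1].
Proof.
have w0' := hw0; have r1' := hr1.
pose eta := (r1 - 1) * w0 / 2.
have eta0 : 0 < eta by rewrite /eta; solve_gt0.
have e1 : w0 < r1 * w0 - eta.
  rewrite [ltRHS](_ : _ = w0 + eta); first lra.
  by rewrite /eta; field.
exists eta, (1 - 2 * Phi (- (r1 * w0 - eta))), (Phi (r2 * w0 + eta)); split => //.
- have : Phi (- (r1 * w0 - eta)) < Phi (- w0) by apply: Phi_lt; lra.
  by lra.
- exact: Phi_lt1.
- move=> y w; rewrite ler_norml => /andP[y1 y2] /andP[h1 h2].
  have k1 : Phi (r1 * w0 - eta) <= Phi (y + w) by apply: Phi_le; lra.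
  have k2 : Phi (y - w) <= Phi (- (r1 * w0 - eta)) by apply: Phi_le; lra.
  have k3 := Phi_opp (r1 * w0 - eta).
  have k4 : Phi (y + w) <= Phi (r2 * w0 + eta) by apply: Phi_le; lra.
  have k5 := Phi_gt0 (y - w).
  by apply/andP; split; lra.
Qed.

(** The interval lies in the upper tail of the normal law. *)
Lemma coverage_large_bias (eps : R) : 0 < eps -> exists M : R,
  forall y w : R, M <= y -> r1 * w0 <= w <= r2 * w0 ->
    0 <= Phi (y + w) - Phi (y - w) <= eps.
Proof.
move=> e0; have [M hM] := Phi_small e0.
exists (r2 * w0 - M) => y w My /andP[h1 h2].
have w1 : 0 < w by apply: lt_le_trans h1; have ? := hw0; have ? := hr1; apply: mulr_gt0; lra.
have k1 : Phi (y - w) <= Phi (y + w) by apply: Phi_le; lra.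
have k2 := Phi_lt1 (y + w).
have k3 : Phi (- (y - w)) < eps by apply: hM; lra.
have k4 := Phi_opp (y - w).
by apply/andP; split; lra.
Qed.

(** The interval has length at least 2 r1 w0 and stays in a bounded set, on
    which the density is bounded below. *)
Lemma coverage_bounded_bias (M : R) : exists c : R, 0 < c /\
  forall y w : R, `|y| <= M -> r1 * w0 <= w <= r2 * w0 ->
    c <= Phi (y + w) - Phi (y - w).
Proof.
have rw0 : 0 < r1 * w0 by have ? := hw0; have ? := hr1; apply: mulr_gt0; lra.
have p0 : 0 < normal_pdf 0 1 (M + r2 * w0).
  by rewrite normal_pdfE ?oner_neq0// mulr_gt0 ?normal_peak_gt0 ?oner_neq0// expR_gt0.
exists (2 * (r1 * w0) * normal_pdf 0 1 (M + r2 * w0)); split; first by solve_gt0.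
move=> y w; rewrite ler_norml => /andP[y1 y2] /andP[h1 h2].
apply: le_trans (@Phi_ge R (M + r2 * w0) (y - w) (y + w) _ _ _); [|lra..].
by apply: ler_wpM2r; [exact: ltW|lra].
Qed.

End regimes.


Lemma limn_esup_near_le (R : realType) (u : nat -> \bar R) (c : \bar R) :
  (\forall n \near \oo, (u n <= c)%E) -> (limn_esup u <= c)%E.
Proof.
move=> h; rewrite /limn_esup /limf_esup.
apply: (@le_trans _ _ (ereal_sup (u @` [set n | (u n <= c)%E]))).
  by apply: ereal_inf_lbound; exists [set n | (u n <= c)%E].
by apply: ge_ereal_sup => _ [n hn <-].
Qed.

Lemma limn_einf_near_ge (R : realType) (u : nat -> \bar R) (c : \bar R) :
  (\forall n \near \oo, (c <= u n)%E) -> (c <= limn_einf u)%E.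
Proof.
move=> h; rewrite /limn_einf leeNr; apply: limn_esup_near_le.
by apply: filterS h => n; rewrite leeN2.
Qed.

Lemma limn_bounds (R : realType) (a b c0 c1 : R) (u : nat -> \bar R) :
  a < c0 -> c1 < b -> (\forall n \near \oo, (c0%:E <= u n <= c1%:E)%E) ->
  (a%:E < limn_einf u < b%:E)%E /\ (a%:E < limn_esup u < b%:E)%E.
Proof.
move=> ac cb h.
have h1 : (c0%:E <= limn_einf u)%E.
  by apply: limn_einf_near_ge; apply: filterS h => n /andP[].
have h2 : (limn_esup u <= c1%:E)%E.
  by apply: limn_esup_near_le; apply: filterS h => n /andP[].
have h3 := limn_einf_sup u.
have ac' : (a%:E < c0%:E)%E by rewrite lte_fin.
have cb' : (c1%:E < b%:E)%E by rewrite lte_fin.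
split; apply/andP; split.
- exact: lt_le_trans h1.
- exact: le_lt_trans (le_trans h3 h2) cb'.
- exact: lt_le_trans (le_trans h1 h3).
- exact: le_lt_trans h2 cb'.
Qed.

Lemma uniform_bounds (R : realType) (a b c0 c1 : R) (H : Type) (M : set H)
    (u : nat -> H -> \bar R) (x0 : H) : M x0 -> a < c0 -> c1 < b ->
  (\forall n \near \oo, forall x, M x -> (c0%:E <= u n x <= c1%:E)%E) ->
  asymp_in_uniformly a b M u.
Proof.
move=> Mx0 ac cb h.
have hinf : \forall n \near \oo, (c0%:E <= ereal_inf [set u n x | x in M] <= c1%:E)%E.
  apply: filterS h => n hn; apply/andP; split.
    by apply: le_ereal_inf_tmp => _ [x Mx <-]; have /andP[] := hn x Mx.
  apply: (@le_trans _ _ (u n x0)); last by have /andP[] := hn x0 Mx0.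
  by apply: ereal_inf_lbound; exists x0.
have hsup : \forall n \near \oo, (c0%:E <= ereal_sup [set u n x | x in M] <= c1%:E)%E.
  apply: filterS h => n hn; apply/andP; split.
    apply: (@le_trans _ _ (u n x0)); first by have /andP[] := hn x0 Mx0.
    by apply: ereal_sup_ubound; exists x0.
  by apply: ge_ereal_sup => _ [x Mx <-]; have /andP[] := hn x Mx.
by split; [have [] := limn_bounds ac cb hinf|have [] := limn_bounds ac cb hsup].
Qed.

Lemma cvg_ereal0 (R : realType) (u : nat -> \bar R) :
  (forall eps : R, 0 < eps -> \forall n \near \oo, (0 <= u n <= eps%:E)%E) ->
  u @ \oo --> (0 : \bar R)%E.
Proof.
move=> h; apply/fine_cvgP; split.
  apply: filterS (h 1 ltr01) => n /andP[h1 h2].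
  by rewrite fin_numElt (lt_le_trans (ltNyr 0))//= (le_lt_trans h2)// ltry.
apply/cvgrPdist_le => eps e0; apply: filterS (h eps e0) => n /=.
case: (u n) => [r| |] //=; last by case/andP.
rewrite !lee_fin sub0r normrN => /andP[h1 h2].
by rewrite ger0_norm.
Qed.

Section coverage_regimes.
Context (R : realType) (H1 H2 : completeNormedModType R)
  (ip1 : {dot H1 for idfun}) (ip2 : {dot H2 for idfun})
  (hip1 : norm_of_dot ip1)
  (K : {linear H1 -> H2}) (KT : {linear H2 -> H1}) (hKT : adjoint ip1 ip2 K KT)
  (e : nat -> H1) (he : forall i j, ip1 (e i) (e j) = (i == j)%:R)
  (kappa : nat -> R) (hkappa : forall i, KT (K (e i)) = kappa i ^+ 2 *: e i)
  (alpha p beta C : R)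
  (halpha : 0 < alpha) (hp : 0 <= p) (hbeta : 0 < beta) (hC : 1 <= C)
  (hkappaC : forall i,
     C^-1 * i.+1%:R `^ (- p) <= kappa i <= C * i.+1%:R `^ (- p))
  (tau : nat -> R) (htau : scaling tau)
  (l : nat -> R) (q : R) (S : R -> R)
  (hqbeta : - beta < q) (hqp : q < p) (hS : slowly_varying S)
  (hlS : forall i, `|l i| = i.+1%:R `^ (- q - 2^-1) * S i.+1%:R)
  (hqalpha : - 2^-1 - alpha < q)
  (d : measure_display) (Omega : nat -> measurableType d)
  (P : forall n, H1 -> probability (Omega n) R)
  (Y : forall n, H2 -> {mfun Omega n >-> R})
  (hY : forall n mu0, (0 < n)%N ->
     white_noise_model ip2 (P n mu0) (Y n) (K mu0) n)
  (LAY : forall n, {mfun Omega n >-> R})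
  (hLAY : forall n mu0, (0 < n)%N ->
     {ae P n mu0, forall w,
        series (fun i => LA_coef n l (prior_eigenvalue alpha (tau n)) kappa i
                         * Y n ((kappa i)^-1 *: K (e i)) w) @ \oo
        --> LAY n w})
  (z : R) (hz : z < 0).

Let cov := fun (n : nat) (mu0 : H1) =>
    coverage (P n mu0) (LAY n) z
      (posterior_sd n l (prior_eigenvalue alpha (tau n)) kappa)
      (functional_value ip1 e l mu0).

Let r_ n := rho alpha p n (tau n).
Let sb n := bias_order alpha p beta q S n (tau n).
Let ss n := spread_order alpha p q S n (tau n).
Let tau0 n : 0 < tau n. Proof. exact: htau.1. Qed.

(** The Sobolev norm of the element with coordinates m is at most M. *)
Definition sobolev_coord (m : nat -> R) (M : R) : Prop :=
  forall k, \sum_(0 <= i < k) m i ^+ 2 * i.+1%:R `^ (2 * beta) <= M ^+ 2.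

Lemma rho_near (X : R) : \forall n \near \oo, (0 < n)%N /\ X <= r_ n.
Proof.
have a0 : 0 < 1 + 2 * alpha + 2 * p by have ? := halpha; have ? := hp; lra.
have /cvgryPge /(_ (Num.max X 0 `^ (1 + 2 * alpha + 2 * p))) h := htau.2.
near=> n; split; first by near: n; exact: nbhs_infty_gt.
rewrite /r_ /rho; apply: (@le_trans _ _ (Num.max X 0)); first by rewrite le_max lexx.
have -> : Num.max X 0 = (Num.max X 0 `^ (1 + 2 * alpha + 2 * p)) `^ (1 + 2 * alpha + 2 * p)^-1.
  by rewrite -powRrM mulfV ?gt_eqF// powRr1// le_max lexx orbT.
apply: powR_mono; [by rewrite invr_ge0 ltW|exact: powR_ge0|].
by near: n; exact: h.
Unshelve. all: by end_near. Qed.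

(** Collects what is known at each large n: B is a bound for the bias in units
    of the bias rate, c1 and c2 compare the standard deviation sd of LAY to
    its order, and w is - z times the ratio of posterior spread to sd. *)
Lemma coverage_formula : exists r1 r2 c1 c2 B X : R, [/\ 1 < r1, 0 < c1, 0 < c2, 0 < B &
  forall n, (0 < n)%N -> X <= r_ n -> [/\ 0 < ss n, 0 < sb n &
  forall mu M, 0 < M -> sobolev_coord (fun i => ip1 mu (e i)) M ->
  exists v m sd w : R, [/\ series (fun i => l i * ip1 mu (e i)) @ \oo --> v,
    series (fun i => LA_coef n l (prior_eigenvalue alpha (tau n)) kappa i * (kappa i * ip1 mu (e i))) @ \oo --> m,
    series (fun i => l i * ip1 mu (e i) *
      (1 + n%:R * prior_eigenvalue alpha (tau n) i * kappa i ^+ 2)^-1) @ \oo --> v - m &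
    [/\ `|v - m| <= B * sb n * M, 0 < sd, c1 * ss n <= sd <= c2 * ss n,
     r1 * - z <= w <= r2 * - z &
     cov n mu = (Phi ((v - m) / sd + w) - Phi ((v - m) / sd - w))%:E]]]].
Proof.
have [r1 [r2 [c1 [c2 [X [r11 c10 c20 X1 hs]]]]]] :=
  spread_limits halpha hp hC hkappaC hqp hS hlS hqalpha.
have [B [X' [B0 X'1 hb]]] := bias_bound halpha hp hC hkappaC hqbeta hS hlS.
exists r1, r2, c1, c2, B, (Num.max X X'); split => // n n0.
rewrite ge_max => /andP[rX rX'].
have [ss0 [sd [sd0 hsd /andP[h1 h2] h3]]] := hs n (tau n) n0 (tau0 n) rX.
have [sb0 hb'] := hb n (tau n) n0 (tau0 n) rX'.
split => // mu M M0 hM.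
have [v [m [cv cm cb bb]]] := hb' _ M M0 hM.
set s := posterior_sd _ _ _ _ in h1 h2.
exists v, m, sd, (- z * (s / sd)); split => //; split => //.
  have z0 : 0 <= - z by have := hz; lra.
  rewrite (mulrC r1) (mulrC r2); apply/andP; split; apply: ler_wpM2l => //.
    by rewrite ler_pdivlMr.
  by rewrite ler_pdivrMr.
have s0 : 0 <= s by exact: sqrtr_ge0.
have zs : z * s <= 0 by rewrite nmulr_rle0.
rewrite /cov /functional_value (cvg_lim _ cv)//.
have h := coverage_white_noise hKT he hkappa (kappa_gt0 hC hkappaC) (hY mu n0) (hLAY mu n0) v cm hsd sd0 zs.
rewrite h; congr (EFin (Phi _ - Phi _)).
  by field; rewrite gt_eqF.
by field; rewrite gt_eqF.
Qed.

Lemma coverage_uniform : (forall eta : R, 0 < eta -> \forall n \near \oo, sb n <= eta * ss n) ->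
  asymp_in_uniformly (1 - 2 * Phi z) 1 (sobolev_ball ip1 e beta) cov.
Proof.
move=> hR.
have [r1 [r2 [c1 [c2 [B [X [r11 c10 c20 B0 h]]]]]]] := coverage_formula.
have z0 : 0 < - z by have := hz; lra.
have [eta [c3 [c4 [eta0 hc3 hc4 hg]]]] := coverage_small_bias r2 z0 r11.
rewrite opprK in hc3.
have m0 : sobolev_ball ip1 e beta 0.
  apply/(sobolev_normP _ _ _ _ ler01) => k.
  by rewrite big1 ?expr1n// => i _; rewrite linear0l expr0n mul0r.
apply: (uniform_bounds m0 hc3 hc4).
have e1 : 0 < eta * c1 / B by solve_gt0.
near=> n => mu hmu.
have [n0 rX] : (0 < n)%N /\ X <= r_ n by near: n; exact: rho_near.
have [ss0 sb0 hn] := h n n0 rX.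
have hM : sobolev_coord (fun i => ip1 mu (e i)) 1 by apply/(sobolev_normP _ _ _ _ ler01).
have [v [m [sd [w [_ _ _ [bb sd0 /andP[s1 s2] hw ->]]]]]] := hn mu 1 ltr01 hM.
rewrite !lee_fin; apply: hg => //.
rewrite normrM normfV (gtr0_norm sd0) ler_pdivrMr//; apply: (le_trans bb); rewrite mulr1.
have hRn : sb n <= eta * c1 / B * ss n by near: n; exact: hR.
apply: (@le_trans _ _ (B * (eta * c1 / B * ss n))).
  by apply: ler_wpM2l => //; exact: ltW.
rewrite [leLHS](_ : _ = eta * (c1 * ss n)); last by field; rewrite gt_eqF.
by apply: ler_wpM2l => //; exact: ltW.
Unshelve. all: by end_near. Qed.

Lemma sobolev_space_coord (mu : H1) : sobolev_space ip1 e beta mu ->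
  exists M : R, 0 < M /\ sobolev_coord (fun i => ip1 mu (e i)) M.
Proof.
rewrite /sobolev_space/=; case E : (sobolev_norm ip1 e beta mu) => [r| |]// _.
  have M0 : 0 < Num.max r 1 by rewrite lt_max ltr01 orbT.
  exists (Num.max r 1); split => //.
  by apply/(sobolev_normP _ _ _ _ (ltW M0)); rewrite E lee_fin le_max lexx.
by exists 1; split => //; apply/(sobolev_normP _ _ _ _ ler01); rewrite E leNye.
Qed.

Lemma coverage_fixed (mu : H1) : beta + q < 1 + 2 * alpha + 2 * p ->
  sobolev_space ip1 e beta mu ->
  (exists D : R, 0 < D /\ \forall n \near \oo, sb n <= D * ss n) ->
  asymp_in (1 - 2 * Phi z) 1 (fun n => cov n mu).
Proof.
move=> ba /sobolev_space_coord[M [M0 hM]] [D [D0 hD]].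
have [r1 [r2 [c1 [c2 [B [X [r11 c10 c20 B0 h]]]]]]] := coverage_formula.
have z0 : 0 < - z by have := hz; lra.
have [eta [c3 [c4 [eta0 hc3 hc4 hg]]]] := coverage_small_bias r2 z0 r11.
rewrite opprK in hc3.
have e1 : 0 < eta * c1 / D by solve_gt0.
have [X' hX'] := bias_fixed_small halpha hp hC hkappaC hqbeta hS hlS ba M0 e1 hM.
apply: (limn_bounds hc3 hc4); near=> n.
have [n0 rX] : (0 < n)%N /\ X <= r_ n by near: n; exact: rho_near.
have [_ rX'] : (0 < n)%N /\ X' <= r_ n by near: n; exact: rho_near.
have [ss0 sb0 hn] := h n n0 rX.
have [v [m [sd [w [cv cm _ [_ sd0 /andP[s1 s2] hw ->]]]]]] := hn mu M M0 hM.
have [v' [m' [cv' cm' bb]]] := hX' n (tau n) n0 (tau0 n) rX'.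
rewrite (cvg_unique _ cv' cv)// (cvg_unique _ cm' cm)// in bb.
rewrite !lee_fin; apply: hg => //.
rewrite normrM normfV (gtr0_norm sd0) ler_pdivrMr//; apply: (le_trans bb).
have hRn : sb n <= D * ss n by near: n; exact: hD.
apply: (@le_trans _ _ (eta * c1 / D * (D * ss n))).
  by apply: ler_wpM2l => //; exact: ltW.
rewrite [leLHS](_ : _ = eta * (c1 * ss n)); last by field; rewrite gt_eqF.
by apply: ler_wpM2l => //; exact: ltW.
Unshelve. all: by end_near. Qed.

Lemma coord_element (m : nat -> R) (M : R) : sobolev_coord m M ->
  exists mu : H1, forall i, ip1 mu (e i) = m i.
Proof.
move=> hM; apply: (exists_coord hip1 he (M := M ^+ 2)) => k.
apply: le_trans (hM k); apply: ler_sum => i _.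
apply: ler_peMr; first exact: sqr_ge0.
by apply: powR_ge1; [rewrite ler1n|have ? := hbeta; lra].
Qed.

Definition shrunk_sum (n : nat) (m : nat -> R) (k : nat) : R :=
  \sum_(0 <= i < k) l i * m i *
    (1 + n%:R * prior_eigenvalue alpha (tau n) i * kappa i ^+ 2)^-1.

(** All terms of the bias series are nonnegative, so that the bias is at least
    each of the partial sums. *)
Lemma coverage_to0 (mu : nat -> H1) (M eps c : R) : 0 < M -> 0 < c ->
  (forall n, sobolev_coord (fun i => ip1 (mu n) (e i)) M) ->
  (\forall n \near \oo, (forall i, 0 <= l i * ip1 (mu n) (e i)) /\
    exists k, c * (r_ n `^ (- eps) * sb n) <= shrunk_sum n (fun i => ip1 (mu n) (e i)) k) ->
  (forall D : R, \forall n \near \oo, D * ss n <= r_ n `^ (- eps) * sb n) ->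
  cov n (mu n) @[n --> \oo] --> 0%E.
Proof.
move=> M0 c0 hM hlow hD.
have [r1 [r2 [c1 [c2 [B [X [r11 c10 c20 B0 h]]]]]]] := coverage_formula.
have z0 : 0 < - z by have := hz; lra.
apply: cvg_ereal0 => eps' e0.
have [M1 hM1] := coverage_large_bias r2 z0 r11 e0.
have M20 : 0 <= Num.max M1 0 by rewrite le_max lexx orbT.
near=> n.
have [n0 rX] : (0 < n)%N /\ X <= r_ n by near: n; exact: rho_near.
have [ss0 sb0 hn] := h n n0 rX.
have [v [m [sd [w [_ _ cb [_ sd0 /andP[s1 s2] hw ->]]]]]] := hn (mu n) M M0 (hM n).
rewrite !lee_fin; apply: hM1 => //.
apply: (@le_trans _ _ (Num.max M1 0)); first by rewrite le_max lexx.
rewrite ler_pdivlMr//.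
have [l0 [k hk]] : (forall i, 0 <= l i * ip1 (mu n) (e i)) /\
    exists k, c * (r_ n `^ (- eps) * sb n) <= shrunk_sum n (fun i => ip1 (mu n) (e i)) k.
  by near: n.
have f0 i : 0 <= l i * ip1 (mu n) (e i) *
    (1 + n%:R * prior_eigenvalue alpha (tau n) i * kappa i ^+ 2)^-1.
  apply: mulr_ge0 => //; rewrite invr_ge0 addr_ge0// mulr_ge0 ?sqr_ge0//.
  by rewrite mulr_ge0// ltW// lam_gt0.
have := nonneg_partial_le k f0 cb; rewrite -/(shrunk_sum n _ k) => hk'.
apply: le_trans hk'; apply: le_trans hk.
apply: (@le_trans _ _ (Num.max M1 0 * (c2 * ss n))); first by apply: ler_wpM2l.
have hDn : Num.max M1 0 * c2 / c * ss n <= r_ n `^ (- eps) * sb n by near: n; exact: hD.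
apply: (@le_trans _ _ (c * (Num.max M1 0 * c2 / c * ss n))); last first.
  by apply: ler_wpM2l => //; exact: ltW.
by rewrite [leRHS](_ : _ = Num.max M1 0 * (c2 * ss n))//; field; rewrite gt_eqF.
Unshelve. all: by end_near. Qed.

(** For the finitely many n with rho_n below the threshold of [bias_extremal]
    the element is 0. *)
Lemma extremal_elements : exists c : R, exists mu : nat -> H1, [/\ 0 < c,
  forall n, sobolev_coord (fun i => ip1 (mu n) (e i)) 1 &
  \forall n \near \oo, (forall i, 0 <= l i * ip1 (mu n) (e i)) /\
    exists k, c * sb n <= shrunk_sum n (fun i => ip1 (mu n) (e i)) k].
Proof.
have [c [X [c0 X1 h]]] := bias_extremal halpha hp hC hkappaC hqbeta hS hlS.
have : forall n, exists mu : H1, sobolev_coord (fun i => ip1 mu (e i)) 1 /\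
   ((0 < n)%N /\ X <= r_ n -> (forall i, 0 <= l i * ip1 mu (e i)) /\
    exists k, c * sb n <= shrunk_sum n (fun i => ip1 mu (e i)) k).
  move=> n; have [[n0 rX]|hn] := pselect ((0 < n)%N /\ X <= r_ n).
    have [m [k [m0 mM mk]]] := h n (tau n) n0 (tau0 n) rX.
    have hm : sobolev_coord m 1 by move=> k'; rewrite expr1n.
    have [mu hmu] := coord_element hm; exists mu.
    have E : (fun i => ip1 mu (e i)) = m by apply/funext.
    rewrite E; split => // _; split; last by exists k.
    by move=> i; rewrite hmu.
  exists 0; split => // k.
  by rewrite big1 ?expr1n// => i _; rewrite linear0l expr0n mul0r.
move=> /choice[mu hmu]; exists c, mu; split => //.
  by move=> n; have [] := hmu n.
near=> n; have [_] := hmu n; apply.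
by near: n; exact: rho_near.
Unshelve. all: by end_near. Qed.

Lemma sobolev_coord_bounded (mu : nat -> H1) (M : R) : 0 <= M ->
  (forall n, sobolev_coord (fun i => ip1 (mu n) (e i)) M) -> sobolev_bounded ip1 e beta mu.
Proof.
move=> M0 h; apply: (@le_lt_trans _ _ M%:E); last exact: ltry.
by apply: ge_ereal_sup => _ [n _ <-]; apply/(sobolev_normP _ _ _ _ M0); exact: h.
Qed.

Lemma coverage_worst : (forall D : R, \forall n \near \oo, D * ss n <= sb n) ->
  exists mu : nat -> H1, sobolev_bounded ip1 e beta mu /\
    cov n (mu n) @[n --> \oo] --> 0%E.
Proof.
move=> hD; have [c [mu [c0 hM hlow]]] := extremal_elements.
exists mu; split; first exact: (sobolev_coord_bounded ler01).
apply: (@coverage_to0 mu 1 0 c) => //.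
  by apply: filterS hlow => n; rewrite oppr0 powRr0 mul1r.
by move=> D; apply: filterS (hD D) => n; rewrite oppr0 powRr0 mul1r.
Qed.

Lemma coverage_worst_fixed (eps : R) : 0 < eps ->
  (forall D : R, \forall n \near \oo, D * ss n <= r_ n `^ (- eps) * sb n) ->
  exists mu : H1, sobolev_space ip1 e beta mu /\ cov n mu @[n --> \oo] --> 0%E.
Proof.
move=> e0 hD.
have [m [M [c [X [[M0 c0] m0 hm h]]]]] := bias_fixed halpha hp hC hkappaC hqbeta hS hlS e0.
have [mu hmu] := coord_element hm; exists mu.
have E : (fun i => ip1 mu (e i)) = m by apply/funext.
have hM : sobolev_coord (fun i => ip1 mu (e i)) M by rewrite E.
split.
  rewrite /sobolev_space/=; apply: (@le_lt_trans _ _ M%:E); last exact: ltry.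
  by apply/(sobolev_normP _ _ _ _ (ltW M0)).
apply: (@coverage_to0 (fun=> mu) M eps c) => //.
near=> n; split; first by move=> i; rewrite hmu.
rewrite E; have [n0 rX] : (0 < n)%N /\ X <= r_ n by near: n; exact: rho_near.
exact: h.
Unshelve. all: by end_near. Qed.

(** The multiple N of the extremal elements is chosen such that the bias is at
    least M2 standard deviations, which makes the coverage small; the bias
    remains bounded in units of the standard deviation, which keeps the
    coverage away from 0. *)
Lemma coverage_critical (c : R) : 0 < c ->
  (exists D1 D2 : R, [/\ 0 < D1, 0 < D2 & \forall n \near \oo, D1 * ss n <= sb n <= D2 * ss n]) ->
  exists mu : nat -> H1, sobolev_bounded ip1 e beta mu /\
    asymp_in 0 c (fun n => cov n (mu n)).
Proof.
move=> c0 [D1 [D2 [D10 D20 hD]]].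
have [r1 [r2 [c1 [c2 [B [X [r11 c10 c20 B0 h]]]]]]] := coverage_formula.
have z0 : 0 < - z by have := hz; lra.
have [c3 [mu [c30 hM hlow]]] := extremal_elements.
have e0 : 0 < c / 2 by lra.
have [M1 hM1] := coverage_large_bias r2 z0 r11 e0.
have M20 : 0 < Num.max M1 1 by rewrite lt_max ltr01 orbT.
set M2 := Num.max M1 1 in M20.
pose N := M2 * c2 / (c3 * D1).
have N0 : 0 < N by rewrite /N; solve_gt0.
have NE n i : ip1 (N *: mu n) (e i) = N * ip1 (mu n) (e i) by rewrite linearZl_LR.
have hN n : sobolev_coord (fun i => ip1 (N *: mu n) (e i)) N.
  move=> k; under eq_bigr do rewrite NE exprMn -mulrA.
  by rewrite -mulr_sumr; apply: ler_piMr; [exact: sqr_ge0|have := hM n k; rewrite expr1n].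
exists (fun n => N *: mu n); split; first exact: (sobolev_coord_bounded (ltW N0)).
have [c4 [c40 hc4]] := coverage_bounded_bias r2 z0 r11 (B * D2 * N / c1).
have cc : c / 2 < c by lra.
apply: (limn_bounds c40 cc); near=> n.
have [n0 rX] : (0 < n)%N /\ X <= r_ n by near: n; exact: rho_near.
have [ss0 sb0 hn] := h n n0 rX.
have [v [m [sd [w [_ _ cb [bb sd0 /andP[s1 s2] hw ->]]]]]] := hn (N *: mu n) N N0 (hN n).
have /andP[d1 d2] : D1 * ss n <= sb n <= D2 * ss n by near: n.
have [l0 [k hk]] : (forall i, 0 <= l i * ip1 (mu n) (e i)) /\
    exists k, c3 * sb n <= shrunk_sum n (fun i => ip1 (mu n) (e i)) k by near: n.
have f0 i : 0 <= l i * ip1 (N *: mu n) (e i) *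
    (1 + n%:R * prior_eigenvalue alpha (tau n) i * kappa i ^+ 2)^-1.
  rewrite NE mulrCA; apply: mulr_ge0.
    by apply: mulr_ge0 => //; exact: ltW.
  rewrite invr_ge0 addr_ge0// mulr_ge0 ?sqr_ge0//.
  by rewrite mulr_ge0// ltW// lam_gt0.
have hk' := nonneg_partial_le k f0 cb.
have hk2 : N * shrunk_sum n (fun i => ip1 (mu n) (e i)) k <= v - m.
  apply: le_trans hk'; rewrite /shrunk_sum mulr_sumr; apply: ler_sum => i _.
  by rewrite NE (mulrCA (l i)) [leLHS]mulrA.
have y1 : M1 <= (v - m) / sd.
  apply: (@le_trans _ _ M2); first by rewrite /M2 le_max lexx.
  rewrite ler_pdivlMr//; apply: le_trans hk2.
  apply: (@le_trans _ _ (N * (c3 * (D1 * ss n)))); last first.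
    apply: ler_wpM2l; first exact: ltW.
    by apply: le_trans hk; apply: ler_wpM2l => //; exact: ltW.
  rewrite [leRHS](_ : _ = M2 * (c2 * ss n)); last by rewrite /N; field; rewrite !gt_eqF.
  by apply: ler_wpM2l => //; exact: ltW.
have y2 : `|(v - m) / sd| <= B * D2 * N / c1.
  rewrite normrM normfV (gtr0_norm sd0) ler_pdivrMr//; apply: (le_trans bb).
  apply: (@le_trans _ _ (B * (D2 * ss n) * N)).
    by apply: ler_wpM2r; [exact: ltW|apply: ler_wpM2l => //; exact: ltW].
  rewrite [leLHS](_ : _ = B * D2 * N / c1 * (c1 * ss n)); last by field; rewrite gt_eqF.
  by apply: ler_wpM2l => //; apply: ltW; solve_gt0.
have /andP[_ h2] := hM1 _ _ y1 hw.
by rewrite !lee_fin h2 andbT; exact: hc4.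
Unshelve. all: by end_near. Qed.

End coverage_regimes.

(** * Comparison of scalings *)

Section rates.
Context (R : realType) (alpha p beta q : R) (S : R -> R).
Hypotheses (halpha : 0 < alpha) (hp : 0 <= p) (hbeta : 0 < beta).
Hypotheses (hqp : q < p) (hS : slowly_varying S).

Let a := 1 + 2 * alpha + 2 * p.
Let b := beta + q.
Let kap := Num.min b a + p - q.
Let A x := `|S x|.
Let A0 x : 0 <= A x. Proof. exact: normr_ge0. Qed.
Let hA : potter A. Proof. exact: slowly_varying_potter. Qed.
Let a0 : 0 < a. Proof. exact: model_a_gt0. Qed.

Lemma kap_gt0 : 0 < kap.
Proof.
have h1 := a0; have h2 := hqp; have h3 := hbeta; have h4 := hp.
by rewrite /kap; have [|] := leP b a; rewrite /b => ?; lra.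
Qed.
Let k0 := kap_gt0.

(** The ratio of bias rate and spread rate is n^(1/2) times this function of
    rho_n, since tau_n is rho_n^(a / 2) n^(- 1/2). *)
Definition rate_ratio (r : R) : R := r `^ (- kap) * Num.sqrt (gam2_at A a b r) / A r.

(** The function is rho^(- kap) times a slowly varying function. *)
Lemma rate_ratio_potter (eps : R) : 0 < eps -> exists C X : R, [/\ 0 < C, 1 <= X &
  forall x y, X <= x -> x <= y -> [/\ 0 < rate_ratio x,
    rate_ratio y <= C * (y / x) `^ (eps - kap) * rate_ratio x &
    rate_ratio x <= C * (y / x) `^ (kap + eps) * rate_ratio y]].
Proof.
move=> e0; have e20 : 0 < eps / 2 by lra.
have [C1 [X1 [C11 X11 h1]]] := potter_up A0 hA e20.
have [C2 [X2 [C20 X21 h2]]] := gam2_at_potter A0 hA a b e0.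
have [X3 [X31 h3]] := potter_pos hA.
have C10 : 0 < C1 by lra.
exists (Num.sqrt C2 * C1), (Num.max X1 (Num.max X2 X3)); split.
- by rewrite mulr_gt0// sqrtr_gt0.
- by rewrite le_max X11.
move=> x y; rewrite !ge_max => /and3P[x1 x2 x3] xy.
have x0 : 0 < x by lra.
have y0 : 0 < y by lra.
have Ax : 0 < A x by exact: h3.
have Ay : 0 < A y by apply: h3; lra.
have [a1 a2] := h1 x y x1 xy.
have [gx g1 g2] := h2 x y x2 xy.
have [gy _ _] := h2 y y (le_trans x2 xy) (lexx _).
have w0 : 0 < y / x by solve_gt0.
set w := y / x in a1 a2 g1 g2 w0 *.
have sw : Num.sqrt (w `^ eps) = w `^ (eps / 2).
  by rewrite -[RHS]ger0_norm ?powR_ge0// -sqrtr_sqr powR_sqr; congr (Num.sqrt (_ `^ _)); field.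
have s1 : Num.sqrt (gam2_at A a b x) <= Num.sqrt C2 * w `^ (eps / 2) * Num.sqrt (gam2_at A a b y).
  rewrite -sw -!sqrtrM; first by apply: ler_wsqrtr.
    by apply: mulr_ge0; [exact: ltW|exact: powR_ge0].
  exact: ltW.
have s2 : Num.sqrt (gam2_at A a b y) <= Num.sqrt C2 * w `^ (eps / 2) * Num.sqrt (gam2_at A a b x).
  rewrite -sw -!sqrtrM; first by apply: ler_wsqrtr.
    by apply: mulr_ge0; [exact: ltW|exact: powR_ge0].
  exact: ltW.
have i1 : (A x)^-1 <= C1 * w `^ (eps / 2) / A y.
  by rewrite ler_pdivlMr// mulrC ler_pdivrMr.
have i2 : (A y)^-1 <= C1 * w `^ (eps / 2) / A x.
  by rewrite ler_pdivlMr// mulrC ler_pdivrMr.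
have we : w `^ eps = w `^ (eps / 2) * w `^ (eps / 2).
  by rewrite -powRDp//; congr (_ `^ _); field.
have wk : w `^ kap = y `^ kap / x `^ kap by exact: powR_divp.
have xk : 0 < x `^ kap by rewrite powR_gt0.
have yk : 0 < y `^ kap by rewrite powR_gt0.
have we0 : 0 < w `^ (eps / 2) by rewrite powR_gt0.
have sx : 0 < Num.sqrt (gam2_at A a b x) by rewrite sqrtr_gt0.
have sy : 0 < Num.sqrt (gam2_at A a b y) by rewrite sqrtr_gt0.
rewrite /rate_ratio; split.
- have P0 : 0 < x `^ (- kap) by rewrite powR_gt0.
  by solve_gt0.
- rewrite powRDp// we [w `^ (- kap)]powRN wk !powRN.
  rewrite [leRHS](_ : _ = (y `^ kap)^-1 * (Num.sqrt C2 * w `^ (eps / 2) * Num.sqrt (gam2_at A a b x)) * (C1 * w `^ (eps / 2) / A x)); last first.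
    by field; rewrite !gt_eqF.
  by apply: ler_pM; [solve_ge0|solve_ge0|apply: ler_wpM2l; [solve_ge0|]|].
- rewrite powRDp// we wk !powRN.
  rewrite [leRHS](_ : _ = (x `^ kap)^-1 * (Num.sqrt C2 * w `^ (eps / 2) * Num.sqrt (gam2_at A a b y)) * (C1 * w `^ (eps / 2) / A y)); last first.
    by field; rewrite !gt_eqF.
  by apply: ler_pM; [solve_ge0|solve_ge0|apply: ler_wpM2l; [solve_ge0|]|].
Qed.

Lemma bias_spread_ratio (n : nat) (t : R) : (0 < n)%N -> 0 < t -> 0 < A (rho alpha p n t) ->
  bias_order alpha p beta q S n t =
  Num.sqrt n%:R * rate_ratio (rho alpha p n t) * spread_order alpha p q S n t.
Proof.
move=> n0 t0 Ar; rewrite /bias_order /spread_order /rate_ratio -/a -/b -/A.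
have N0 : 0 < n%:R :> R by rewrite ltr0n.
have E := powR_rho a0 n0 t0.
set r := rho alpha p n t in Ar E *.
have r0 : 0 < r by exact: rho_gt0.
have sE : Num.sqrt n%:R * t = r `^ (a / 2).
  rewrite -[t in LHS]gtr0_norm// -sqrtr_sqr -sqrtrM; last exact: ltW.
  rewrite -E -[RHS]ger0_norm ?powR_ge0// -sqrtr_sqr powR_sqr; congr (Num.sqrt (_ `^ _)).
  by rewrite -/a; field.
have -> : - Num.min b a = a / 2 + - kap + - (2^-1 + alpha + q).
  by rewrite /kap /a; field.
rewrite powRDp// powRDp// -sE -/(A r).
by field; rewrite gt_eqF.
Qed.

Lemma rho_ratio (n : nat) (t t' : R) : (0 < n)%N -> 0 < t -> 0 < t' ->
  rho alpha p n t' / rho alpha p n t = (t' / t) `^ (2 / a).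
Proof.
move=> n0 t0 t'0; have N0 : 0 < n%:R :> R by rewrite ltr0n.
have s0 : 0 < t ^+ 2 by rewrite exprn_gt0.
have s'0 : 0 < t' ^+ 2 by rewrite exprn_gt0.
rewrite /rho -/a -powR_divp ?mulr_gt0//.
rewrite (_ : n%:R * t' ^+ 2 / (n%:R * t ^+ 2) = (t' / t) ^+ 2); last first.
  by field; rewrite !gt_eqF.
rewrite -powR_mulrn; last by rewrite divr_ge0// ltW.
by rewrite -powRrM.
Qed.

Let sb n t := bias_order alpha p beta q S n t.
Let ss n t := spread_order alpha p q S n t.
Let r_ n t := rho alpha p n t.
Let RR n t := Num.sqrt n%:R * rate_ratio (r_ n t).

Lemma ratio_near (tau : nat -> R) : scaling tau ->
  \forall n \near \oo, [/\ (0 < n)%N, 0 < ss n (tau n), 0 < RR n (tau n) &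
    sb n (tau n) = RR n (tau n) * ss n (tau n)].
Proof.
move=> ht; have [X [X1 hX]] := potter_pos hA.
have [C [X' [C0 X'1 hX']]] := rate_ratio_potter ltr01.
near=> n.
have [n0 rX] : (0 < n)%N /\ X <= r_ n (tau n) by near: n; exact: rho_near.
have [_ rX'] : (0 < n)%N /\ X' <= r_ n (tau n) by near: n; exact: rho_near.
have t0 := ht.1 n.
have Ar : 0 < A (r_ n (tau n)) by exact: hX.
have [h0 _ _] := hX' _ _ rX' (lexx _).
have r0 : 0 < r_ n (tau n) by exact: rho_gt0.
split => //.
- rewrite /ss /spread_order -/A; apply: mulr_gt0 => //; apply: mulr_gt0 => //.
  by rewrite powR_gt0.
- by rewrite /RR mulr_gt0// sqrtr_gt0 ltr0n.
- exact: bias_spread_ratio.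
Unshelve. all: by end_near. Qed.

Lemma balanced_near (ttau : nat -> R) : balancing_scaling alpha p beta q S ttau ->
  exists c C : R, [/\ 0 < c, 0 < C & \forall n \near \oo, c <= RR n (ttau n) <= C].
Proof.
move=> [ht [c [C [c0 h]]]]; exists c, (Num.max C 1); split => //.
  by rewrite lt_max ltr01 orbT.
near=> n.
have [n0 ss0 RR0 E] : [/\ (0 < n)%N, 0 < ss n (ttau n), 0 < RR n (ttau n) &
    sb n (ttau n) = RR n (ttau n) * ss n (ttau n)] by near: n; exact: ratio_near.
have : c <= `|bias_rate alpha p beta q S n (ttau n) / spread_rate alpha p q S n (ttau n)| <= C.
  by near: n.
rewrite bias_rateE ?(ht.1 n)// spread_rateE ?(ht.1 n)// -/(sb _ _) -/(ss _ _) E mulfK ?gt_eqF//.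
by rewrite gtr0_norm// => /andP[h1 h2]; rewrite h1 le_max h2.
Unshelve. all: by end_near. Qed.

(** For fixed n the ratio of the two values of rho is (t' / t)^(2 / a); the
    exponents kap / 2 and 3 kap / 2 of [rate_ratio_potter] at eps = kap / 2
    become kap / a and 3 kap / a. *)
Lemma ratio_compare : exists C X : R, [/\ 0 < C, 1 <= X &
  forall (n : nat) (t t' : R), (0 < n)%N -> 0 < t -> t <= t' -> X <= r_ n t ->
  RR n t' <= C * (t / t') `^ (kap / a) * RR n t /\
  RR n t <= C * (t' / t) `^ (3 * kap / a) * RR n t'].
Proof.
have e0 : 0 < kap / 2 by have := k0; lra.
have [C [X [C0 X1 h]]] := rate_ratio_potter e0.
exists C, X; split => // n t t' n0 t0 tt rX.
have t'0 : 0 < t' by lra.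
have r0 : 0 < r_ n t by exact: rho_gt0.
have ap := a0.
have E : r_ n t' / r_ n t = (t' / t) `^ (2 / a) by exact: rho_ratio.
have rr : r_ n t <= r_ n t'.
  have : 1 <= r_ n t' / r_ n t.
    by rewrite E; apply: powR_ge1; [rewrite ler_pdivlMr ?mul1r|apply: divr_ge0; lra].
  by rewrite ler_pdivlMr// mul1r.
have [_ h1 h2] := h _ _ rX rr.
have tE : t / t' = (t' / t)^-1 by rewrite invf_div.
rewrite E -!powRrM in h1 h2; rewrite /RR; split.
  rewrite [leRHS]mulrCA; apply: ler_wpM2l; first exact: sqrtr_ge0.
  rewrite tE powRVp ?divr_gt0//.
  have -> : - (kap / a) = 2 / a * (kap / 2 - kap) by field; rewrite gt_eqF.
  exact: h1.
rewrite [leRHS]mulrCA; apply: ler_wpM2l; first exact: sqrtr_ge0.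
have -> : 3 * kap / a = 2 / a * (kap + kap / 2) by field; rewrite gt_eqF.
exact: h2.
Qed.

Section balancing.
Variables (tau ttau : nat -> R).
Hypotheses (htau : scaling tau) (hbal : balancing_scaling alpha p beta q S ttau).

Let tau0 n : 0 < tau n. Proof. exact: htau.1. Qed.
Let ttau0 n : 0 < ttau n. Proof. exact: hbal.1.1. Qed.
Let ka0 : 0 < kap / a. Proof. exact: divr_gt0 k0 a0. Qed.

Lemma small_ratio (u v : nat -> R) (c : R) : (forall n, 0 < u n) -> (forall n, 0 < v n) ->
  asymp_small u v -> 0 < c ->
  \forall n \near \oo, u n <= v n /\ (u n / v n) `^ (kap / a) <= c.
Proof.
move=> u0 v0 huv c0.
have d0 : 0 < Num.min 1 (c `^ (kap / a)^-1) by rewrite lt_min ltr01 powR_gt0.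
have /cvgrPdist_le /(_ _ d0) := huv; apply: filterS => n /=.
have uv0 : 0 < u n / v n by rewrite divr_gt0.
rewrite sub0r normrN gtr0_norm// le_min => /andP[h1 h2]; split.
  by move: h1; rewrite ler_pdivrMr// mul1r.
have -> : c = (c `^ (kap / a)^-1) `^ (kap / a).
  by rewrite -powRrM mulVf ?gt_eqF// powRr1// ltW.
by apply: powR_mono => //; exact: ltW.
Qed.

Lemma bias_negligible : asymp_small ttau tau -> forall eta : R, 0 < eta ->
  \forall n \near \oo, sb n (tau n) <= eta * ss n (tau n).
Proof.
move=> hs eta eta0.
have [c0 [C0 [c00 C00 hb]]] := balanced_near hbal.
have [C [X [Cp X1 h]]] := ratio_compare.
have e1 : 0 < eta / (C * C0) by solve_gt0.
near=> n.
have [n0 rX] : (0 < n)%N /\ X <= r_ n (ttau n) by near: n; apply: rho_near => //; exact: hbal.1.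
have [_ ss0 RR0 ->] : [/\ (0 < n)%N, 0 < ss n (tau n), 0 < RR n (tau n) &
    sb n (tau n) = RR n (tau n) * ss n (tau n)] by near: n; exact: ratio_near.
apply: ler_wpM2r; first exact: ltW.
have [tt ht] : ttau n <= tau n /\ (ttau n / tau n) `^ (kap / a) <= eta / (C * C0).
  by near: n; exact: small_ratio.
have /andP[b1 b2] : c0 <= RR n (ttau n) <= C0 by near: n.
have [h1 _] := h n _ _ n0 (ttau0 n) tt rX.
apply: (le_trans h1).
apply: (@le_trans _ _ (C * (eta / (C * C0)) * C0)).
  apply: ler_pM => //; first by solve_ge0.
    by lra.
  by apply: ler_wpM2l => //; exact: ltW.
by rewrite [leLHS](_ : _ = eta)//; field; rewrite !gt_eqF.
Unshelve. all: by end_near. Qed.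

Lemma bias_comparable : asymp_equiv tau ttau -> exists D1 D2 : R, [/\ 0 < D1, 0 < D2 &
  \forall n \near \oo, D1 * ss n (tau n) <= sb n (tau n) <= D2 * ss n (tau n)].
Proof.
move=> [c1 [c2 [c10 hc]]].
have [c0 [C0 [c00 C00 hb]]] := balanced_near hbal.
have [C [X [Cp X1 h]]] := ratio_compare.
pose M := Num.max 1 (Num.max c2 c1^-1).
have M1 : 1 <= M by rewrite le_max lexx.
have k3 : 0 <= 3 * kap / a by rewrite -mulrA; apply: mulr_ge0 => //; exact: ltW.
pose E := C * M `^ (3 * kap / a).
have M0 : 0 < M by lra.
have E0 : 0 < E by rewrite /E; solve_gt0.
have key n t t' : (0 < n)%N -> 0 < t -> t <= t' -> X <= r_ n t -> t' / t <= M ->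
  0 <= RR n t -> 0 <= RR n t' -> RR n t' <= E * RR n t /\ RR n t <= E * RR n t'.
  move=> n0 t0 tt rX tM R0 R'0; have [h1 h2] := h n t t' n0 t0 tt rX.
  have t'0 : 0 < t' by lra.
  split; [apply: (le_trans h1)|apply: (le_trans h2)]; apply: ler_wpM2r => //; apply: ler_wpM2l; try exact: ltW.
    apply: (@le_trans _ _ 1); last exact: powR_ge1.
    by apply: powR_le1; [rewrite divr_gt0|rewrite ler_pdivrMr ?mul1r|exact: ltW].
  by apply: powR_mono => //; rewrite divr_ge0// ltW.
exists (c0 / E), (E * C0); split; [by solve_gt0|by solve_gt0|].
near=> n.
have [n0 rX] : (0 < n)%N /\ X <= r_ n (ttau n) by near: n; apply: rho_near => //; exact: hbal.1.
have [_ rX'] : (0 < n)%N /\ X <= r_ n (tau n) by near: n; apply: rho_near.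
have [_ ss0 RR0 ->] : [/\ (0 < n)%N, 0 < ss n (tau n), 0 < RR n (tau n) &
    sb n (tau n) = RR n (tau n) * ss n (tau n)] by near: n; exact: ratio_near.
have /andP[b1 b2] : c0 <= RR n (ttau n) <= C0 by near: n.
have /andP[d1 d2] : c1 <= `|tau n / ttau n| <= c2 by near: n.
have q0 : 0 < tau n / ttau n by rewrite divr_gt0.
rewrite gtr0_norm// in d1 d2.
have R0 : 0 <= RR n (ttau n) by lra.
have [k1 k2] : RR n (tau n) <= E * RR n (ttau n) /\ RR n (ttau n) <= E * RR n (tau n).
  have [tt|tt] := leP (ttau n) (tau n).
    by apply: key => //; [rewrite /M !le_max d2 orbT|exact: ltW].
  have tM : ttau n / tau n <= M by rewrite /M !le_max -invf_div lef_pV2 ?posrE// d1 !orbT.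
  by have [k1 k2] := key n (tau n) (ttau n) n0 (tau0 n) (ltW tt) rX' tM (ltW RR0) R0.
apply/andP; split; apply: ler_wpM2r; try exact: ltW.
  by rewrite ler_pdivrMr// mulrC; lra.
by apply: (le_trans k1); apply: ler_wpM2l => //; exact: ltW.
Unshelve. all: by end_near. Qed.

Lemma bias_dominant : asymp_small tau ttau -> forall D : R,
  \forall n \near \oo, D * ss n (tau n) <= sb n (tau n).
Proof.
move=> hs D.
have [c0 [C0 [c00 C00 hb]]] := balanced_near hbal.
have [C [X [Cp X1 h]]] := ratio_compare.
pose M := Num.max D 1.
have M0 : 0 < M by rewrite lt_max ltr01 orbT.
have e1 : 0 < c0 / (C * M) by solve_gt0.
near=> n.
have [n0 rX] : (0 < n)%N /\ X <= r_ n (tau n) by near: n; apply: rho_near.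
have [_ ss0 RR0 ->] : [/\ (0 < n)%N, 0 < ss n (tau n), 0 < RR n (tau n) &
    sb n (tau n) = RR n (tau n) * ss n (tau n)] by near: n; exact: ratio_near.
apply: ler_wpM2r; first exact: ltW.
have [tt ht] : tau n <= ttau n /\ (tau n / ttau n) `^ (kap / a) <= c0 / (C * M).
  by near: n; exact: small_ratio.
have /andP[b1 b2] : c0 <= RR n (ttau n) <= C0 by near: n.
have [h1 _] := h n _ _ n0 (tau0 n) tt rX.
apply: (@le_trans _ _ M); first by rewrite le_max lexx.
have : c0 <= c0 / M * RR n (tau n).
  apply: (le_trans b1); apply: (le_trans h1); apply: ler_wpM2r; first exact: ltW.
  rewrite [leRHS](_ : _ = C * (c0 / (C * M))); last by field; rewrite !gt_eqF.
  by apply: ler_wpM2l => //; exact: ltW.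
by rewrite mulrAC ler_pdivlMr// ler_pM2l.
Unshelve. all: by end_near. Qed.

(** If tau is smaller than the balancing scaling by a factor n^(- delta), then
    R_n exceeds a power of n. As R_n is bounded below at the balancing
    scaling, n is at least a multiple of rho^kap there, and a fortiori for the
    smaller value of rho at tau; so R_n exceeds a power of rho. *)
Lemma bias_poly_dominant : asymp_small tau ttau ->
  (exists delta : R, 0 < delta /\ asymp_bounded tau (fun n => n%:R `^ (- delta) * ttau n)) ->
  exists eps : R, 0 < eps /\ forall D : R,
  \forall n \near \oo, D * ss n (tau n) <= r_ n (tau n) `^ (- eps) * sb n (tau n).
Proof.
move=> hs [delta [del0 [B hB]]].
have [c0 [C0 [c00 C00 hb]]] := balanced_near hbal.
have [C [X [Cp X1 h]]] := ratio_compare.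
have k20 : 0 < kap / 2 by have := k0; lra.
have [C' [X' [C'p X'1 h']]] := rate_ratio_potter k20.
have [hX0 _ _] := h' X' X' (lexx _) (lexx _).
have X'0 : 0 < X' by lra.
pose M := Num.max B 1.
have M0 : 0 < M by rewrite lt_max ltr01 orbT.
pose G := C' * (X' `^ (kap / 2)) * rate_ratio X' / c0.
have G0 : 0 < G by rewrite /G; solve_gt0.
(* R_n is of order at least n^(delta kap / a), and n of order at least
   rho^kap; half of the resulting exponent of rho is given away. *)
pose eps := delta * kap / a * kap / 2.
have eps0 : 0 < eps by have ? := k0; have ? := a0; rewrite /eps; solve_gt0.
pose c5 := c0 / C * ((G ^+ 2) `^ delta * M) `^ (- (kap / a)).
have c50 : 0 < c5 by rewrite /c5; solve_gt0.
exists eps; split => // D.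
pose N := Num.max D 1.
have N0 : 0 < N by rewrite lt_max ltr01 orbT.
have cN : 0 < c5 / N by solve_gt0.
have [Z [Z1 hZ]] := powR_decay eps0 cN.
near=> n.
have [n0 rX] : (0 < n)%N /\ X <= r_ n (tau n) by near: n; apply: rho_near.
have [_ rZ] : (0 < n)%N /\ Z <= r_ n (tau n) by near: n; apply: rho_near.
have [_ rX'] : (0 < n)%N /\ X' <= r_ n (ttau n) by near: n; apply: rho_near => //; exact: hbal.1.
have [_ ss0 RR0 ->] : [/\ (0 < n)%N, 0 < ss n (tau n), 0 < RR n (tau n) &
    sb n (tau n) = RR n (tau n) * ss n (tau n)] by near: n; exact: ratio_near.
rewrite [leRHS]mulrA; apply: ler_wpM2r; first exact: ltW.
have [tt _] : tau n <= ttau n /\ (tau n / ttau n) `^ (kap / a) <= 1.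
  by near: n; apply: small_ratio.
have /andP[b1 b2] : c0 <= RR n (ttau n) <= C0 by near: n.
have [h1 _] := h n _ _ n0 (tau0 n) tt rX.
have nR : 0 < n%:R :> R by rewrite ltr0n.
have sn0 : 0 < Num.sqrt n%:R :> R by rewrite sqrtr_gt0.
have r0 : 0 < r_ n (tau n) by exact: rho_gt0.
have rt0 : 0 < r_ n (ttau n) by exact: rho_gt0.
have rr : r_ n (tau n) <= r_ n (ttau n).
  rewrite /r_ /rho; apply: powR_mono.
  - by rewrite invr_ge0 ltW.
  - by rewrite mulr_ge0 ?sqr_ge0// ltW.
  - by apply: ler_wpM2l; [exact: ltW|rewrite ler_sqr ?nnegrE// ltW].
(* n is at least of the order of rho^kap *)
have [_ g1 _] := h' X' _ (lexx _) rX'.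
have hn : r_ n (tau n) `^ (kap / 2) <= G * Num.sqrt n%:R.
  apply: (@le_trans _ _ (r_ n (ttau n) `^ (kap / 2))).
    by apply: powR_mono => //; exact: ltW.
  have := b1; rewrite /RR => b1'.
  have : c0 <= Num.sqrt n%:R * (C' * (r_ n (ttau n) / X') `^ (kap / 2 - kap) * rate_ratio X').
    by apply: (le_trans b1'); apply: ler_wpM2l => //; exact: ltW.
  have -> : kap / 2 - kap = - (kap / 2) by field.
  rewrite powR_divp// !powRN; set y := r_ n (ttau n) `^ (kap / 2).
  have y0 : 0 < y by rewrite /y powR_gt0.
  have x0 : 0 < X' `^ (kap / 2) by rewrite powR_gt0.
  have -> : Num.sqrt n%:R * (C' * (y^-1 / (X' `^ (kap / 2))^-1) * rate_ratio X') =
    c0 * (G * Num.sqrt n%:R) / y.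
    by rewrite /G; field; rewrite !gt_eqF.
  by rewrite ler_pdivlMr// ler_pM2l.
have hn2 : r_ n (tau n) `^ kap <= G ^+ 2 * n%:R.
  have -> : r_ n (tau n) `^ kap = (r_ n (tau n) `^ (kap / 2)) ^+ 2.
    by rewrite powR_sqr; congr (_ `^ _); field.
  have -> : n%:R = Num.sqrt n%:R ^+ 2 :> R by rewrite sqr_sqrtr// ltW.
  rewrite -exprMn ler_sqr ?nnegrE ?powR_ge0//.
  by apply: mulr_ge0; exact: ltW.
have hq : tau n / ttau n <= M * n%:R `^ (- delta).
  have : `|tau n / (n%:R `^ (- delta) * ttau n)| <= B by near: n.
  have P0 : 0 < n%:R `^ (- delta) * ttau n by solve_gt0.
  rewrite gtr0_norm ?divr_gt0// ler_pdivrMr// => hh.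
  rewrite ler_pdivrMr//; apply: (le_trans hh); rewrite mulrA.
  apply: ler_wpM2r; first exact: ltW.
  by apply: ler_wpM2r; [exact: powR_ge0|rewrite le_max lexx].
have hq2 : tau n / ttau n <= (G ^+ 2) `^ delta * M * (r_ n (tau n) `^ (kap * delta))^-1.
  apply: (le_trans hq); rewrite powRN.
  have P1 : 0 < n%:R `^ delta :> R by rewrite powR_gt0.
  have P2 : 0 < r_ n (tau n) `^ (kap * delta) by rewrite powR_gt0.
  rewrite ler_pdivrMr// mulrAC ler_pdivlMr//.
  rewrite [leRHS](_ : _ = M * ((G ^+ 2) `^ delta * n%:R `^ delta)); last by ring.
  apply: ler_wpM2l; first exact: ltW.
  rewrite -powRM ?sqr_ge0 ?(ltW nR)// powRrM.
  by apply: powR_mono => //; [exact: ltW|exact: powR_ge0].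
have hRR : c5 * r_ n (tau n) `^ (2 * eps) <= RR n (tau n).
  have q0 : 0 < tau n / ttau n by rewrite divr_gt0.
  have L : c0 <= C * (tau n / ttau n) `^ (kap / a) * RR n (tau n) by lra.
  have L2 : (tau n / ttau n) `^ (kap / a) <=
      ((G ^+ 2) `^ delta * M) `^ (kap / a) * (r_ n (tau n) `^ (2 * eps))^-1.
    apply: (le_trans (powR_mono (ltW ka0) (ltW q0) hq2)).
    rewrite powR_divp; [|by solve_gt0|by solve_gt0].
    rewrite -powRrM [leLHS](_ : _ = ((G ^+ 2) `^ delta * M) `^ (kap / a) * (r_ n (tau n) `^ (2 * eps))^-1)//.
    congr (_ / (_ `^ _)); have ap := a0; rewrite /eps; field.
    by rewrite gt_eqF.
  have P3 : 0 < ((G ^+ 2) `^ delta * M) `^ (kap / a) by solve_gt0.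
  have P4 : 0 < r_ n (tau n) `^ (2 * eps) by rewrite powR_gt0.
  have L3 : c0 <= C * (((G ^+ 2) `^ delta * M) `^ (kap / a) * (r_ n (tau n) `^ (2 * eps))^-1) * RR n (tau n).
    apply: (le_trans L); apply: ler_wpM2r; first exact: ltW.
    by apply: ler_wpM2l => //; exact: ltW.
  rewrite /c5 powRN.
  set u := ((G ^+ 2) `^ delta * M) `^ (kap / a) in P3 L3 *.
  set v := r_ n (tau n) `^ (2 * eps) in P4 L3 *.
  rewrite [leLHS](_ : _ = c0 * (v / (C * u))); last by field; rewrite !gt_eqF.
  rewrite [leRHS](_ : _ = C * (u * v^-1) * RR n (tau n) * (v / (C * u))); last by field; rewrite !gt_eqF.
  by apply: ler_wpM2r => //; apply: ltW; solve_gt0.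
apply: (@le_trans _ _ N); first by rewrite le_max lexx.
apply: (@le_trans _ _ (r_ n (tau n) `^ (- eps) * (c5 * r_ n (tau n) `^ (2 * eps)))); last first.
  by apply: ler_wpM2l => //; exact: powR_ge0.
rewrite mulrCA -powRDp//; have -> : - eps + 2 * eps = eps by ring.
have := hZ _ rZ; rewrite powRN => hz.
have P5 : 0 < r_ n (tau n) `^ eps by rewrite powR_gt0.
by move: hz; rewrite ler_pdivlMr// mulrC ler_pdivrMr.
Unshelve. all: by end_near. Qed.

End balancing.

Section fixed_scaling.
Variable tau : nat -> R.
Hypotheses (htau : scaling tau) (tau1 : forall n, tau n = 1).

(** For tau = 1, n is rho_n^a, and R_n is a function of rho_n only. *)
Lemma sqrt_sample_size (n : nat) : (0 < n)%N -> Num.sqrt n%:R = r_ n (tau n) `^ (a / 2).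
Proof.
move=> n0; have := powR_rho a0 n0 (htau.1 n); rewrite -/(r_ n (tau n)) -/a tau1 expr1n mulr1 => <-.
rewrite -[RHS]ger0_norm ?powR_ge0// -sqrtr_sqr powR_sqr; congr (Num.sqrt (_ `^ _)).
by field.
Qed.

(** R_n is rho^(a / 2 - kap) up to a slowly varying factor, and kap > a / 2;
    for beta + q >= a the latter is a consequence of q < p. *)
Lemma bias_negligible1 : alpha < beta - 2^-1 -> forall eta : R, 0 < eta ->
  \forall n \near \oo, sb n (tau n) <= eta * ss n (tau n).
Proof.
move=> hab eta eta0.
pose th := kap - a / 2.
have th0 : 0 < th.
  have h1 := halpha; have h2 := hp; have h3 := hqp.
  by rewrite /th /kap; have [] := leP b a; rewrite /a /b => ?; lra.
have th20 : 0 < th / 2 by lra.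
have [C [X [C0 X1 h]]] := rate_ratio_potter th20.
have [hX _ _] := h X X (lexx _) (lexx _).
have X0 : 0 < X by lra.
have c0 : 0 < eta / (C * X `^ (- (th / 2 - kap)) * rate_ratio X) by solve_gt0.
have [Z [Z1 hZ]] := powR_decay th20 c0.
near=> n.
have [n0 rX] : (0 < n)%N /\ X <= r_ n (tau n) by near: n; apply: rho_near.
have [_ rZ] : (0 < n)%N /\ Z <= r_ n (tau n) by near: n; apply: rho_near.
have [_ ss0 RR0 ->] : [/\ (0 < n)%N, 0 < ss n (tau n), 0 < RR n (tau n) &
    sb n (tau n) = RR n (tau n) * ss n (tau n)] by near: n; exact: ratio_near.
apply: ler_wpM2r; first exact: ltW.
have [_ h1 _] := h _ _ (lexx X) rX.
rewrite /RR sqrt_sample_size//; set r := r_ n (tau n) in rX rZ h1 *.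
have r0 : 0 < r by lra.
apply: (@le_trans _ _ (r `^ (a / 2) * (C * (r / X) `^ (th / 2 - kap) * rate_ratio X))).
  by apply: ler_wpM2l => //; exact: powR_ge0.
rewrite powR_divp// [leLHS](_ : _ = (r `^ (a / 2) * r `^ (th / 2 - kap)) *
  (C * (X `^ (th / 2 - kap))^-1 * rate_ratio X)); last by ring.
rewrite -powRDp// -powRN -ler_pdivlMr; last by solve_gt0.
have -> : a / 2 + (th / 2 - kap) = - (th / 2) by rewrite /th; field.
exact: hZ.
Unshelve. all: by end_near. Qed.

(** Here beta + q < a follows from q < p, and the orders of bias and spread
    coincide. *)
Lemma bias_comparable1 : alpha = beta - 2^-1 -> exists D1 D2 : R, [/\ 0 < D1, 0 < D2 &
  \forall n \near \oo, D1 * ss n (tau n) <= sb n (tau n) <= D2 * ss n (tau n)].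
Proof.
move=> hab; exists 1, 1; split => //; apply: nearW => n; rewrite !mul1r.
suff -> : sb n (tau n) = ss n (tau n) by rewrite lexx.
have ba : b < a by have h1 := halpha; have h2 := hp; have h3 := hqp; rewrite /a /b; lra.
rewrite /sb /ss /bias_order /spread_order -/a -/b -/A tau1 mul1r /gam2_at ba min_l; last exact: ltW.
rewrite sqrtr_sqr ger0_norm//; congr (_ `^ (- _) * _).
by rewrite /b hab; field.
Qed.

(** R_n is rho^(a / 2 - kap) up to a slowly varying factor, and a / 2 - kap >=
    1/2 + alpha - beta > 0. *)
Lemma bias_poly_dominant1 : beta - 2^-1 < alpha ->
  exists eps : R, 0 < eps /\ forall D : R,
  \forall n \near \oo, D * ss n (tau n) <= r_ n (tau n) `^ (- eps) * sb n (tau n).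
Proof.
move=> hab; pose th := a / 2 - kap.
have th0 : 0 < th.
  have : Num.min b a <= b by rewrite ge_min lexx.
  by rewrite /th /kap /a /b => ?; lra.
have th30 : 0 < th / 3 by lra.
have [C [X [C0 X1 h]]] := rate_ratio_potter th30.
have [hX _ _] := h X X (lexx _) (lexx _).
have X0 : 0 < X by lra.
exists (th / 3); split => // D.
pose N := Num.max D 1.
have N0 : 0 < N by rewrite lt_max ltr01 orbT.
have c0 : 0 < rate_ratio X * X `^ (kap + th / 3) / (N * C) by solve_gt0.
have [Z [Z1 hZ]] := powR_decay th30 c0.
near=> n.
have [n0 rX] : (0 < n)%N /\ X <= r_ n (tau n) by near: n; apply: rho_near.
have [_ rZ] : (0 < n)%N /\ Z <= r_ n (tau n) by near: n; apply: rho_near.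
have [_ ss0 RR0 ->] : [/\ (0 < n)%N, 0 < ss n (tau n), 0 < RR n (tau n) &
    sb n (tau n) = RR n (tau n) * ss n (tau n)] by near: n; exact: ratio_near.
rewrite [leRHS]mulrA; apply: ler_wpM2r; first exact: ltW.
apply: (@le_trans _ _ N); first by rewrite le_max lexx.
have [_ _ h1] := h _ _ (lexx X) rX.
rewrite /RR sqrt_sample_size//; set r := r_ n (tau n) in rX rZ h1 *.
have r0 : 0 < r by lra.
rewrite mulrA -powRDp//.
have h2 := hZ _ rZ.
have P1 : 0 < r `^ (th / 3) by rewrite powR_gt0.
have P2 : 0 < r `^ (kap + th / 3) by rewrite powR_gt0.
have P3 : 0 < X `^ (kap + th / 3) by rewrite powR_gt0.
have -> : - (th / 3) + a / 2 = th / 3 + (kap + th / 3) by rewrite /th; field.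
rewrite powRDp//; rewrite powR_divp// in h1; rewrite powRN in h2.
set u := r `^ (th / 3) in P1 h2 *; set v := r `^ (kap + th / 3) in P2 h1 *.
set w := X `^ _ in P3 h1 h2; set g := rate_ratio X in hX h1 h2; set k := rate_ratio r in h1 *.
have k1 : g * w <= C * v * k.
  by move: h1; rewrite mulrA mulrAC ler_pdivlMr.
have k2 : N * C <= g * w * u.
  move: h2; rewrite ler_pdivlMr; last by solve_gt0.
  by rewrite mulrC ler_pdivrMr.
have k3 : g * w * u <= C * v * k * u by apply: ler_wpM2r => //; exact: ltW.
have : N * C <= u * v * k * C.
  by rewrite [leRHS](_ : _ = C * v * k * u); [exact: le_trans k3|ring].
by rewrite ler_pM2r.
Unshelve. all: by end_near. Qed.

End fixed_scaling.

End rates.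

(** * The coverage theorem *)

Unset Implicit Arguments.
Set Strict Implicit.
Set Printing Implicit Defensive.

Theorem theorem5p3 (R : realType)
  (* the Hilbert spaces and the operator K *)
  (H1 H2 : completeNormedModType R)
  (ip1 : {dot H1 for idfun}) (ip2 : {dot H2 for idfun})
  (hip1 : norm_of_dot ip1) (hip2 : norm_of_dot ip2)
  (hsep1 : separable H1) (hsep2 : separable H2)
  (K : {linear H1 -> H2}) (KT : {linear H2 -> H1})
  (hK : continuous K) (hKinj : injective K) (hKT : adjoint ip1 ip2 K KT)
  (* eigenbasis of K^T K *)
  (e : nat -> H1) (he : orthonormal_basis ip1 e)
  (kappa : nat -> R) (hkappa : forall i, KT (K (e i)) = kappa i ^+ 2 *: e i)
  (alpha p beta C : R)
  (halpha : 0 < alpha) (hp : 0 <= p) (hbeta : 0 < beta) (hC : 1 <= C)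
  (hkappaC : forall i,
     C^-1 * i.+1%:R `^ (- p) <= kappa i <= C * i.+1%:R `^ (- p))
  (* the priors N(0, Lam n) *)
  (tau : nat -> R) (htau : scaling tau)
  (Lam : nat -> {linear H1 -> H1}) (hLamc : forall n, continuous (Lam n))
  (hLam : forall n i,
     Lam n (e i) = prior_eigenvalue alpha (tau n) i *: e i)
  (prior : nat -> probability (borel H1) R)
  (hprior : forall n, centered_gaussian ip1 (prior n) (Lam n))
  (* the functional L and its representer *)
  (L : H1 -> R)
  (hL : forall n, measurable_linear_functional (prior n) L)
  (l : nat -> R)
  (hl : forall n, representer L e (prior_eigenvalue alpha (tau n)) l)
  (q : R) (S : R -> R)
  (hqbeta : - beta < q) (hqp : q < p) (hS : slowly_varying S)
  (hlS : forall i, `|l i| = i.+1%:R `^ (- q - 2^-1) * S i.+1%:R)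
  (* square summability of (l_i sqrt(lambda_i)) forces q >= - 1/2 - alpha; in
     the equality case the posterior spread is not of the order of spread_rate
     and the coverage tends to 1 in (i) *)
  (hqalpha : - 2^-1 - alpha < q)
  (* the data Y, with law P n mu0 under mu0 *)
  (d : measure_display) (Omega : nat -> measurableType d)
  (P : forall n, H1 -> probability (Omega n) R)
  (Y : forall n, H2 -> {mfun Omega n >-> R})
  (hY : forall n mu0, (0 < n)%N ->
     white_noise_model ip2 (P n mu0) (Y n) (K mu0) n)
  (* LAY is the sum of the series of the terms LA_coef i * Y_(f_i) *)
  (LAY : forall n, {mfun Omega n >-> R})
  (hLAY : forall n mu0, (0 < n)%N ->
     {ae P n mu0, forall w,
        series (fun i => LA_coef n l (prior_eigenvalue alpha (tau n)) kappa i
                         * Y n ((kappa i)^-1 *: K (e i)) w) @ \oo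
        --> LAY n w})
  (gamma z : R) (hgamma : 0 < gamma < 1) (hz : normal_quantile (gamma / 2) z) :
  let cov := fun (n : nat) (mu0 : H1) =>
    coverage (P n mu0) (LAY n) z
      (posterior_sd n l (prior_eigenvalue alpha (tau n)) kappa)
      (functional_value ip1 e l mu0) in
  (forall ttau : nat -> R, balancing_scaling alpha p beta q S ttau ->
    (* (i) *)
    (asymp_small ttau tau ->
       asymp_in_uniformly (1 - gamma) 1 (sobolev_ball ip1 e beta) cov) /\
    (* (ii) *)
    (asymp_equiv tau ttau ->
       (beta + q < 1 + 2 * alpha + 2 * p ->
          forall mu0, sobolev_space ip1 e beta mu0 ->
            asymp_in (1 - gamma) 1 (fun n => cov n mu0)) /\
       (forall c : R, 0 < c < 1 -> exists mu : nat -> H1,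
          sobolev_bounded ip1 e beta mu /\
          asymp_in 0 c (fun n => cov n (mu n)))) /\
    (* (iii) *)
    (asymp_small tau ttau ->
       (exists mu : nat -> H1,
          sobolev_bounded ip1 e beta mu /\
          cov n (mu n) @[n --> \oo] --> 0%E) /\
       ((exists delta : R, 0 < delta /\
           asymp_bounded tau (fun n => n%:R `^ (- delta) * ttau n)) ->
        exists mu0 : H1,
          sobolev_space ip1 e beta mu0 /\
          cov n mu0 @[n --> \oo] --> 0%E))) /\
  ((forall n, tau n = 1) ->
    (alpha < beta - 2^-1 ->
       asymp_in_uniformly (1 - gamma) 1 (sobolev_ball ip1 e beta) cov) /\
    (alpha = beta - 2^-1 ->
       (beta + q < 1 + 2 * alpha + 2 * p ->
          forall mu0, sobolev_space ip1 e beta mu0 ->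
            asymp_in (1 - gamma) 1 (fun n => cov n mu0)) /\
       (forall c : R, 0 < c < 1 -> exists mu : nat -> H1,
          sobolev_bounded ip1 e beta mu /\
          asymp_in 0 c (fun n => cov n (mu n)))) /\
    (beta - 2^-1 < alpha ->
       exists mu0 : H1,
         sobolev_space ip1 e beta mu0 /\
         cov n mu0 @[n --> \oo] --> 0%E)).

Proof.
move=> cov.
have he1 := he.1.
have Pz : Phi z = gamma / 2 by exact: normal_quantile_Phi.
have hz0 : z < 0.
  by apply: Phi_inj_lt; rewrite Pz Phi0; have /andP[_ g1] := hgamma; lra.
have gE : 1 - gamma = 1 - 2 * Phi z by rewrite Pz; field.
have C1 := coverage_uniform hKT he1 hkappa halpha hp hC hkappaC htau hqbeta hqp hS hlS hqalpha hY hLAY hz0.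
have C2 := coverage_fixed hKT he1 hkappa halpha hp hC hkappaC htau hqbeta hqp hS hlS hqalpha hY hLAY hz0.
have C3 := coverage_critical hip1 hKT he1 hkappa halpha hp hbeta hC hkappaC htau hqbeta hqp hS hlS hqalpha hY hLAY hz0.
have C4 := coverage_worst hip1 hKT he1 hkappa halpha hp hbeta hC hkappaC htau hqbeta hqp hS hlS hqalpha hY hLAY hz0.
have C5 := coverage_worst_fixed hip1 hKT he1 hkappa halpha hp hbeta hC hkappaC htau hqbeta hqp hS hlS hqalpha hY hLAY hz0.
rewrite -gE in C1 C2.
have up (u v : nat -> R) : (exists D1 D2 : R, [/\ 0 < D1, 0 < D2 &
    \forall n \near \oo, D1 * v n <= u n <= D2 * v n]) ->
  exists D : R, 0 < D /\ \forall n \near \oo, u n <= D * v n.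
  move=> [D1 [D2 [_ D20 h]]]; exists D2; split => //.
  by apply: filterS h => n /andP[].
split.
  move=> ttau hbal; split; last split.
  - by move=> hs; apply: C1; exact: bias_negligible hs.
  - move=> hq; have hc := bias_comparable halpha hp hbeta hqp hS htau hbal hq.
    split; first by move=> ba mu0 hmu; apply: C2 => //; exact: up hc.
    by move=> c /andP[c0 _]; apply: C3.
  - move=> hs; split; first by apply: C4; exact: bias_dominant hs.
    move=> hd.
    have [eps [e0 h]] := bias_poly_dominant halpha hp hbeta hqp hS htau hbal hs hd.
    exact: C5 e0 h.
move=> tau1; split; last split.
- by move=> hab; apply: C1; exact: bias_negligible1.
- move=> hab; have hc := bias_comparable1 S halpha hp hqp tau1 hab.
  split; first by move=> ba mu0 hmu; apply: C2 => //; exact: up hc.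
  by move=> c /andP[c0 _]; apply: C3.
- move=> hab.
  have [eps [e0 h]] := bias_poly_dominant1 q halpha hp hS htau tau1 hab.
  exact: C5 e0 h.
Qed.
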